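(* For every $n\ge0$, the polynomials $Q_n$ and $Q_{n+1}$ have no common zeros in $S_0\setminus\{0\}$; between any two consecutive zeros of $Q_n$ in $(0,\alpha)$ there is exactly one zero of $Q_{n+1}$, and between any two consecutive zeros of $Q_{n+1}$ in $(0,\alpha)$ there is exactly one zero of $Q_n$. Likewise, for every $n\ge0$, $\Psi_n$ and $\Psi_{n+1}$ have no common zeros in $S_1$; between any two consecutive zeros of $\Psi_n$ in $(-b,-a)$ there is exactly one zero of $\Psi_{n+1}$, and vice versa.
   Context: Fix real numbers $0<\alpha<\infty$ and $0<a<b<\infty$, and let $\omega=e^{2\pi i/3}$. Let $S_0=\bigcup_{k=0}^{2}\omega^k[0,\alpha]$ and $S_1=\bigcup_{k=0}^{2}\omega^k[-b,-a]$. Let $s_1:S_0\to\mathbb{C}$ satisfy $s_1\ge 0$ on $(0,\alpha)$, $s_1\in L^1(0,\alpha)$, $s_1$ not a.e. zero on $(0,\alpha)$, and $s_1(\omega z)=\omega^2 s_1(z)$ for $z\in S_0\setminus\{0,\alpha,\omega\alpha,\omega^2\alpha\}$. For a function $g$ on $S_0$, $\int_{S_0}g(t)s_1(t)\,dt$ denotes the complex line integral along the three segments oriented from $0$ outward; by the symmetry of $s_1$ it equals $\sum_{k=0}^{2}\int_0^\alpha g(\omega^k x)s_1(x)\,dx$. Let $s_2\ge 0$ be integrable on $[-b,-a]$ and not a.e. zero, and put $f(z)=z^2\int_{-b}^{-a}\frac{s_2(t)}{z^3-t^3}\,dt$. For $n\ge0$, $Q_n$ denotes the monic polynomial of lowest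 degree such that $\int_{S_0}Q_{2n}(t)t^ks_1(t)dt=0$ and $\int_{S_0}Q_{2n}(t)t^kf(t)s_1(t)dt=0$ for $0\le k\le n-1$; and $\int_{S_0}Q_{2n+1}(t)t^ks_1(t)dt=0$ for $0\le k\le n$, $\int_{S_0}Q_{2n+1}(t)t^kf(t)s_1(t)dt=0$ for $0\le k\le n-1$. The functions of second type are $\Psi_n(z)=\int_{S_0}\frac{Q_n(t)}{t-z}s_1(t)\,dt$, $z\in\mathbb{C}\setminus S_0$. *)

(* Defs.v *)
From Stdlib Require Import Reals List.
Import ListNotations.
Open Scope R_scope.

Definition Cx := (R * R)%type.
Definition RtoC (x : R) : Cx := (x, 0).
Definition C0 : Cx := (0, 0).
Definition C1 : Cx := (1, 0).
Definition Cadd (z w : Cx) : Cx := (fst z + fst w, snd z + snd w).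
Definition Copp (z : Cx) : Cx := (- fst z, - snd z).
Definition Csub (z w : Cx) : Cx := Cadd z (Copp w).
Definition Cmul (z w : Cx) : Cx :=
  (fst z * fst w - snd z * snd w, fst z * snd w + snd z * fst w).
Definition Cinv (z : Cx) : Cx :=
  (fst z / (fst z ^ 2 + snd z ^ 2), - snd z / (fst z ^ 2 + snd z ^ 2)).
Definition Cdiv (z w : Cx) : Cx := Cmul z (Cinv w).
Fixpoint Cpow (z : Cx) (n : nat) : Cx :=
  match n with O => C1 | S m => Cmul z (Cpow z m) end.

(* omega = exp(2 pi i / 3) *)
Definition omega : Cx := (- (1/2), sqrt 3 / 2).

(* ---------- Polynomials: coefficient lists, lowest degree first ---------- *)
Definition cpoly := list Cx.
Definition peval (p : cpoly) (z : Cx) : Cx :=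
  fold_right (fun c acc => Cadd c (Cmul z acc)) C0 p.
(* monic: leading coefficient equals 1 (so deg p = length p - 1) *)
Definition monic (p : cpoly) : Prop := exists q, p = q ++ [C1].

(* ---------- Lebesgue integral on [a,b] (Riesz--Sz.-Nagy construction) ---- *)
Definition negligible (E : R -> Prop) : Prop :=
  forall eps, 0 < eps -> exists u v : nat -> R,
    (forall n, u n <= v n) /\
    (forall x, E x -> exists n, u n < x < v n) /\
    (forall N, sum_f_R0 (fun n => v n - u n) N <= eps).

Definition ae_on (a b : R) (P : R -> Prop) : Prop :=
  negligible (fun x => a <= x <= b /\ ~ P x).

Definition upper_int (a b : R) (f : R -> R) (I : R) : Prop :=
  exists phi : nat -> StepFun a b,
    (forall k x, a <= x <= b -> phi k x <= phi (S k) x) /\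
    ae_on a b (fun x => Un_cv (fun k => phi k x) (f x)) /\
    Un_cv (fun k => RiemannInt_SF (phi k)) I.

Definition has_int (a b : R) (f : R -> R) (I : R) : Prop :=
  exists g h Ig Ih, upper_int a b g Ig /\ upper_int a b h Ih /\
    ae_on a b (fun x => f x = g x - h x) /\ I = Ig - Ih.

Definition has_cint (a b : R) (f : R -> Cx) (I : Cx) : Prop :=
  has_int a b (fun x => fst (f x)) (fst I) /\ has_int a b (fun x => snd (f x)) (snd I).

Definition has_S0int (alpha : R) (s1 : R -> R) (g : Cx -> Cx) (I : Cx) : Prop :=
  exists I0 I1 I2,
    has_cint 0 alpha (fun x => Cmul (g (Cmul (Cpow omega 0) (RtoC x))) (RtoC (s1 x))) I0 /\
    has_cint 0 alpha (fun x => Cmul (g (Cmul (Cpow omega 1) (RtoC x))) (RtoC (s1 x))) I1 /\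
    has_cint 0 alpha (fun x => Cmul (g (Cmul (Cpow omega 2) (RtoC x))) (RtoC (s1 x))) I2 /\
    I = Cadd I0 (Cadd I1 I2).

Definition inS0 (alpha : R) (z : Cx) : Prop :=
  exists k x, (k < 3)%nat /\ 0 <= x <= alpha /\ z = Cmul (Cpow omega k) (RtoC x).
Definition inS1 (a b : R) (z : Cx) : Prop :=
  exists k x, (k < 3)%nat /\ - b <= x <= - a /\ z = Cmul (Cpow omega k) (RtoC x).

(* F plays the role of f (only its values on S0 matter) *)
Definition orth_conds (alpha : R) (s1 : R -> R) (F : Cx -> Cx) (p q : nat) (Q : cpoly) : Prop :=
  (forall k, (k < p)%nat ->
     has_S0int alpha s1 (fun t => Cmul (peval Q t) (Cpow t k)) C0) /\
  (forall k, (k < q)%nat ->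
     has_S0int alpha s1 (fun t => Cmul (Cmul (peval Q t) (Cpow t k)) (F t)) C0).

Definition Qcond (alpha : R) (s1 : R -> R) (F : Cx -> Cx) (m : nat) (Q : cpoly) : Prop :=
  forall n, (m = 2 * n -> orth_conds alpha s1 F n n Q)%nat /\
            (m = 2 * n + 1 -> orth_conds alpha s1 F (n + 1) n Q)%nat.

Definition IsQ (alpha : R) (s1 : R -> R) (F : Cx -> Cx) (m : nat) (Q : cpoly) : Prop :=
  monic Q /\ Qcond alpha s1 F m Q /\
  forall P, monic P -> Qcond alpha s1 F m P -> (length Q <= length P)%nat.

Definition Psi_zero (alpha : R) (s1 : R -> R) (Q : cpoly) (z : Cx) : Prop :=
  has_S0int alpha s1 (fun t => Cdiv (peval Q t) (Csub t z)) C0.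

Definition Q_zero (Q : cpoly) (x : R) : Prop := peval Q (RtoC x) = C0.

(* Main.v *)
From Stdlib Require Import FunctionalExtensionality Classical ClassicalEpsilon Permutation.
From Stdlib Require Import Reals List Lra Lia.
From Stdlib Require Cantor.
Require Import Defs.
Import ListNotations.
Open Scope R_scope.

(** In the variable [t = z^3] the residue classes of exponents modulo 3 decouple, and [Q_m] is
    [z^r g(z^3)] with [r = m mod 3] and [g] real, orthogonal with respect to a Nikishin system: to powers
    of [t] and to powers of [t] times the Markov function [h(t) = ∫ dσ(u) / (t - u)] of a positive measure
    on the negative axis.  The key fact is that a nonzero polynomial orthogonal to [A] consecutive powers
    and to [B <= A + 1] powers times [h] has degree at least [A + B].  Indeed, if
    [v = P1 + P2 h] vanishes at the zeros [xs] of such a polynomial, then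
    [v P2 = ω ∫ P2(u)^2 / ((t - u) ω(u)) dσ(u)] with [ω = ∏ (t - x)], so [v] changes sign exactly at [xs].
    Real combinations of two consecutive polynomials satisfy one relation less than their degree.  At a
    double zero [x0] the factor [(t - x0)^2] moves into the measure and the degree drops by two, which
    contradicts the bound; for the second kind functions a double zero [y0] moves [(t - y0)^-2] into the
    first and [(u - y0)^2] into the second measure and yields two more relations.  Hence both Wronskians
    have no zeros, and interlacing follows from Rolle's theorem applied to quotients. *)

(** * Step functions and coverings *)

(** The restriction [B <= A + 1] shapes the argument. In the identity for [v P2] the two sides
    differ by a polynomial, and the part coming from [P2^2] has up to [2B - 2] coefficients; the
    [A + B - 1] zeros force it to vanish only if [2B - 2 <= A + B - 1]. Which powers of [t] occur
    depends on [m] modulo 6: modulo 3 for the exponents, modulo 2 for the family that received the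
    last condition. In some classes the powers with [h] start one later; then [h] is replaced by
    [t h], which is again a Markov function up to sign and a constant, at the price [B <= A].
    Nonvanishing of the Wronskian presupposes that nontrivial combinations are nonzero: if the two
    polynomials were proportional, the earlier one would inherit a further relation and violate the
    degree bound. As they lie in different residue classes, one is multiplied by [t] when the
    residue passes from 2 to 0, which is invisible for [t > 0]. The same bound determines [Q_m]: a
    competitor of degree [m] found by linear algebra bounds its degree from above, and the other
    residue components and the imaginary part have too few coefficients to be nonzero. *)

Inductive stp (f : R -> R) : R -> R -> R -> Prop :=
| stp_nil a : stp f a a 0
| stp_cons a r b v I : a <= r -> (forall x, a < x < r -> f x = v) ->
    stp f r b I -> stp f a b (v * (r - a) + I).

Lemma stp_le f a b I : stp f a b I -> a <= b.
Proof. induction 1; lra. Qed.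

Lemma stp_const f a b v : a <= b -> (forall x, a < x < b -> f x = v) -> stp f a b (v * (b - a)).
Proof.
  intros H1 H2. replace (v * (b - a)) with (v * (b - a) + 0) by ring.
  apply stp_cons; auto. apply stp_nil.
Qed.

Lemma stp_cat f a r b I J : stp f a r I -> stp f r b J -> stp f a b (I + J).
Proof.
  induction 1 as [|a r' b' v I Hle Hv H IH]; intros HJ.
  - replace (0 + J) with J by ring. exact HJ.
  - replace (v * (r' - a) + I + J) with (v * (r' - a) + (I + J)) by ring.
    apply stp_cons; auto.
Qed.

Lemma stp_split f a b I : stp f a b I -> forall c, a <= c <= b ->
  exists I1 I2, stp f a c I1 /\ stp f c b I2 /\ I = I1 + I2.
Proof.
  induction 1 as [a|a r b v I Hle Hv H IH]; intros c Hc.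
  - replace c with a by lra. exists 0, 0. repeat split; try apply stp_nil; ring.
  - destruct (Rle_dec c r) as [Hcr|Hcr].
    + exists (v * (c - a)), (v * (r - c) + I). split; [|split].
      * apply stp_const; [lra|]. intros; apply Hv; lra.
      * apply stp_cons; auto. intros; apply Hv; lra.
      * ring.
    + destruct (IH c) as (I1 & I2 & H1 & H2 & E); [lra|].
      exists (v * (r - a) + I1), I2. split; [|split]; auto.
      * apply stp_cons; auto.
      * lra.
Qed.

Lemma stp_ext f g a b I : (forall x, a < x < b -> f x = g x) -> stp f a b I -> stp g a b I.
Proof.
  intros E H; revert E. induction H as [a|a r b v I Hle Hv H IH]; intros E.
  - apply stp_nil.
  - pose proof (stp_le _ _ _ _ H).
    apply stp_cons; auto.
    + intros x Hx. rewrite <- E by lra. auto.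
    + apply IH. intros; apply E; lra.
Qed.

Lemma stp_map_const (F : R -> R) f a b I : stp f a b I ->
  exists K, stp (fun x => F (f x)) a b K.
Proof.
  induction 1 as [a|a r b v I Hle Hv H [K IH]].
  - exists 0; apply stp_nil.
  - eexists. apply stp_cons with (v := F v); eauto.
    intros x Hx; now rewrite Hv.
Qed.

(** Instead of forming a common refinement of two subdivisions, the second function is cut at the
    first node of the first one, which is constant on that piece. *)
Lemma stp_map2 (F : R -> R -> R) f g a b I J : stp f a b I -> stp g a b J ->
  exists K, stp (fun x => F (f x) (g x)) a b K.
Proof.
  intros H; revert J. induction H as [a|a r b v I Hle Hv H IH]; intros J HJ.
  - exists 0; apply stp_nil.
  - destruct (stp_split _ _ _ _ HJ r) as (J1 & J2 & H1 & H2 & _).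
    { split; auto. eapply stp_le; eauto. }
    destruct (IH _ H2) as [K2 HK2].
    destruct (stp_map_const (F v) _ _ _ _ H1) as [K1 HK1].
    exists (K1 + K2). eapply stp_cat; eauto.
    eapply stp_ext; [|exact HK1]. intros x Hx; cbv beta. now rewrite Hv.
Qed.

Lemma stp_lin k f g a b I J : stp f a b I -> stp g a b J ->
  stp (fun x => f x + k * g x) a b (I + k * J).
Proof.
  intros H; revert J. induction H as [a|a r b v I Hle Hv H IH]; intros J HJ.
  - assert (J = 0) as ->.
    { clear -HJ. remember a as b in HJ at 2. induction HJ; auto.
      pose proof (stp_le _ _ _ _ HJ). subst b. replace r with a in * by lra.
      rewrite IHHJ by auto. ring. }
    replace (0 + k * 0) with 0 by ring. apply stp_nil.
  - destruct (stp_split _ _ _ _ HJ r) as (J1 & J2 & H1 & H2 & ->).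
    { split; auto. eapply stp_le; eauto. }
    replace (v * (r - a) + I + k * (J1 + J2)) with
      ((v * (r - a) + k * J1) + (I + k * J2)) by ring.
    eapply stp_cat; [|eauto].
    assert (E : stp (fun x => v + k * g x) a r (v * (r - a) + k * J1)).
    { clear -H1. induction H1 as [a|a r b w I Hle Hv H IH].
      - replace (v * (a - a) + k * 0) with 0 by ring. apply stp_nil.
      - replace (v * (b - a) + k * (w * (r - a) + I)) with
          ((v + k * w) * (r - a) + (v * (b - r) + k * I)) by ring.
        apply stp_cons; auto. intros; now rewrite Hv. }
    eapply stp_ext; [|exact E]. intros x Hx; cbv beta. now rewrite Hv.
Qed.

Lemma stp_ge0 f a b I : stp f a b I -> (forall x, a < x < b -> 0 <= f x) -> 0 <= I.
Proof.
  induction 1 as [a|a r b v I Hle Hv H IH]; intros Hf; [lra|].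
  pose proof (stp_le _ _ _ _ H).
  assert (0 <= I) by (apply IH; intros; apply Hf; lra).
  destruct (Req_dec a r) as [->|Hn]; [lra|].
  assert (0 <= v).
  { rewrite <- (Hv ((a + r) / 2)) by lra. apply Hf; lra. }
  nra.
Qed.

Lemma stp_mono f g a b I J : stp f a b I -> stp g a b J ->
  (forall x, a < x < b -> f x <= g x) -> I <= J.
Proof.
  intros H1 H2 H. pose proof (stp_lin (-1) _ _ _ _ _ _ H2 H1) as H3.
  apply stp_ge0 in H3; [lra|]. intros x Hx; specialize (H x Hx); lra.
Qed.

Lemma stp_uniq f a b I J : stp f a b I -> stp f a b J -> I = J.
Proof. intros; apply Rle_antisym; eapply stp_mono; eauto; intros; lra. Qed.

Lemma stp_bounded f a b I : stp f a b I -> exists M, 0 <= M /\ forall x, a <= x <= b -> Rabs (f x) <= M.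
Proof.
  induction 1 as [a|a r b v I Hle Hv H (M & HM & IH)].
  - exists (Rabs (f a)). split; [apply Rabs_pos|]. intros x Hx; replace x with a by lra; lra.
  - exists (Rabs (f a) + Rabs v + M).
    pose proof (Rabs_pos (f a)); pose proof (Rabs_pos v).
    split; [lra|]. intros x Hx.
    destruct (Req_dec x a) as [->|]; [lra|].
    destruct (Rlt_dec x r).
    + rewrite Hv by lra. lra.
    + specialize (IH x). lra.
Qed.

(** The list collects the nodes, where values are unconstrained. Away from them a bound at one point
    is a bound on an interval, which drives the compactness argument in [decr_step_int_to_0]. *)
Lemma stp_local f a b I : stp f a b I -> exists l : list R, forall s, a <= s <= b -> ~ In s l ->
  exists d, 0 < d /\ forall x, a <= x <= b -> Rabs (x - s) < d -> f x = f s.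
Proof.
  induction 1 as [a|a r b v I Hle Hv H (l & IH)].
  - exists []. intros s Hs _. exists 1. split; [lra|]. intros x Hx _. f_equal; lra.
  - pose proof (stp_le _ _ _ _ H).
    exists (a :: r :: l). intros s Hs Hn. simpl in Hn.
    destruct (Rlt_dec s r) as [Hsr|Hsr].
    + assert (a <> s) by tauto.
      exists (Rmin (s - a) (r - s)). split; [apply Rmin_glb_lt; lra|].
      intros x Hx Hd.
      assert (Rabs (x - s) < s - a /\ Rabs (x - s) < r - s) as [D1 D2].
      { split; eapply Rlt_le_trans; try exact Hd; [apply Rmin_l|apply Rmin_r]. }
      apply Rabs_def2 in D1, D2.
      rewrite !Hv; auto; lra.
    + assert (r <> s) by tauto.
      destruct (IH s) as (d & Hd & IH'); [lra|tauto|].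
      exists (Rmin d (s - r)). split; [apply Rmin_glb_lt; lra|].
      intros x Hx Hdd.
      assert (Rabs (x - s) < d /\ Rabs (x - s) < s - r) as [D1 D2].
      { split; eapply Rlt_le_trans; try exact Hdd; [apply Rmin_l|apply Rmin_r]. }
      apply IH'; auto. apply Rabs_def2 in D2. lra.
Qed.

Lemma stepfun_stp a b (phi : StepFun a b) : a <= b -> stp phi a b (RiemannInt_SF phi).
Proof.
  intros Hab. destruct phi as [f [l [lf Had]]].
  unfold RiemannInt_SF, subdivision_val, subdivision; simpl.
  destruct (Rle_dec a b) as [_|]; [|lra].
  destruct Had as (H1 & H2 & H3 & H4 & H5).
  rewrite Rmin_left in H2 by auto. rewrite Rmax_right in H3 by auto.
  clear Hab. revert l a b H1 H2 H3 H4 H5.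
  induction lf as [|v lf IH]; intros l a b H1 H2 H3 H4 H5.
  - destruct l as [|x [|y l]]; simpl in *; try discriminate.
    subst. apply stp_nil.
  - destruct l as [|x [|y l]]; simpl in *; try discriminate.
    subst x. apply stp_cons.
    + apply (H1 0%nat); simpl; lia.
    + apply (H5 0%nat); lia.
    + apply IH; simpl; auto.
      * intros i Hi. apply (H1 (S i)). simpl in *; lia.
      * intros i Hi. apply (H5 (S i)). simpl in *; lia.
Qed.

Lemma stp_stepfun f a b I : stp f a b I ->
  exists phi : StepFun a b, fe phi = f /\ RiemannInt_SF phi = I.
Proof.
  intros H. pose proof (stp_le _ _ _ _ H) as Hab.
  assert (exists l lf, adapted_couple f a b l lf) as (l & lf & Had).
  { induction H as [a|a r b v I Hle Hv H IH].
    - exists [a], []. repeat split; simpl.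
      + intros i Hi; simpl in Hi; lia.
      + rewrite Rmin_left; lra.
      + rewrite Rmax_left; lra.
      + intros i Hi; lia.
    - pose proof (stp_le _ _ _ _ H) as Hrb.
      destruct (IH Hrb) as (l & lf & H1 & H2 & H3 & H4 & H5).
      rewrite Rmin_left in H2 by lra. rewrite Rmax_right in H3 by lra.
      destruct l as [|y l]; [discriminate|]. simpl in H2, H3, H4. subst y.
      exists (a :: r :: l), (v :: lf). repeat split; simpl.
      + intros [|i] Hi; simpl; auto. apply (H1 i); simpl in *; lia.
      + rewrite Rmin_left; lra.
      + rewrite Rmax_right; lra.
      + now rewrite <- H4.
      + intros [|i] Hi; simpl; [exact Hv|]. apply (H5 i). simpl; lia. }
  set (phi := mkStepFun (existT (fun l => is_subdivision f a b l) l
                (existT (fun lf => adapted_couple f a b l lf) lf Had))).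
  exists phi. split; [reflexivity|].
  eapply stp_uniq; [|exact H]. exact (stepfun_stp a b phi Hab).
Qed.

(** A supremum argument in place of Heine-Borel, in a form that can accumulate an integral while the
    right end moves. *)
Lemma real_induction (P : R -> Prop) a b : a <= b -> P a ->
  (forall s, a <= s <= b -> exists d, 0 < d /\ forall x y, a <= x -> x <= y -> y <= b ->
     Rabs (x - s) < d -> Rabs (y - s) < d -> P x -> P y) -> P b.
Proof.
  intros Hab Ha Hs.
  set (E := fun c => a <= c <= b /\ P c).
  destruct (completeness E) as [s [Hub Hlub]].
  - exists b. intros c [Hc _]; lra.
  - exists a. split; auto; lra.
  - assert (a <= s) by (apply Hub; split; auto; lra).
    assert (s <= b) by (apply Hlub; intros c [Hc _]; lra).
    destruct (Hs s) as (d & Hd & Hstep); [lra|].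
    assert (exists x, E x /\ s - d < x) as (x & [Hx Px] & Hxs).
    { apply NNPP; intros N. assert (s <= s - d); [|lra].
      apply Hlub. intros c Hc. apply Rnot_lt_le; intros Hlt. apply N; eauto. }
    assert (x <= s) by (apply Hub; split; auto).
    assert (Rabs (x - s) < d) by (apply Rabs_def1; lra).
    destruct (Rlt_dec s b) as [Hsb|Hsb].
    + exfalso. set (y := Rmin b (s + d / 2)).
      assert (Hy : y <= b) by apply Rmin_l.
      assert (Hy' : y <= s + d / 2) by apply Rmin_r.
      assert (Hy2 : s < y) by (apply Rmin_glb_lt; lra).
      assert (y <= s); [|lra].
      apply Hub. split; [lra|]. apply (Hstep x y); try lra; auto.
      apply Rabs_def1; lra.
    + replace b with s by lra. apply (Hstep x s); try lra; auto.
      rewrite Rminus_diag, Rabs_R0; auto.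
Qed.

(** * Countable coverings and null sets *)

Definition lsum {X} (g : X -> R) (l : list X) : R := fold_right (fun x s => g x + s) 0 l.

Lemma lsum_app {X} (g : X -> R) l1 l2 : lsum g (l1 ++ l2) = lsum g l1 + lsum g l2.
Proof. induction l1; simpl; [|rewrite IHl1]; ring. Qed.

Lemma lsum_ge0 {X} (g : X -> R) l : (forall x, 0 <= g x) -> 0 <= lsum g l.
Proof. intros H; induction l; simpl; [lra|]. specialize (H a); lra. Qed.

Lemma lsum_incl {X} (g : X -> R) l1 l2 : (forall x, 0 <= g x) -> NoDup l1 -> incl l1 l2 ->
  lsum g l1 <= lsum g l2.
Proof.
  intros Hg Hn; revert l2. induction Hn as [|x l1 Hx Hn IH]; intros l2 Hi.
  - apply lsum_ge0; auto.
  - destruct (in_split x l2) as (m1 & m2 & ->); [apply Hi; left; auto|].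
    rewrite lsum_app; simpl.
    assert (lsum g l1 <= lsum g (m1 ++ m2)).
    { apply IH. intros y Hy. destruct (in_app_or m1 (x :: m2) y) as [|[->|]].
      - apply Hi; right; auto.
      - apply in_or_app; auto.
      - contradiction.
      - apply in_or_app; auto. }
    rewrite lsum_app in H. lra.
Qed.

Lemma lsum_map {X Y} (h : X -> Y) (g : Y -> R) l : lsum g (map h l) = lsum (fun x => g (h x)) l.
Proof. induction l; simpl; auto. now rewrite IHl. Qed.

Lemma lsum_prod {X Y} (g : X -> Y -> R) l1 l2 :
  lsum (fun p => g (fst p) (snd p)) (list_prod l1 l2) = lsum (fun x => lsum (g x) l2) l1.
Proof.
  induction l1; simpl; auto. rewrite lsum_app, IHl1. f_equal. now rewrite lsum_map.
Qed.

Lemma lsum_seq (g : nat -> R) N : sum_f_R0 g N = lsum g (seq 0 (S N)).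
Proof.
  induction N; [simpl; ring|].
  rewrite (seq_S (S N)), lsum_app, <- IHN. simpl. ring.
Qed.

(** [negligible] with the size fixed, so that total lengths can be added; [negligible E] means
    [covered E eps] for every positive [eps]. *)
Definition covered (E : R -> Prop) (eps : R) : Prop :=
  exists u v : nat -> R, (forall n, u n <= v n) /\ (forall x, E x -> exists n, u n < x < v n) /\
    (forall N, sum_f_R0 (fun n => v n - u n) N <= eps).

Lemma covered_sub (E E' : R -> Prop) e e' : (forall x, E x -> E' x) -> e' <= e ->
  covered E' e' -> covered E e.
Proof.
  intros H He (u & v & H1 & H2 & H3). exists u, v. repeat split; auto.
  intros N; specialize (H3 N); lra.
Qed.

Lemma covered_union (E : nat -> R -> Prop) (T : nat -> R) eps :
  (forall k, covered (E k) (T k)) -> (forall N, sum_f_R0 T N <= eps) ->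
  covered (fun x => exists k, E k x) eps.
Proof.
  intros HE HT.
  set (u := fun k => proj1_sig (constructive_indefinite_description _ (HE k))).
  assert (Hu : forall k, exists v : nat -> R, (forall n, u k n <= v n) /\
     (forall x, E k x -> exists n, u k n < x < v n) /\
     (forall N, sum_f_R0 (fun n => v n - u k n) N <= T k)).
  { intros k. exact (proj2_sig (constructive_indefinite_description _ (HE k))). }
  clearbody u.
  set (v := fun k => proj1_sig (constructive_indefinite_description _ (Hu k))).
  assert (Hv : forall k, (forall n, u k n <= v k n) /\
     (forall x, E k x -> exists n, u k n < x < v k n) /\
     (forall N, sum_f_R0 (fun n => v k n - u k n) N <= T k)).
  { intros k. exact (proj2_sig (constructive_indefinite_description _ (Hu k))). }
  clearbody v.
  exists (fun n => u (fst (Cantor.of_nat n)) (snd (Cantor.of_nat n))),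
         (fun n => v (fst (Cantor.of_nat n)) (snd (Cantor.of_nat n))).
  split; [|split].
  - intros n. apply Hv.
  - intros x [k Hk]. destruct (proj1 (proj2 (Hv k)) x Hk) as [i Hi].
    exists (Cantor.to_nat (k, i)). rewrite Cantor.cancel_of_to. exact Hi.
  - intros N. apply Rle_trans with (sum_f_R0 T N); auto.
    set (g := fun k i => v k i - u k i).
    assert (Hg : forall k i, 0 <= g k i).
    { intros k i. unfold g. pose proof (proj1 (Hv k) i). lra. }
    rewrite lsum_seq.
    change (lsum (fun n => g (fst (Cantor.of_nat n)) (snd (Cantor.of_nat n))) (seq 0 (S N)) <= sum_f_R0 T N).
    rewrite <- (lsum_map Cantor.of_nat (fun p => g (fst p) (snd p))).
    (* A Cantor code is at least as large as both coordinates, so the first [N + 1] pairs lie in the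
       square of indices up to [N], whose rows are bounded by the [T k]. *)
    apply Rle_trans with (lsum (fun p => g (fst p) (snd p)) (list_prod (seq 0 (S N)) (seq 0 (S N)))).
    + apply lsum_incl.
      * intros; apply Hg.
      * apply FinFun.Injective_map_NoDup; [|apply seq_NoDup].
        intros x y Hxy. rewrite <- (Cantor.cancel_to_of x), Hxy. apply Cantor.cancel_to_of.
      * intros [k i] Hp. apply in_map_iff in Hp. destruct Hp as (n & Hn & Hin).
        apply in_seq in Hin.
        pose proof (Cantor.to_nat_non_decreasing k i) as Hki.
        rewrite <- Hn, Cantor.cancel_to_of in Hki.
        apply in_prod; apply in_seq; lia.
    + rewrite lsum_prod, <- lsum_seq. apply sum_Rle. intros k Hk.
      rewrite <- lsum_seq. apply Hv.
Qed.

Lemma covered_list (E : R -> Prop) (L : list (R * R)) :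
  (forall p, In p L -> fst p <= snd p) -> (forall x, E x -> exists p, In p L /\ fst p < x < snd p) ->
  covered E (lsum (fun p => snd p - fst p) L).
Proof.
  intros H1 H2.
  (* Beyond the end of the list the default [(0, 0)] contributes empty intervals. *)
  exists (fun n => fst (nth n L (0, 0))), (fun n => snd (nth n L (0, 0))).
  assert (Hle : forall n, fst (nth n L (0, 0)) <= snd (nth n L (0, 0))).
  { intros n. destruct (nth_in_or_default n L (0, 0)) as [Hin| ->]; [auto|simpl; lra]. }
  split; [|split]; auto.
  - intros x Hx. destruct (H2 x Hx) as (p & Hp & Hpx).
    destruct (In_nth L p (0, 0) Hp) as (n & _ & Hn). exists n. now rewrite Hn.
  - clear H2. intros N. revert N. induction L as [|p L IH]; intros N.
    + simpl. right. clear. induction N as [|N IHN]; simpl; [ring|]. rewrite IHN; ring.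
    + assert (E0 : sum_f_R0 (fun n => snd (nth n (p :: L) (0, 0)) - fst (nth n (p :: L) (0, 0))) N
        <= (snd p - fst p) + sum_f_R0 (fun n => snd (nth n L (0, 0)) - fst (nth n L (0, 0))) N).
      { clear -Hle. destruct N as [|N].
        - pose proof (Hle 1%nat). simpl in *. lra.
        - rewrite decomp_sum by lia. simpl pred.
          pose proof (Hle (S (S N))) as H. simpl in H. simpl. lra. }
      assert (IH' : sum_f_R0 (fun n => snd (nth n L (0, 0)) - fst (nth n L (0, 0))) N <=
        lsum (fun p => snd p - fst p) L).
      { apply IH. { intros q Hq; apply H1; right; auto. }
        intros n. apply (Hle (S n)). }
      simpl lsum. lra.
Qed.

Lemma sum_half e N : 0 < e -> sum_f_R0 (fun k => e / 2 ^ (S k)) N <= e.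
Proof.
  intros He. assert (sum_f_R0 (fun k => e / 2 ^ (S k)) N = e - e / 2 ^ (S N)) as ->.
  { induction N; simpl in *; [|rewrite IHN]; field; try (apply pow_nonzero; lra). }
  assert (0 < e / 2 ^ S N); [|lra]. apply Rdiv_lt_0_compat; auto. apply pow_lt; lra.
Qed.

Lemma half_pos e k : 0 < e -> 0 < e / 2 ^ (S k).
Proof. intros; apply Rdiv_lt_0_compat; auto. apply pow_lt; lra. Qed.

Lemma negligible_sub (E E' : R -> Prop) : (forall x, E x -> E' x) -> negligible E' -> negligible E.
Proof. intros H HE eps He. destruct (HE eps He) as (u & v & H1 & H2 & H3). exists u, v; auto. Qed.

Lemma negligible_union (E : nat -> R -> Prop) :
  (forall k, negligible (E k)) -> negligible (fun x => exists k, E k x).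
Proof.
  intros H eps He. apply (covered_union E (fun k => eps / 2 ^ (S k))).
  - intros k. apply (H k). now apply half_pos.
  - intros; now apply sum_half.
Qed.

Lemma negligible_or (E E' : R -> Prop) : negligible E -> negligible E' ->
  negligible (fun x => E x \/ E' x).
Proof.
  intros H H'. apply negligible_sub with (fun x => exists k : nat, match k with O => E x | _ => E' x end).
  - intros x [Hx|Hx]; [exists 0%nat|exists 1%nat]; auto.
  - apply negligible_union with (E := fun k x => match k with O => E x | _ => E' x end).
    intros [|k]; auto.
Qed.

Lemma covered_finite (l : list R) d : 0 < d -> covered (fun x => In x l) d.
Proof.
  (* Intervals of radius [e] around the points of [l]; the [+ 1] takes care of the empty list. *)
  intros Hd. set (n := length l). set (e := d / 2 / (INR n + 1)).
  pose proof (pos_INR n) as Hn.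
  assert (He : 0 < e). { unfold e. apply Rdiv_lt_0_compat; lra. }
  apply covered_sub with (E' := fun x => In x l)
    (e' := lsum (fun p => snd p - fst p) (map (fun x => (x - e, x + e)) l)); auto.
  - rewrite lsum_map.
    assert (Hl : forall (e : R) l, lsum (fun x => snd (x - e, x + e) - fst (x - e, x + e)) l = INR (length l) * (2 * e)).
    { clear. intros e l. induction l as [|x l IH]; [simpl; ring|].
      change (length (x :: l)) with (S (length l)). rewrite S_INR. simpl in *. rewrite IH. ring. }
    rewrite Hl. fold n.
    replace d with ((INR n + 1) * (2 * e)) by (unfold e; field; lra). nra.
  - apply covered_list.
    + intros p Hp. apply in_map_iff in Hp. destruct Hp as (x & <- & _). simpl; lra.
    + intros x Hx. exists (x - e, x + e). split; [apply in_map_iff; eauto|simpl; lra].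
Qed.

Lemma negligible_finite (l : list R) : negligible (fun x => In x l).
Proof. intros e He. now apply covered_finite. Qed.

(** Chebyshev's inequality: the pieces with value at least 1 have total length at most [I]. The
    slack [d] pays for the nodes, where [f] may be large without contributing to [I]. *)
Lemma stp_covered f a b I : stp f a b I -> (forall x, a < x < b -> 0 <= f x) -> forall d, 0 < d ->
  covered (fun x => a <= x <= b /\ 1 <= f x) (I + d).
Proof.
  intros H Hf d Hd.
  assert (exists (L : list (R * R)) (l : list R), (forall p, In p L -> fst p <= snd p) /\
    (forall x, a <= x <= b /\ 1 <= f x -> In x l \/ exists p, In p L /\ fst p < x < snd p) /\
    lsum (fun p => snd p - fst p) L <= I) as (L & l & HL1 & HL2 & HL3).
  { clear d Hd. induction H as [a|a r b v I Hle Hv H IH].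
    - exists [], [a]. simpl. repeat split; try tauto; [|lra]. intros x [Hx _]. left; left; lra.
    - pose proof (stp_le _ _ _ _ H) as Hrb.
      destruct IH as (L & l & H1 & H2 & H3). { intros; apply Hf; lra. }
      destruct (Rle_dec 1 v) as [Hv1|Hv1].
      + exists ((a, r) :: L), (a :: r :: l). split; [|split].
        * intros p [<-|Hp]; auto.
        * intros x [Hx Hfx]. destruct (Req_dec a x); [left; left; auto|].
          destruct (Req_dec r x); [left; right; left; auto|].
          destruct (Rlt_dec x r).
          -- right. exists (a, r). split; [left; auto|simpl; lra].
          -- destruct (H2 x) as [|(p & Hp & Hpx)]; [split; auto; lra|left; right; right; auto|].
             right. exists p. split; [right; auto|auto].
        * simpl. nra.
      + exists L, (a :: r :: l). split; [|split]; auto.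
        * intros x [Hx Hfx]. destruct (Req_dec a x); [left; left; auto|].
          destruct (Req_dec r x); [left; right; left; auto|].
          destruct (Rlt_dec x r).
          -- rewrite Hv in Hfx by lra. lra.
          -- destruct (H2 x) as [|(p & Hp & Hpx)]; [split; auto; lra|left; right; right; auto|].
             right. exists p. auto.
        * destruct (Req_dec a r) as [->|]; [lra|].
          assert (0 <= v). { rewrite <- (Hv ((a + r) / 2)) by lra. apply Hf; lra. }
          nra. }
  assert (HC : covered (fun x => exists k : nat, match k with O => exists p, In p L /\ fst p < x < snd p
     | _ => In x l end) (I + d)).
  { apply (covered_union (fun k x => match k with O => exists p, In p L /\ fst p < x < snd p
       | _ => In x l end) (fun k => match k with O => I | S j => d / 2 ^ (S j) end)).
    - intros [|k].
      + eapply covered_sub; [| |apply (covered_list _ L HL1)]; [|exact HL3|].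
        * intros x Hx; exact Hx.
        * auto.
      + apply covered_finite. now apply half_pos.
    - intros [|N]; [simpl; lra|]. rewrite decomp_sum by lia. simpl pred.
      pose proof (sum_half d N Hd). lra. }
  eapply covered_sub; [|apply Rle_refl|exact HC].
  intros x Hx. destruct (HL2 x Hx); [exists 1%nat|exists 0%nat]; auto.
Qed.

(** * The Lebesgue integral *)

Lemma ae_imp a b (P Q : R -> Prop) : (forall x, a <= x <= b -> P x -> Q x) -> ae_on a b P -> ae_on a b Q.
Proof. intros H. apply negligible_sub. intros x [Hx Hq]. split; auto. Qed.

Lemma ae_and a b (P Q : R -> Prop) : ae_on a b P -> ae_on a b Q -> ae_on a b (fun x => P x /\ Q x).
Proof.
  intros HP HQ. eapply negligible_sub; [|apply (negligible_or _ _ HP HQ)].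
  intros x [Hx Hn]. destruct (classic (P x)); [right|left]; tauto.
Qed.

Lemma ae_all a b (P : R -> Prop) : (forall x, a <= x <= b -> P x) -> ae_on a b P.
Proof.
  intros H. eapply negligible_sub; [|apply (negligible_finite [])].
  intros x [Hx Hn]. destruct Hn; auto.
Qed.

Lemma decr_le (phi : nat -> R -> R) x : (forall k, phi (S k) x <= phi k x) ->
  forall j k, (j <= k)%nat -> phi k x <= phi j x.
Proof. intros H j k. induction 1; [lra|]. specialize (H m). lra. Qed.

(** A lemma of F. Riesz. Around a good point some [phi k] is constant and small; around an
    exceptional point the uniform bound [M] meets a covering of small total length. [real_induction]
    adds up both contributions from [a] to [b]. *)
Lemma decr_step_int_to_0 a b (phi : nat -> R -> R) J : a <= b ->
  (forall k, stp (phi k) a b (J k)) ->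
  (forall k x, a <= x <= b -> phi (S k) x <= phi k x) ->
  ae_on a b (fun x => forall e, 0 < e -> exists k, phi k x < e) ->
  forall e, 0 < e -> exists K, J K <= e.
Proof.
  intros Hab Hs Hd Hae e He.
  destruct (stp_bounded _ _ _ _ (Hs 0%nat)) as (M0 & HM0 & HM).
  set (M := M0 + 1).
  assert (Hl : forall k, exists l : list R, forall s, a <= s <= b -> ~ In s l ->
    exists d, 0 < d /\ forall x, a <= x <= b -> Rabs (x - s) < d -> phi k x = phi k s).
  { intros k. eapply stp_local; eauto. }
  set (l := fun k => proj1_sig (constructive_indefinite_description _ (Hl k))).
  assert (Hl' : forall k s, a <= s <= b -> ~ In s (l k) ->
    exists d, 0 < d /\ forall x, a <= x <= b -> Rabs (x - s) < d -> phi k x = phi k s).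
  { intros k. exact (proj2_sig (constructive_indefinite_description _ (Hl k))). }
  clearbody l.
  (* The nodes of all [phi k] join the exceptional set, so that at every other point some [phi k] is
     small and locally constant. *)
  pose proof (negligible_or _ _ Hae (negligible_union (fun k x => In x (l k)) (fun k => negligible_finite (l k)))) as HN.
  (* Each contribution gets half of [e]: height [e2] on the good part, total length [e1] for the
     covering. *)
  set (e2 := e / 2 / (b - a + 1)). set (e1 := e / 2 / M).
  assert (He2 : 0 < e2) by (unfold e2; apply Rdiv_lt_0_compat; lra).
  assert (He1 : 0 < e1) by (unfold e1; apply Rdiv_lt_0_compat; unfold M; lra).
  destruct (HN e1 He1) as (u & v & Huv & Hcov & Hsum). clear HN.
  (* The length of the part of the [n]-th covering interval to the left of [c]. *)
  set (len := fun n c => Rmax 0 (Rmin c (v n) - u n)).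
  assert (Hlen0 : forall n c, 0 <= len n c) by (intros; apply Rmax_l).
  assert (Hlenm : forall n x y, x <= y -> len n x <= len n y).
  { intros n x y Hxy. unfold len, Rmax, Rmin. repeat destruct (Rle_dec _ _); lra. }
  assert (Hlenb : forall n c, len n c <= v n - u n).
  { intros n c. specialize (Huv n). unfold len, Rmax, Rmin. repeat destruct (Rle_dec _ _); lra. }
  (* Up to [c] finitely many covering intervals have been used, and one threshold [K] serves all
     later [k]; both may grow as [c] advances. *)
  set (P := fun c => exists N K, forall k, (K <= k)%nat -> forall I, stp (phi k) a c I ->
     I <= e2 * (c - a) + M * sum_f_R0 (fun n => len n c) N).
  assert (HP : P b).
  { apply (real_induction P a b); auto.
    - exists 0%nat, 0%nat. intros k _ I HI.
      rewrite (stp_uniq _ _ _ _ _ HI (stp_nil _ _)). specialize (Hlen0 0%nat a).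
      simpl. unfold M. nra.
    - intros s Hsab.
      assert (Hmono : forall x y, x <= y -> forall n N N', (N <= N')%nat -> (n <= N')%nat ->
        sum_f_R0 (fun n => len n x) N + (len n y - len n x) <= sum_f_R0 (fun n => len n y) N').
      { intros x y Hxy n N N' HNN Hn.
        apply Rle_trans with (sum_f_R0 (fun n => len n x) N' + (len n y - len n x)).
        - apply Rplus_le_compat_r. clear -HNN Hlen0. induction HNN; [lra|].
          simpl. specialize (Hlen0 (S m) x). lra.
        - clear HNN. induction N' as [|N' IH]; simpl.
          + replace n with 0%nat by lia. lra.
          + destruct (Nat.eq_dec n (S N')) as [->|Hne].
            * assert (sum_f_R0 (fun n => len n x) N' <= sum_f_R0 (fun n => len n y) N').
              { apply sum_Rle. intros; auto. }
              lra.
            * specialize (IH ltac:(lia)). specialize (Hlenm (S N') x y Hxy). lra. }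
      destruct (classic ((a <= s <= b /\ ~ (forall e, 0 < e -> exists k, phi k s < e)) \/ exists k, In s (l k))) as [HE|HE].
      (* Near an exceptional [s] the passage from [x] to [y] stays inside one covering interval, so
         [y - x] is exactly the growth of [len n]. *)
      + destruct (Hcov s HE) as [n Hn].
        exists (Rmin (s - u n) (v n - s)). split; [apply Rmin_glb_lt; lra|].
        intros x y Hax Hxy Hyb Hx Hy (N & K & HPx).
        assert (u n < x /\ y < v n) as [Hux Hyv].
        { assert (Rabs (x - s) < s - u n) by (eapply Rlt_le_trans; [exact Hx|apply Rmin_l]).
          assert (Rabs (y - s) < v n - s) by (eapply Rlt_le_trans; [exact Hy|apply Rmin_r]).
          apply Rabs_def2 in H, H0. lra. }
        exists (Nat.max N n), K. intros k Hk I HI.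
        destruct (stp_split _ _ _ _ HI x) as (I1 & I2 & H1 & H2 & ->); [lra|].
        specialize (HPx k Hk I1 H1).
        assert (I2 <= M * (y - x)).
        { eapply stp_mono; [exact H2| apply (stp_const (fun _ => M)); [lra|auto]|].
          intros z Hz. cbv beta. pose proof (decr_le phi z (fun k => Hd k z ltac:(lra)) 0 k ltac:(lia)).
          specialize (HM z ltac:(lra)). pose proof (Rle_abs (phi 0%nat z)). unfold M; lra. }
        assert (len n y - len n x = y - x).
        { unfold len. rewrite !(Rmin_left _ (v n)), !Rmax_right by lra. ring. }
        specialize (Hmono x y Hxy n N (Nat.max N n) ltac:(lia) ltac:(lia)).
        rewrite H0 in Hmono. unfold M in *. nra.
      + assert (Hc : forall e, 0 < e -> exists k, phi k s < e).
        { apply NNPP; intros Hn. apply HE; left; tauto. }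
        destruct (Hc e2 He2) as [K0 HK0].
        destruct (Hl' K0 s Hsab) as (d & Hd0 & Hloc). { intros Hin; apply HE; right; eauto. }
        exists d. split; auto. intros x y Hax Hxy Hyb Hx Hy (N & K & HPx).
        exists N, (Nat.max K K0). intros k Hk I HI.
        destruct (stp_split _ _ _ _ HI x) as (I1 & I2 & H1 & H2 & ->); [lra|].
        specialize (HPx k ltac:(lia) I1 H1).
        assert (I2 <= e2 * (y - x)).
        { eapply stp_mono; [exact H2| apply (stp_const (fun _ => e2)); [lra|auto]|].
          intros z Hz. cbv beta. pose proof (decr_le phi z (fun k => Hd k z ltac:(lra)) K0 k ltac:(lia)).
          rewrite (Hloc z) in H; [lra|lra|]. apply Rabs_def2 in Hx, Hy. apply Rabs_def1; lra. }
        assert (sum_f_R0 (fun n => len n x) N <= sum_f_R0 (fun n => len n y) N).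
        { apply sum_Rle. intros; auto. }
        unfold M in *. nra. }
  destruct HP as (N & K & HP). exists K. specialize (HP K ltac:(lia) _ (Hs K)).
  assert (sum_f_R0 (fun n => len n b) N <= e1).
  { eapply Rle_trans; [|apply (Hsum N)]. apply sum_Rle. intros; auto. }
  assert (M * sum_f_R0 (fun n => len n b) N <= e / 2).
  { replace (e / 2) with (M * e1) by (unfold e1, M; field; lra). unfold M; nra. }
  assert (e2 * (b - a) <= e / 2).
  { replace (e / 2) with (e2 * (b - a + 1)) by (unfold e2; field; lra). nra. }
  lra.
Qed.

Definition ups a b (f : R -> R) (I : R) : Prop := exists (phi : nat -> R -> R) (J : nat -> R),
  (forall k, stp (phi k) a b (J k)) /\
  (forall k x, a <= x <= b -> phi k x <= phi (S k) x) /\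
  ae_on a b (fun x => Un_cv (fun k => phi k x) (f x)) /\ Un_cv J I.

Lemma upper_int_ups a b f I : a <= b -> upper_int a b f I <-> ups a b f I.
Proof.
  intros Hab. split.
  - intros (phi & H1 & H2 & H3). exists (fun k => fe (phi k)), (fun k => RiemannInt_SF (phi k)).
    repeat split; auto. intros k. now apply stepfun_stp.
  - intros (phi & J & H0 & H1 & H2 & H3).
    assert (Hp : forall k, exists p : StepFun a b, fe p = phi k /\ RiemannInt_SF p = J k).
    { intros k. now apply stp_stepfun. }
    set (p := fun k => proj1_sig (constructive_indefinite_description _ (Hp k))).
    assert (Hp' : forall k, fe (p k) = phi k /\ RiemannInt_SF (p k) = J k).
    { intros k. exact (proj2_sig (constructive_indefinite_description _ (Hp k))). }
    clearbody p. exists p. repeat split.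
    + intros k x Hx. rewrite !(proj1 (Hp' _)). auto.
    + eapply ae_imp; [|exact H2]. intros x Hx Hcv e He. destruct (Hcv e He) as [N HN].
      exists N. intros n Hn. rewrite (proj1 (Hp' n)). auto.
    + intros e He. destruct (H3 e He) as [N HN].
      exists N. intros n Hn. rewrite (proj2 (Hp' n)). auto.
Qed.

Lemma stp_incr_int a b phi J : (forall k, stp (phi k) a b (J k)) ->
  (forall k x, a <= x <= b -> phi k x <= phi (S k) x) -> Un_growing J.
Proof. intros H1 H2 k. eapply stp_mono; eauto. intros; apply H2; lra. Qed.

(** [decr_step_int_to_0] applies to [(psi - phi k)^+], which decreases to 0 almost everywhere. *)
Lemma step_le_ups a b psi I0 g I : a <= b -> stp psi a b I0 -> ups a b g I ->
  ae_on a b (fun x => psi x <= g x) -> I0 <= I.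
Proof.
  intros Hab Hpsi (phi & J & H0 & H1 & H2 & H3) Hle.
  pose proof (growing_ineq J I (stp_incr_int _ _ _ _ H0 H1) H3) as HJ.
  set (th := fun k x => Rmax (psi x - phi k x) 0).
  assert (Hth : forall k, exists K, stp (th k) a b K).
  { intros k. apply (stp_map2 (fun s t => Rmax (s - t) 0) psi (phi k) a b _ _ Hpsi (H0 k)). }
  set (K := fun k => proj1_sig (constructive_indefinite_description _ (Hth k))).
  assert (HK : forall k, stp (th k) a b (K k)).
  { intros k. exact (proj2_sig (constructive_indefinite_description _ (Hth k))). }
  clearbody K. apply le_epsilon. intros e He.
  destruct (decr_step_int_to_0 a b th K Hab HK) with (e := e) as [n Hn]; auto.
  - intros k x Hx. unfold th. specialize (H1 k x Hx). unfold Rmax.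
    repeat destruct (Rle_dec _ _); lra.
  - eapply ae_imp; [|apply (ae_and _ _ _ _ H2 Hle)]. intros x Hx [Hcv Hxle] d Hd.
    destruct (Hcv d Hd) as [N HN]. specialize (HN N ltac:(lia)). unfold Rdist in HN.
    apply Rabs_def2 in HN. exists N. unfold th. apply Rmax_lub_lt; lra.
  - assert (I0 + -1 * J n <= K n).
    { eapply stp_mono; [apply (stp_lin (-1) _ _ _ _ _ _ Hpsi (H0 n))|apply HK|].
      intros x Hx. unfold th. eapply Rle_trans; [|apply Rmax_l]. lra. }
    specialize (HJ n). lra.
Qed.

Lemma incr_cv_le (u : nat -> R) l : (forall k, u k <= u (S k)) -> Un_cv u l -> forall k, u k <= l.
Proof. intros H Hc k. apply (growing_ineq u l); auto. Qed.

Lemma ups_mono a b f g I I' : a <= b -> ups a b f I -> ups a b g I' ->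
  ae_on a b (fun x => f x <= g x) -> I <= I'.
Proof.
  intros Hab (phi & J & H0 & H1 & H2 & H3) Hg Hle.
  apply Rle_cv_lim with (Un := J) (Vn := fun _ => I'); auto.
  - intros k. eapply step_le_ups; eauto.
    eapply ae_imp; [|apply (ae_and _ _ _ _ H2 Hle)]. intros x Hx [Hc Hxle].
    pose proof (incr_cv_le (fun k => phi k x) (f x) (fun k => H1 k x Hx) Hc k). simpl in H. lra.
  - intros e He. exists 0%nat. intros; rewrite Rdist_eq; auto.
Qed.

Lemma Un_cv_lin u v l m k : Un_cv u l -> Un_cv v m -> Un_cv (fun n => u n + k * v n) (l + k * m).
Proof.
  intros Hu Hv. apply CV_plus with (Bn := fun n => k * v n); auto.
  apply CV_mult with (An := fun _ => k); auto.
  intros e He. exists 0%nat. intros; rewrite Rdist_eq; auto.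
Qed.

Lemma ups_lin a b f g I I' k : 0 <= k -> ups a b f I -> ups a b g I' ->
  ups a b (fun x => f x + k * g x) (I + k * I').
Proof.
  intros Hk (phi & J & H0 & H1 & H2 & H3) (psi & J' & H0' & H1' & H2' & H3').
  exists (fun n x => phi n x + k * psi n x), (fun n => J n + k * J' n).
  repeat split.
  - intros n. apply stp_lin; auto.
  - intros n x Hx. specialize (H1 n x Hx). specialize (H1' n x Hx). nra.
  - eapply ae_imp; [|apply (ae_and _ _ _ _ H2 H2')]. intros x Hx [Hc Hc']. now apply Un_cv_lin.
  - now apply Un_cv_lin.
Qed.

Lemma has_int_ups a b f I : a <= b -> has_int a b f I <->
  exists g h Ig Ih, ups a b g Ig /\ ups a b h Ih /\ ae_on a b (fun x => f x = g x - h x) /\ I = Ig - Ih.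
Proof.
  intros Hab. split; intros (g & h & Ig & Ih & H1 & H2 & H3 & H4);
  exists g, h, Ig, Ih; repeat split; auto; apply upper_int_ups; auto.
Qed.

Lemma has_int_ae_ext a b f f' I : ae_on a b (fun x => f x = f' x) -> has_int a b f I -> has_int a b f' I.
Proof.
  intros He (g & h & Ig & Ih & H1 & H2 & H3 & H4). exists g, h, Ig, Ih. repeat split; auto.
  eapply ae_imp; [|apply (ae_and _ _ _ _ He H3)]. intros x Hx [<- E]. exact E.
Qed.

Lemma has_int_ext a b f f' I : (forall x, a <= x <= b -> f x = f' x) -> has_int a b f I -> has_int a b f' I.
Proof. intros H. apply has_int_ae_ext. now apply ae_all. Qed.

Lemma has_int_nonneg a b f I : a <= b -> has_int a b f I -> ae_on a b (fun x => 0 <= f x) -> 0 <= I.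
Proof.
  intros Hab Hf Hp. apply has_int_ups in Hf as (g & h & Ig & Ih & H1 & H2 & H3 & ->); auto.
  assert (Ih <= Ig); [|lra].
  eapply ups_mono; eauto. eapply ae_imp; [|apply (ae_and _ _ _ _ Hp H3)].
  cbv beta. intros x Hx [H E]. lra.
Qed.

Lemma has_int_lin a b f f' I I' k : a <= b -> has_int a b f I -> has_int a b f' I' ->
  has_int a b (fun x => f x + k * f' x) (I + k * I').
Proof.
  intros Hab Hf Hf'. apply has_int_ups in Hf as (g & h & Ig & Ih & H1 & H2 & H3 & ->); auto.
  apply has_int_ups in Hf' as (g' & h' & Ig' & Ih' & H1' & H2' & H3' & ->); auto.
  apply has_int_ups; auto.
  destruct (Rle_dec 0 k) as [Hk|Hk].
  - exists (fun x => g x + k * g' x), (fun x => h x + k * h' x), (Ig + k * Ig'), (Ih + k * Ih').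
    repeat split; try (apply ups_lin; auto); [|ring].
    eapply ae_imp; [|apply (ae_and _ _ _ _ H3 H3')]. intros x Hx [-> ->]. ring.
  (* [ups] is closed under nonnegative multiples only, so for negative [k] the two parts of [f']
     change places. *)
  - exists (fun x => g x + - k * h' x), (fun x => h x + - k * g' x), (Ig + - k * Ih'), (Ih + - k * Ig').
    repeat split; try (apply ups_lin; auto; lra); [|ring].
    eapply ae_imp; [|apply (ae_and _ _ _ _ H3 H3')]. intros x Hx [-> ->]. ring.
Qed.

Lemma has_int_mono a b f f' I I' : a <= b -> has_int a b f I -> has_int a b f' I' ->
  (forall x, a <= x <= b -> f x <= f' x) -> I <= I'.
Proof.
  intros Hab H1 H2 Hle. pose proof (has_int_lin _ _ _ _ _ _ (-1) Hab H2 H1) as H.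
  apply has_int_nonneg in H; auto; [lra|]. apply ae_all. intros x Hx. specialize (Hle x Hx). lra.
Qed.

Lemma has_int_uniq a b f I I' : a <= b -> has_int a b f I -> has_int a b f I' -> I = I'.
Proof. intros; apply Rle_antisym; eapply has_int_mono; eauto; intros; lra. Qed.

(* If [f = g - h] with [∫ g = ∫ h], cover [{f > 1/m}] by the increasing step sets
   [{m (phi_j - psi_k)^+ >= 1}], where [phi_j] increases to [g] and [psi_k <= h] has [∫ psi_k] close to [∫ h]. *)
Lemma has_int_zero a b f : a <= b -> has_int a b f 0 -> ae_on a b (fun x => 0 <= f x) ->
  ae_on a b (fun x => f x = 0).
Proof.
  intros Hab Hf Hp. apply has_int_ups in Hf as (g & h & Ig & Ih & Hg & Hh & E & EI); auto.
  assert (Ih = Ig) by lra. subst Ih. clear EI.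
  pose proof Hg as (phi & J & F0 & F1 & F2 & F3). pose proof Hh as (psi & J' & S0 & S1 & S2 & S3).
  set (good := fun x => 0 <= f x /\ f x = g x - h x /\ Un_cv (fun k => phi k x) (g x) /\ Un_cv (fun k => psi k x) (h x)).
  assert (Hgood : ae_on a b good).
  { repeat apply ae_and; auto. }
  assert (Hm : forall m : nat, negligible (fun x => a <= x <= b /\ good x /\ 1 < INR (S m) * f x)).
  { intros m e He. set (q := INR (S m)).
    assert (Hq : 0 < q) by (apply lt_0_INR; lia).
    (* With this [k], the integral of [q (max(phi_j, psi_k) - psi_k)] is at most [e / 2] for every
       [j]. *)
    destruct (S3 (e / 2 / q)) as [k Hk]. { repeat apply Rdiv_lt_0_compat; lra. }
    specialize (Hk k ltac:(lia)). unfold Rdist in Hk. apply Rabs_def2 in Hk.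
    set (tau := fun j x => if Rle_dec 1 (q * (phi j x - psi k x)) then 1 else 0).
    assert (Ht : forall j, exists T, stp (tau j) a b T).
    { intros j. apply (stp_map2 (fun s t => if Rle_dec 1 (q * (s - t)) then 1 else 0) _ _ _ _ _ _ (F0 j) (S0 k)). }
    set (T := fun k => proj1_sig (constructive_indefinite_description _ (Ht k))).
    assert (HT : forall k, stp (tau k) a b (T k)).
    { intros j. exact (proj2_sig (constructive_indefinite_description _ (Ht j))). }
    clearbody T.
    assert (HTb : forall j, T j <= e / 2).
    { intros j.
      destruct (stp_map2 Rmax _ _ _ _ _ _ (F0 j) (S0 k)) as [X HX].
      assert (X <= Ig).
      { apply (step_le_ups a b _ X g Ig Hab HX Hg). eapply ae_imp; [|exact Hgood].
        intros x Hx (G1 & G2 & G3 & G4). cbv beta.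
        pose proof (incr_cv_le (fun k => phi k x) _ (fun k => F1 k x Hx) G3 j) as Q1.
        pose proof (incr_cv_le (fun k => psi k x) _ (fun k => S1 k x Hx) G4 k) as Q2.
        cbv beta in Q1, Q2. apply Rmax_lub; lra. }
      assert (HD : T j <= 0 * (b - a) + q * (X + -1 * J' k)).
      { eapply stp_mono; [apply HT| |].
        - apply (stp_lin q (fun _ => 0)); [apply stp_const; auto|].
          apply (stp_lin (-1)); [exact HX|apply S0].
        - intros x Hx. cbv beta. unfold tau.
          assert (phi j x - psi k x <= Rmax (phi j x) (psi k x) - psi k x) by (pose proof (Rmax_l (phi j x) (psi k x)); lra).
          assert (0 <= Rmax (phi j x) (psi k x) - psi k x) by (pose proof (Rmax_r (phi j x) (psi k x)); lra).
          destruct (Rle_dec _ _); nra. }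
      replace (e / 2) with (q * (e / 2 / q)) by (field; lra). nra. }
    (* Successive differences of the increasing indicators [tau j]: their integrals telescope, so
       the union over all [j] up to [N] costs only [T N]. *)
    set (D := fun j => match j with O => T O | S i => T (S i) + -1 * T i end).
    set (dt := fun j => match j with O => tau O | S i => fun x => tau (S i) x + -1 * tau i x end).
    assert (HC : covered (fun x => exists j, a <= x <= b /\ 1 <= dt j x) e).
    { apply covered_union with (T := fun j => D j + (e / 2) / 2 ^ (S j)).
      - intros j. apply stp_covered.
        + destruct j; simpl; [apply HT|]. apply stp_lin; apply HT.
        + intros x Hx. destruct j; simpl; unfold tau.
          * destruct (Rle_dec _ _); lra.
          * specialize (F1 j x ltac:(lra)).
            assert (q * (phi j x - psi k x) <= q * (phi (S j) x - psi k x)) by (apply Rmult_le_compat_l; lra).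
            destruct (Rle_dec 1 (q * (phi j x - psi k x))); destruct (Rle_dec 1 (q * (phi (S j) x - psi k x))); lra.
        + apply half_pos. lra.
      - intros N. rewrite plus_sum. pose proof (sum_half (e / 2) N ltac:(lra)).
        assert (sum_f_R0 D N = T N) as ->.
        { clear. induction N; simpl; auto. rewrite IHN. simpl. ring. }
        specialize (HTb N). lra. }
    eapply covered_sub; [|apply Rle_refl|exact HC].
    intros x (Hx & (G1 & G2 & G3 & G4) & Hfx).
    pose proof (incr_cv_le (fun k => psi k x) _ (fun k => S1 k x Hx) G4 k) as Hps. simpl in Hps.
    assert (exists j, 1 <= q * (phi j x - psi k x)) as [j Hj].
    { destruct (G3 ((q * f x - 1) / q)) as [j Hj]. { fold q in Hfx; apply Rdiv_lt_0_compat; lra. }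
      specialize (Hj j ltac:(lia)). unfold Rdist in Hj. apply Rabs_def2 in Hj. exists j.
      assert (q * ((q * f x - 1) / q) = q * f x - 1) by (field; lra).
      assert (q * (f x - (q * f x - 1) / q) <= q * (phi j x - psi k x)) by (apply Rmult_le_compat_l; lra). lra. }
    (* The index wanted is the one at which the indicator first switches on at [x]. *)
    induction j as [|j IH].
    - exists 0%nat. split; auto. simpl. unfold tau. destruct (Rle_dec _ _); lra.
    - destruct (Rle_dec 1 (q * (phi j x - psi k x))) as [Hj'|Hj']; [auto|].
      exists (S j). split; auto. simpl. unfold tau.
      destruct (Rle_dec 1 (q * (phi (S j) x - psi k x))); [|lra].
      destruct (Rle_dec 1 (q * (phi j x - psi k x))); lra. }
  eapply negligible_sub; [|apply (negligible_or _ _ Hgood (negligible_union _ Hm))].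
  intros x [Hx Hne]. destruct (classic (good x)) as [G|G]; [|left; split; auto].
  right. pose proof G as (G1 & _). assert (0 < f x) by lra.
  destruct (archimed_cor1 (f x) H) as (N & HN & HN0).
  exists (pred N). repeat split; try apply G; try lra.
  replace (S (pred N)) with N by lia.
  assert (0 < INR N) by (apply lt_0_INR; lia).
  apply (Rmult_lt_compat_l (INR N)) in HN; auto. rewrite Rinv_r in HN; lra.
Qed.

(** * Products of integrable and continuous functions *)

Definition cont (a b : R) (f : R -> R) := forall x, a <= x <= b -> continuity_pt f x.

Lemma cont_step_below a b f e : a <= b -> cont a b f -> 0 < e ->
  exists th I, stp th a b I /\ forall x, a <= x <= b -> f x - e <= th x <= f x.
Proof.
  intros Hab Hc He.
  apply (real_induction (fun c => exists th I, stp th a c I /\ forall x, a <= x <= c -> f x - e <= th x <= f x) a b); auto.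
  - exists f, 0. split; [apply stp_nil|]. intros; lra.
  - intros s Hs. destruct (Hc s Hs (e / 2) ltac:(lra)) as (d & Hd & Hcd).
    assert (Hcd' : forall x, Rabs (x - s) < d -> Rabs (f x - f s) < e / 2).
    { intros x Hx. destruct (Req_dec x s) as [->|Hn].
      - rewrite Rminus_diag, Rabs_R0. lra.
      - apply (Hcd x). split; [split; [exact I|auto]|exact Hx]. }
    exists d. split; auto. intros x y Hax Hxy Hyb Hx Hy (th & I & HI & Hth).
    (* The new piece has height [f s - e / 2], admissible because [f] differs from [f s] by less
       than [e / 2] there. *)
    exists (fun z => if Rle_dec z x then th z else f s - e / 2), (I + (f s - e / 2) * (y - x)).
    split.
    + eapply stp_cat.
      * eapply stp_ext; [|exact HI]. intros z Hz; cbv beta. destruct (Rle_dec z x); lra.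
      * apply stp_const; auto. intros z Hz. destruct (Rle_dec z x); lra.
    + intros z Hz. destruct (Rle_dec z x); [apply Hth; lra|].
      assert (Rabs (z - s) < d). { apply Rabs_def2 in Hx, Hy. apply Rabs_def1; lra. }
      specialize (Hcd' z H). apply Rabs_def2 in Hcd'. lra.
Qed.

Lemma cont_step_seq a b f : a <= b -> cont a b f -> (forall x, a <= x <= b -> 0 <= f x) ->
  exists chi : nat -> R -> R, (forall k, exists I, stp (chi k) a b I) /\
    (forall k x, a <= x <= b -> 0 <= chi k x <= chi (S k) x) /\
    (forall k x, a <= x <= b -> chi k x <= f x) /\
    (forall x, a <= x <= b -> Un_cv (fun k => chi k x) (f x)).
Proof.
  intros Hab Hc Hf.
  assert (Ht : forall k : nat, exists th, (exists I, stp th a b I) /\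
     forall x, a <= x <= b -> f x - / INR (S k) <= th x <= f x).
  { intros k. destruct (cont_step_below a b f (/ INR (S k)) Hab Hc) as (th & I & H1 & H2).
    - apply Rinv_0_lt_compat, lt_0_INR; lia.
    - exists th. split; eauto. }
  set (th := fun k => proj1_sig (constructive_indefinite_description _ (Ht k))).
  assert (Hth : forall k, (exists I, stp (th k) a b I) /\
     forall x, a <= x <= b -> f x - / INR (S k) <= th k x <= f x).
  { intros k. exact (proj2_sig (constructive_indefinite_description _ (Ht k))). }
  clearbody th.
  (* Running maxima turn approximations that need not be monotone in [k] into an increasing,
     nonnegative sequence still below [f]. *)
  set (chi := fix chi k := match k with O => fun x => Rmax (th O x) 0 | S j => fun x => Rmax (chi j x) (th (S j) x) end).
  assert (H0 : forall k x, 0 <= chi k x).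
  { induction k; intros x; simpl; [apply Rmax_r|]. eapply Rle_trans; [apply IHk|apply Rmax_l]. }
  assert (Hub : forall k x, a <= x <= b -> chi k x <= f x).
  { induction k; intros x Hx; simpl; apply Rmax_lub; auto; apply Hth; auto. }
  assert (Hlb : forall k x, th k x <= chi k x).
  { destruct k; intros x; simpl; [apply Rmax_l|apply Rmax_r]. }
  assert (Hm : forall k x, chi k x <= chi (S k) x) by (intros; simpl; apply Rmax_l).
  exists chi. repeat split; auto.
  - induction k as [|k [I IH]].
    + destruct (proj1 (Hth 0%nat)) as [I HI]. exact (stp_map_const (fun t => Rmax t 0) _ _ _ _ HI).
    + destruct (proj1 (Hth (S k))) as [I' HI']. exact (stp_map2 Rmax _ _ _ _ _ _ IH HI').
  - intros x Hx e He. destruct (archimed_cor1 e He) as (N & HN & HN0).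
    exists N. intros n Hn. unfold Rdist.
    pose proof (Hub n x Hx). pose proof (Hlb n x). pose proof (proj2 (Hth n) x Hx).
    assert (/ INR (S n) <= / INR N).
    { apply Rinv_le_contravar; [apply lt_0_INR; lia|apply le_INR; lia]. }
    apply Rabs_def1; lra.
Qed.

(** Nonnegativity is recorded because a product of increasing sequences need not increase without
    it. *)
Definition upsp a b (f : R -> R) (I : R) : Prop := exists (phi : nat -> R -> R) (J : nat -> R),
  (forall k, stp (phi k) a b (J k)) /\
  (forall k x, a <= x <= b -> 0 <= phi k x <= phi (S k) x) /\
  ae_on a b (fun x => Un_cv (fun k => phi k x) (f x)) /\ Un_cv J I.

Lemma upsp_ups a b f I : upsp a b f I -> ups a b f I.
Proof.
  intros (phi & J & H0 & H1 & H2 & H3). exists phi, J. repeat split; auto. intros; apply H1; auto.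
Qed.

(** The first step function is bounded and lies below all later ones, so a constant shift makes the
    whole sequence nonnegative. *)
Lemma ups_shift a b f I : a <= b -> ups a b f I ->
  exists M, 0 <= M /\ forall M', M <= M' -> exists I', upsp a b (fun x => f x + M') I'.
Proof.
  intros Hab (phi & J & H0 & H1 & H2 & H3).
  destruct (stp_bounded _ _ _ _ (H0 0%nat)) as (M & HM0 & HM).
  exists M. split; auto. intros M' HM'.
  exists (I + M' * (1 * (b - a))), (fun k x => phi k x + M'), (fun k => J k + M' * (1 * (b - a))).
  repeat split.
  - intros k. eapply stp_ext; [|apply (stp_lin M' _ (fun _ => 1) _ _ _ _ (H0 k)); apply stp_const; auto].
    intros; simpl; ring.
  - assert (phi 0%nat x <= phi k x).
    { clear -H1 H. induction k; [lra|]. specialize (H1 k x H). lra. }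
    specialize (HM x H). pose proof (Rle_abs (- phi 0%nat x)). rewrite Rabs_Ropp in *. lra.
  - specialize (H1 k x H). lra.
  - eapply ae_imp; [|exact H2]. intros x Hx Hcv e He. destruct (Hcv e He) as [N HN].
    exists N. intros n Hn. specialize (HN n Hn). unfold Rdist in *.
    replace (phi n x + M' - (f x + M')) with (phi n x - f x) by ring. auto.
  - intros e He. destruct (H3 e He) as [N HN].
    exists N. intros n Hn. specialize (HN n Hn). unfold Rdist in *.
    replace (J n + M' * (1 * (b - a)) - (I + M' * (1 * (b - a)))) with (J n - I) by ring. auto.
Qed.

Lemma upsp_mult a b f g I : a <= b -> cont a b f -> (forall x, a <= x <= b -> 0 <= f x) ->
  upsp a b g I -> exists I', ups a b (fun x => f x * g x) I'.
Proof.
  intros Hab Hc Hf (phi & J & H0 & H1 & H2 & H3).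
  destruct (cont_step_seq a b f Hab Hc Hf) as (chi & C0 & C1 & C2 & C3).
  destruct (continuity_ab_maj f a b Hab Hc) as (xM & HM & _).
  assert (Hp : forall k, exists K, stp (fun x => chi k x * phi k x) a b K).
  { intros k. destruct (C0 k) as [I0 HI0]. exact (stp_map2 Rmult _ _ _ _ _ _ HI0 (H0 k)). }
  set (K := fun k => proj1_sig (constructive_indefinite_description _ (Hp k))).
  assert (HK : forall k, stp (fun x => chi k x * phi k x) a b (K k)).
  { intros k. exact (proj2_sig (constructive_indefinite_description _ (Hp k))). }
  clearbody K.
  assert (Hmono : forall k x, a <= x <= b -> chi k x * phi k x <= chi (S k) x * phi (S k) x).
  { intros k x Hx. specialize (C1 k x Hx). specialize (H1 k x Hx).
    apply Rmult_le_compat; lra. }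
  assert (Hgr : Un_growing K). { exact (stp_incr_int _ _ _ _ HK Hmono). }
  assert (Hgr' : Un_growing J). { apply (stp_incr_int a b phi); auto. intros; apply H1; auto. }
  destruct (Un_cv_crit K Hgr) as [I' HI'].
  { exists (0 * (b - a) + f xM * I). intros y [k ->].
    apply Rle_trans with (0 * (b - a) + f xM * J k).
    - eapply stp_mono; [apply HK| |].
      + apply (stp_lin (f xM) (fun _ => 0) (phi k)); [apply stp_const; auto|apply H0].
      + intros x Hx. cbv beta. specialize (C2 k x ltac:(lra)). specialize (H1 k x ltac:(lra)).
        specialize (HM x ltac:(lra)). nra.
    - pose proof (growing_ineq J I Hgr' H3 k). assert (0 <= f xM).
      { apply Rle_trans with (f a); [apply Hf; lra|apply HM; lra]. }
      nra. }
  exists I', (fun k x => chi k x * phi k x), K. repeat split; auto.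
  eapply ae_imp; [|exact H2]. intros x Hx Hcv.
  apply CV_mult with (An := fun k => chi k x) (Bn := fun k => phi k x); auto.
Qed.

(** Shifts make all factors nonnegative: for large [C] and [M], [f (g - h)] is the difference of
    [(f + C)(g + M) + C (h + M)] and [(f + C)(h + M) + C (g + M)]. *)
Lemma has_int_mult a b f s I : a <= b -> cont a b f -> has_int a b s I ->
  exists I', has_int a b (fun x => f x * s x) I'.
Proof.
  intros Hab Hc Hs. apply has_int_ups in Hs as (g & h & Ig & Ih & H1 & H2 & H3 & _); auto.
  destruct (ups_shift _ _ _ _ Hab H1) as (M1 & HM1 & Hg).
  destruct (ups_shift _ _ _ _ Hab H2) as (M2 & HM2 & Hh).
  destruct (Hg (M1 + M2)) as [G HG]; [lra|]. destruct (Hh (M1 + M2)) as [H HH]; [lra|].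
  set (M := M1 + M2) in *.
  destruct (continuity_ab_min f a b Hab Hc) as (xm & Hm & _).
  set (C := Rabs (f xm)).
  assert (HC0 : 0 <= C) by apply Rabs_pos.
  assert (HCp : forall x, a <= x <= b -> 0 <= f x + C).
  { intros x Hx. specialize (Hm x Hx). pose proof (Rle_abs (- f xm)). rewrite Rabs_Ropp in *.
    unfold C. lra. }
  assert (HcC : cont a b (fun x => f x + C)).
  { intros x Hx. apply (continuity_pt_plus f (fun _ => C)); auto. apply continuity_pt_const. intros ? ?; auto. }
  destruct (upsp_mult a b _ _ _ Hab HcC HCp HG) as [G' HG'].
  destruct (upsp_mult a b _ _ _ Hab HcC HCp HH) as [H' HH'].
  exists ((G' + C * H) - (H' + C * G)). apply has_int_ups; auto.
  exists (fun x => (f x + C) * (g x + M) + C * (h x + M)),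
         (fun x => (f x + C) * (h x + M) + C * (g x + M)), (G' + C * H), (H' + C * G).
  repeat split; try (apply ups_lin; auto; apply upsp_ups; auto).
  eapply ae_imp; [|exact H3]. intros x Hx ->. ring.
Qed.

(** * Positive functionals *)

Lemma cont_const a b c : cont a b (fun _ => c).
Proof. intros x _. apply continuity_pt_const. intros ? ?; auto. Qed.
Lemma cont_id a b : cont a b (fun x => x).
Proof. intros x _. apply derivable_continuous_pt, derivable_pt_id. Qed.
Lemma cont_plus a b f g : cont a b f -> cont a b g -> cont a b (fun x => f x + g x).
Proof. intros Hf Hg x Hx. apply (continuity_pt_plus f g); auto. Qed.
Lemma cont_opp a b f : cont a b f -> cont a b (fun x => - f x).
Proof. intros Hf x Hx. apply (continuity_pt_opp f); auto. Qed.
Lemma cont_minus a b f g : cont a b f -> cont a b g -> cont a b (fun x => f x - g x).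
Proof. intros Hf Hg x Hx. apply (continuity_pt_minus f g); auto. Qed.
Lemma cont_mult a b f g : cont a b f -> cont a b g -> cont a b (fun x => f x * g x).
Proof. intros Hf Hg x Hx. apply (continuity_pt_mult f g); auto. Qed.
Lemma cont_inv a b f : cont a b f -> (forall x, a <= x <= b -> f x <> 0) -> cont a b (fun x => / f x).
Proof. intros Hf H x Hx. apply (continuity_pt_inv f); auto. Qed.
Lemma cont_div a b f g : cont a b f -> cont a b g -> (forall x, a <= x <= b -> g x <> 0) ->
  cont a b (fun x => f x / g x).
Proof. intros Hf Hg H. apply cont_mult; auto. now apply cont_inv. Qed.
Lemma cont_pow a b f n : cont a b f -> cont a b (fun x => f x ^ n).
Proof. intros Hf. induction n; simpl; [apply cont_const|now apply cont_mult]. Qed.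
Lemma cont_abs a b f : cont a b f -> cont a b (fun x => Rabs (f x)).
Proof. intros Hf x Hx. apply (continuity_pt_comp f Rabs); [apply Hf; auto|apply Rcontinuity_abs]. Qed.

Create HintDb cont.
#[export] Hint Resolve cont_const cont_id cont_plus cont_opp cont_minus cont_mult cont_inv cont_div cont_pow cont_abs : cont.

Lemma cube_lt x y : x < y -> x ^ 3 < y ^ 3.
Proof.
  intros H. replace (y ^ 3) with (x ^ 3 + (y - x) * ((y + x / 2) ^ 2 + 3 / 4 * x ^ 2)) by field.
  assert (0 < (y - x) * ((y + x / 2) ^ 2 + 3 / 4 * x ^ 2)); [|lra].
  apply Rmult_lt_0_compat; [lra|].
  pose proof (pow2_ge_0 (y + x / 2)). pose proof (pow2_ge_0 x).
  destruct (Req_dec x 0) as [->|Hx]; [|pose proof (pow_nonzero x 2 Hx); lra].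
  replace (y + 0 / 2) with y by field. assert (0 < y ^ 2) by (apply pow_lt; lra). lra.
Qed.
Lemma cube_le x y : x <= y -> x ^ 3 <= y ^ 3.
Proof. intros [H| ->]; [apply Rlt_le, cube_lt; auto|lra]. Qed.
Lemma cube_inj x y : x ^ 3 = y ^ 3 -> x = y.
Proof. intros H. destruct (Rtotal_order x y) as [H0|[H0|H0]]; auto; apply cube_lt in H0; lra. Qed.

Lemma cont_cube a b f : cont (a ^ 3) (b ^ 3) f -> cont a b (fun t => f (t ^ 3)).
Proof.
  intros Hf x Hx. apply (continuity_pt_comp (fun t => t ^ 3) f).
  - apply (cont_pow a b (fun t => t)); auto with cont.
  - apply Hf. split; apply cube_le; lra.
Qed.

(** Choice makes integration a total functional; the value is meaningful only where [has_int] holds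
    for some number. *)
Definition Int (a b : R) (f : R -> R) : R := epsilon (inhabits 0) (fun I => has_int a b f I).

Lemma Int_spec a b f I : a <= b -> has_int a b f I -> Int a b f = I.
Proof.
  intros Hab H. eapply has_int_uniq; eauto. unfold Int.
  apply (epsilon_spec (inhabits 0) (fun I => has_int a b f I)). eauto.
Qed.

(* Integration against a nonnegative nontrivial density, as a functional on continuous functions.
   [pf_pos] is strict positivity: a nonnegative function of integral zero has infinitely many zeros. *)
Record posfun (lo hi : R) (L : (R -> R) -> R) : Prop := {
  pf_lt : lo < hi;
  pf_ext : forall f g, cont lo hi f -> (forall x, lo <= x <= hi -> f x = g x) -> L f = L g;
  pf_lin : forall f g k, cont lo hi f -> cont lo hi g -> L (fun x => f x + k * g x) = L f + k * L g;
  pf_nonneg : forall f, cont lo hi f -> (forall x, lo <= x <= hi -> 0 <= f x) -> 0 <= L f;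
  pf_pos : forall f l, cont lo hi f -> (forall x, lo < x < hi -> 0 <= f x) -> L f = 0 ->
    (forall x, lo < x < hi -> f x = 0 -> In x l) -> False }.

Lemma has_int_cube a b s f : a <= b -> (exists I, has_int a b s I) -> cont (a ^ 3) (b ^ 3) f ->
  has_int a b (fun t => f (t ^ 3) * s t) (Int a b (fun t => f (t ^ 3) * s t)).
Proof.
  intros Hab [I HI] Hf. destruct (has_int_mult a b (fun t => f (t ^ 3)) s I Hab) as [I' HI']; auto.
  - now apply cont_cube.
  - now rewrite (Int_spec _ _ _ _ Hab HI').
Qed.

(** The functional integrates against the image of [s(t) dt] under cubing, which passes to the
    variable [t^3] without a Jacobian. Finite zero sets pull back to finite sets because cubing is
    injective. *)
Lemma posfun_int a b s : a < b -> (forall x, a < x < b -> 0 <= s x) -> (exists I, has_int a b s I) ->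
  ~ ae_on a b (fun x => s x = 0) -> posfun (a ^ 3) (b ^ 3) (fun f => Int a b (fun t => f (t ^ 3) * s t)).
Proof.
  intros Hab Hs HI Hnz. assert (Hab' : a <= b) by lra.
  assert (Hae : forall f, (forall x, a ^ 3 < x < b ^ 3 -> 0 <= f x) -> ae_on a b (fun t => 0 <= f (t ^ 3) * s t)).
  { intros f Hf. apply negligible_sub with (fun x => In x [a; b]); [|apply negligible_finite].
    intros x [Hx Hn]. simpl. destruct (Req_dec a x); auto. destruct (Req_dec b x); auto. exfalso.
    apply Hn. apply Rmult_le_pos; [apply Hf; split; apply cube_lt|apply Hs]; lra. }
  constructor.
  - now apply cube_lt.
  - intros f g Hf E. symmetry. apply Int_spec; auto.
    eapply has_int_ext; [|apply (has_int_cube a b s f Hab' HI Hf)].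
    intros x Hx. cbv beta. rewrite E; auto. split; apply cube_le; lra.
  - intros f g k Hf Hg. apply Int_spec; auto.
    eapply has_int_ext; [|apply (has_int_lin _ _ _ _ _ _ k Hab' (has_int_cube a b s f Hab' HI Hf) (has_int_cube a b s g Hab' HI Hg))].
    intros x Hx. cbv beta. ring.
  - intros f Hf Hp. eapply has_int_nonneg; [exact Hab'|apply (has_int_cube a b s f Hab' HI Hf)|].
    apply Hae. intros; apply Hp; lra.
  - intros f l Hf Hp H0 Hl.
    pose proof (has_int_cube a b s f Hab' HI Hf) as H. rewrite H0 in H.
    apply has_int_zero in H; auto.
    apply Hnz.
    assert (Hl' : exists l', forall t, In (t ^ 3) l -> In t l').
    { clear. induction l as [|y l [l' IH]].
      - exists []. auto.
      - destruct (classic (exists t, t ^ 3 = y)) as [[t Ht]|Hn].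
        + exists (t :: l'). intros t' [Hy|Hin]; [left; apply cube_inj; congruence|right; auto].
        + exists l'. intros t' [Hy|Hin]; [exfalso; eauto|auto]. }
    destruct Hl' as [l' Hl'].
    eapply negligible_sub; [|apply (negligible_or _ _ H (negligible_finite (a :: b :: l')))].
    intros x [Hx Hsx].
    destruct (classic (f (x ^ 3) * s x = 0)) as [E|E]; [|left; split; auto].
    right. simpl. destruct (Req_dec a x); auto. destruct (Req_dec b x); auto. right; right.
    apply Hl', Hl; [split; apply cube_lt; lra|].
    apply Rmult_integral in E. tauto.
Qed.

Section Pos.
Variables (lo hi : R) (L : (R -> R) -> R).
Hypothesis HL : posfun lo hi L.

Lemma pf_zero : L (fun _ => 0) = 0.
Proof.
  pose proof (pf_lin _ _ _ HL (fun _ => 0) (fun _ => 0) 1 (cont_const _ _ _) (cont_const _ _ _)) as H.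
  cbv beta in H.  rewrite (pf_ext _ _ _ HL (fun x => 0 + 1 * 0) (fun _ => 0)) in H; [lra|auto with cont|].
  intros; ring.
Qed.

Lemma pf_scal f k : cont lo hi f -> L (fun x => k * f x) = k * L f.
Proof.
  intros Hf. rewrite (pf_ext _ _ _ HL _ (fun x => 0 + k * f x)); [|auto with cont|intros; ring].
  rewrite (pf_lin _ _ _ HL (fun _ => 0)), pf_zero; auto with cont. ring.
Qed.

Lemma pf_add f g : cont lo hi f -> cont lo hi g -> L (fun x => f x + g x) = L f + L g.
Proof.
  intros Hf Hg. rewrite (pf_ext _ _ _ HL _ (fun x => f x + 1 * g x)); [|auto with cont|intros; ring].
  rewrite (pf_lin _ _ _ HL); auto. ring.
Qed.

Lemma pf_sub f g : cont lo hi f -> cont lo hi g -> L (fun x => f x - g x) = L f - L g.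
Proof.
  intros Hf Hg. rewrite (pf_ext _ _ _ HL _ (fun x => f x + (-1) * g x)); [|auto with cont|intros; ring].
  rewrite (pf_lin _ _ _ HL); auto. ring.
Qed.

Lemma pf_abs f g : cont lo hi f -> cont lo hi g -> (forall x, lo <= x <= hi -> Rabs (f x) <= g x) ->
  Rabs (L f) <= L g.
Proof.
  intros Hf Hg H.
  assert (0 <= L g - L f /\ 0 <= L g + L f) as [H1 H2].
  { rewrite <- pf_sub, <- pf_add by auto.
    split; apply (pf_nonneg _ _ _ HL); auto with cont; intros x Hx; specialize (H x Hx);
      pose proof (Rle_abs (f x)); pose proof (Rle_abs (- f x)); rewrite Rabs_Ropp in *; lra. }
  apply Rabs_le; lra.
Qed.

Lemma pf_gt0 f l : cont lo hi f -> (forall x, lo <= x <= hi -> 0 <= f x) ->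
  (forall x, lo < x < hi -> f x = 0 -> In x l) -> 0 < L f.
Proof.
  intros Hf Hp Hl. pose proof (pf_nonneg _ _ _ HL f Hf Hp).
  destruct (Req_dec (L f) 0) as [E|]; [|lra].
  exfalso. apply (pf_pos _ _ _ HL f l); auto. intros; apply Hp; lra.
Qed.

(** The means of absorbing factors into a measure: finitely many zeros of the weight do not spoil
    strict positivity. *)
Lemma posfun_weight w l : cont lo hi w -> (forall x, lo <= x <= hi -> 0 <= w x) ->
  (forall x, lo < x < hi -> w x = 0 -> In x l) -> posfun lo hi (fun f => L (fun x => w x * f x)).
Proof.
  intros Hw Hp Hl. constructor.
  - apply HL.
  - intros f g Hf E. apply (pf_ext _ _ _ HL); auto with cont. intros x Hx. now rewrite E.
  - intros f g k Hf Hg. rewrite <- (pf_lin _ _ _ HL) by auto with cont.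
    apply (pf_ext _ _ _ HL); [auto with cont|]. intros; ring.
  - intros f Hf Hf0. apply (pf_nonneg _ _ _ HL); auto with cont.
    intros x Hx. apply Rmult_le_pos; auto.
  - intros f l' Hf Hf0 H0 Hl'. apply (pf_pos _ _ _ HL _ (l ++ l')) in H0; auto with cont.
    + intros x Hx. apply Rmult_le_pos; auto. apply Hp; lra.
    + intros x Hx E. apply in_or_app. apply Rmult_integral in E. destruct E; auto.
Qed.

Lemma cauchy_transform_deriv c z : cont lo hi c -> (z < lo \/ hi < z) ->
  derivable_pt_lim (fun z => L (fun x => c x / (x - z))) z (L (fun x => c x / (x - z) ^ 2)).
Proof.
  intros Hc Hz.
  assert (exists d, 0 < d /\ forall x, lo <= x <= hi -> d <= Rabs (x - z)) as (d & Hd & Hdx).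
  { destruct Hz; [exists (lo - z)|exists (z - hi)]; split; try lra; intros x Hx.
    - rewrite Rabs_right; lra.
    - rewrite Rabs_left; lra. }
  (* For increments below [d / 2] the kernel of the remainder of the difference quotient is at most
     [2 / d^3]. *)
  pose (C := fun x => 2 / d ^ 3 * Rabs (c x)).
  assert (HC : cont lo hi C) by (unfold C; auto with cont).
  assert (HLC : 0 <= L C).
  { apply (pf_nonneg _ _ _ HL); auto. intros x _. unfold C.
    apply Rmult_le_pos; [|apply Rabs_pos]. apply Rlt_le, Rdiv_lt_0_compat; [lra|apply pow_lt; lra]. }
  intros e He.
  assert (Hdelta : 0 < Rmin (d / 2) (e / (L C + 1))).
  { apply Rmin_glb_lt; [lra|apply Rdiv_lt_0_compat; lra]. }
  exists (mkposreal _ Hdelta). intros t Ht0 Ht. simpl in Ht.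
  assert (Ht1 : Rabs t < d / 2) by (eapply Rlt_le_trans; [exact Ht|apply Rmin_l]).
  assert (Ht2 : Rabs t < e / (L C + 1)) by (eapply Rlt_le_trans; [exact Ht|apply Rmin_r]).
  assert (Hn0 : forall x, lo <= x <= hi -> x - z <> 0).
  { intros x Hx E. specialize (Hdx x Hx). rewrite E, Rabs_R0 in Hdx. lra. }
  assert (Hdt : forall x, lo <= x <= hi -> d / 2 <= Rabs (x - (z + t))).
  { intros x Hx. specialize (Hdx x Hx). pose proof (Rabs_triang (x - (z + t)) t).
    replace (x - (z + t) + t) with (x - z) in H by ring. lra. }
  assert (Hn1 : forall x, lo <= x <= hi -> x - (z + t) <> 0).
  { intros x Hx E. specialize (Hdt x Hx). rewrite E, Rabs_R0 in Hdt. lra. }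
  assert (Hn2 : forall x, lo <= x <= hi -> (x - z) ^ 2 <> 0).
  { intros; apply pow_nonzero; auto. }
  assert (E : (L (fun x => c x / (x - (z + t))) - L (fun x => c x / (x - z))) / t - L (fun x => c x / (x - z) ^ 2)
     = t * L (fun x => c x / ((x - (z + t)) * (x - z) ^ 2))).
  { assert (Hk : forall x, lo <= x <= hi -> (x - (z + t)) * (x - z) ^ 2 <> 0).
    { intros x Hx. apply Rmult_integral_contrapositive; auto. }
    rewrite <- pf_sub by auto with cont.
    assert (E1 : L (fun x => c x / (x - (z + t)) - c x / (x - z)) =
      t * L (fun x => c x / (x - z) ^ 2) + (t * t) * L (fun x => c x / ((x - (z + t)) * (x - z) ^ 2))).
    { rewrite <- (pf_scal _ t), <- (pf_lin _ _ _ HL) by auto with cont.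
      apply (pf_ext _ _ _ HL); [auto with cont|]. intros x Hx.
      specialize (Hn0 x Hx); specialize (Hn1 x Hx). field. split; auto. }
    rewrite E1. field. auto. }
  rewrite E, Rabs_mult.
  assert (HB : Rabs (L (fun x => c x / ((x - (z + t)) * (x - z) ^ 2))) <= L C).
  { apply pf_abs; auto.
    - assert (Hk : forall x, lo <= x <= hi -> (x - (z + t)) * (x - z) ^ 2 <> 0).
      { intros x Hx. apply Rmult_integral_contrapositive; auto. }
      auto 8 with cont.
    - intros x Hx. unfold C, Rdiv. rewrite Rabs_mult, Rabs_inv, Rabs_mult, <- RPow_abs.
      specialize (Hdx x Hx); specialize (Hdt x Hx). pose proof (Rabs_pos (c x)).
      assert (/ (Rabs (x - (z + t)) * Rabs (x - z) ^ 2) <= 2 * / d ^ 3); [|nra].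
      replace (2 * / d ^ 3) with (/ (d / 2 * d ^ 2)) by (field; lra).
      apply Rinv_le_contravar; [apply Rmult_lt_0_compat; [lra|apply pow_lt; lra]|].
      apply Rmult_le_compat; try lra; [apply pow_le; lra|].
      apply pow_incr; lra. }
  apply Rle_lt_trans with (Rabs t * L C).
  - apply Rmult_le_compat_l; [apply Rabs_pos|auto].
  - pose proof (Rabs_pos t).
    assert (Rabs t * (L C + 1) < e).
    { replace e with (e / (L C + 1) * (L C + 1)) by (field; lra). apply Rmult_lt_compat_r; lra. }
    nra.
Qed.

Lemma markov_cont c lo' hi' : cont lo hi c -> hi < lo' -> cont lo' hi' (fun t => L (fun u => c u / (t - u))).
Proof.
  intros Hc Hlt x Hx. apply derivable_continuous_pt. exists (- L (fun u => c u / (u - x) ^ 2)).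
  pose proof (cauchy_transform_deriv c x Hc ltac:(right; lra)) as H.
  apply derivable_pt_lim_opp in H.
  intros e He. destruct (H e He) as [d Hd].
  assert (Hm : 0 < Rmin d (x - hi)). { apply Rmin_glb_lt; [apply cond_pos|lra]. }
  exists (mkposreal _ Hm). intros t Ht0 Ht; simpl in Ht.
  assert (Rabs t < x - hi) by (eapply Rlt_le_trans; [exact Ht|apply Rmin_r]). apply Rabs_def2 in H0.
  specialize (Hd t Ht0 (Rlt_le_trans _ _ _ Ht (Rmin_l _ _))). unfold opp_fct in Hd.
  assert (E : forall y, hi < y -> L (fun u => c u / (y - u)) = - L (fun u => c u / (u - y))).
  { intros y Hy. replace (- L (fun u => c u / (u - y))) with ((-1) * L (fun u => c u / (u - y))) by ring.
    assert (forall x0, lo <= x0 <= hi -> x0 - y <> 0) by (intros; lra).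
    assert (forall x0, lo <= x0 <= hi -> y - x0 <> 0) by (intros; lra).
    rewrite <- pf_scal by auto with cont.
    apply (pf_ext _ _ _ HL); [auto with cont|]. intros u Hu. field. split; lra. }
  rewrite !E by lra. exact Hd.
Qed.
End Pos.

(** * Polynomial functions *)

(** The index bounds the number of coefficients, so [polyfun n] means degree less than [n]; at
    [n = 0] only the zero function remains. *)
Fixpoint polyfun (n : nat) (f : R -> R) : Prop :=
  match n with
  | O => forall x, f x = 0
  | S n => exists c g, polyfun n g /\ forall x, f x = c + x * g x
  end.

Lemma polyfun_ext n f g : (forall x, f x = g x) -> polyfun n f -> polyfun n g.
Proof.
  destruct n; simpl; intros E H; [intros; now rewrite <- E|].
  destruct H as (c & h & Hh & H). exists c, h. split; auto. intros; now rewrite <- E.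
Qed.

Lemma polyfun_S n f : polyfun n f -> polyfun (S n) f.
Proof.
  revert f. induction n; intros f H.
  - exists 0, (fun _ => 0). split; simpl in *; auto. intros; rewrite H; ring.
  - destruct H as (c & g & Hg & H). exists c, g. split; auto.
Qed.

Lemma polyfun_le n m f : (n <= m)%nat -> polyfun n f -> polyfun m f.
Proof. induction 1; auto. intros; apply polyfun_S; auto. Qed.

Lemma polyfun_lin n f g k : polyfun n f -> polyfun n g -> polyfun n (fun x => f x + k * g x).
Proof.
  revert f g. induction n; simpl; intros f g Hf Hg.
  - intros; rewrite Hf, Hg; ring.
  - destruct Hf as (c & f' & Hf' & Hf), Hg as (d & g' & Hg' & Hg).
    exists (c + k * d), (fun x => f' x + k * g' x). split; auto. intros; rewrite Hf, Hg; ring.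
Qed.

Lemma polyfun_zero n : polyfun n (fun _ => 0).
Proof. apply (polyfun_le 0); simpl; auto. lia. Qed.

Lemma polyfun_const n c : (1 <= n)%nat -> polyfun n (fun _ => c).
Proof.
  intros H. apply (polyfun_le 1); auto. exists c, (fun _ => 0). split; simpl; auto. intros; ring.
Qed.

Lemma polyfun_add n f g : polyfun n f -> polyfun n g -> polyfun n (fun x => f x + g x).
Proof. intros Hf Hg. eapply polyfun_ext; [|apply (polyfun_lin n f g 1); auto]. intros; simpl; ring. Qed.

Lemma polyfun_scal n f k : polyfun n f -> polyfun n (fun x => k * f x).
Proof.
  intros Hf. eapply polyfun_ext; [|apply (polyfun_lin n (fun _ => 0) f k); auto using polyfun_zero].
  intros; simpl; ring.
Qed.

Lemma polyfun_mulX n f : polyfun n f -> polyfun (S n) (fun x => x * f x).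
Proof. intros H. exists 0, f. split; auto. intros; ring. Qed.

(** Degrees below [n] and [m] add up to at most [n + m - 2], hence [n + m - 1] coefficients. *)
Lemma polyfun_mul n m f g : polyfun n f -> polyfun m g -> polyfun (pred (n + m)) (fun x => f x * g x).
Proof.
  revert f. induction n; intros f Hf Hg.
  - eapply polyfun_ext; [|apply polyfun_zero]. intros x; simpl in *. rewrite Hf; ring.
  - destruct Hf as (c & f' & Hf' & Hf). destruct m.
    + eapply polyfun_ext; [|apply polyfun_zero]. intros x; simpl in *. rewrite Hg; ring.
    + specialize (IHn f' Hf' Hg).
      eapply polyfun_ext; [intros x; symmetry; rewrite Hf|].
      2:{ apply (polyfun_add _ (fun x => c * g x) (fun x => x * (f' x * g x))).
          - apply (polyfun_le (S m)); [lia|]. now apply polyfun_scal.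
          - apply polyfun_mulX in IHn. eapply polyfun_le; [|exact IHn]. lia. }
      simpl; ring.
Qed.

Lemma polyfun_pow_id n : polyfun (S n) (fun x => x ^ n).
Proof. induction n; [exact (polyfun_const 1 1 (le_n _))|exact (polyfun_mulX _ _ IHn)]. Qed.

Lemma polyfun_linear r : polyfun 2 (fun x => x - r).
Proof.
  exists (- r), (fun _ => 1). split; [apply polyfun_const; lia|intros; ring].
Qed.

Lemma polyfun_cont n f a b : polyfun n f -> cont a b f.
Proof.
  revert f. induction n; intros f H.
  - replace f with (fun _ : R => 0) by (extensionality x; now rewrite H). auto with cont.
  - destruct H as (c & g & Hg & H). specialize (IHn g Hg).
    replace f with (fun x => c + x * g x) by (extensionality x; now rewrite H). auto with cont.
Qed.
#[export] Hint Resolve polyfun_cont : cont.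

Lemma polyfun_deriv n f : polyfun n f -> exists f', forall x, derivable_pt_lim f x (f' x).
Proof.
  revert f. induction n; intros f H.
  - replace f with (fun _ : R => 0) by (extensionality x; now rewrite H).
    exists (fun _ => 0). intros x. apply derivable_pt_lim_const.
  - destruct H as (c & g & Hg & H). destruct (IHn g Hg) as [g' Hg'].
    replace f with (fun x => c + x * g x) by (extensionality x; now rewrite H).
    exists (fun x => 0 + (1 * g x + x * g' x)). intros x.
    apply (derivable_pt_lim_plus (fun _ => c)); [apply derivable_pt_lim_const|].
    apply (derivable_pt_lim_mult (fun x => x)); auto. apply derivable_pt_lim_id.
Qed.

Lemma polyfun_quot n f u : polyfun (S n) f ->
  exists g, polyfun n g /\ forall x, f x - f u = (x - u) * g x.
Proof.
  revert f. induction n; intros f (c & g & Hg & H).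
  - exists (fun _ => 0). split; [apply polyfun_zero|]. intros x. simpl in Hg. rewrite !H, !Hg. ring.
  - destruct (IHn g Hg) as (k & Hk & E). exists (fun x => g x + u * k x). split.
    + apply polyfun_add; auto. apply polyfun_S, polyfun_scal; auto.
    + intros x. rewrite !H. replace (c + x * g x - (c + u * g u)) with ((x - u) * g x + u * (g x - g u)) by ring.
      rewrite E. ring.
Qed.

Lemma polyfun_root n f r : polyfun (S n) f -> f r = 0 -> exists g, polyfun n g /\ forall x, f x = (x - r) * g x.
Proof.
  intros H Hr. destruct (polyfun_quot n f r H) as (g & Hg & E). exists g. split; auto.
  intros x. rewrite <- E, Hr. ring.
Qed.

Lemma polyfun_roots n f xs : polyfun n f -> NoDup xs -> (n <= length xs)%nat ->
  (forall x, In x xs -> f x = 0) -> forall x, f x = 0.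
Proof.
  revert f xs. induction n; intros f xs H Hnd Hlen Hz; [exact H|].
  destruct xs as [|r xs]; [simpl in Hlen; lia|].
  destruct (polyfun_root n f r H (Hz r (or_introl eq_refl))) as (g & Hg & E).
  inversion Hnd; subst.
  assert (Hg0 : forall x, g x = 0).
  { apply (IHn g xs); auto; [simpl in Hlen; lia|]. intros x Hx.
    specialize (Hz x (or_intror Hx)). rewrite E in Hz. apply Rmult_integral in Hz.
    destruct Hz; auto. exfalso. apply H2. replace r with x by lra. auto. }
  intros x. rewrite E, Hg0. ring.
Qed.

Lemma polyfun_zeros n f : polyfun n f -> (exists x, f x <> 0) -> exists l, forall x, f x = 0 -> In x l.
Proof.
  revert f. induction n; intros f H [x0 Hx0]; [exfalso; apply Hx0, H|].
  destruct (classic (exists r, f r = 0)) as [[r Hr]|Hn].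
  - destruct (polyfun_root n f r H Hr) as (g & Hg & E).
    destruct (IHn g Hg) as [l Hl].
    + exists x0. intros E0. apply Hx0. rewrite E, E0. ring.
    + exists (r :: l). intros x Hx. rewrite E in Hx. apply Rmult_integral in Hx.
      destruct Hx; [left; lra|right; auto].
  - exists []. intros x Hx. apply Hn; eauto.
Qed.

Lemma polyfun_zero_off_zero n f : polyfun n f -> (forall x, x <> 0 -> f x = 0) -> forall x, f x = 0.
Proof.
  intros H Hz. apply (polyfun_roots n f (map (fun k => INR (S k)) (seq 0 n))); auto.
  - apply FinFun.Injective_map_NoDup; [|apply seq_NoDup]. intros x y E. apply INR_eq in E. lia.
  - rewrite length_map, length_seq. lia.
  - intros x Hx. apply in_map_iff in Hx. destruct Hx as (k & <- & _). apply Hz, not_0_INR. lia.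
Qed.

Lemma polyfun_top d f : polyfun (S d) f -> exists c g, polyfun d g /\ forall x, f x = g x + c * x ^ d.
Proof.
  revert f. induction d; intros f (c & g & Hg & H).
  - exists c, (fun _ => 0). split; [apply polyfun_zero|]. intros x. simpl in Hg. rewrite H, Hg. simpl; ring.
  - destruct (IHd g Hg) as (c' & g' & Hg' & H'). exists c', (fun x => c + x * g' x). split.
    + exists c, g'. auto.
    + intros x. rewrite H, H'. simpl. ring.
Qed.

Lemma polyfun_neq_pow d f : polyfun d f -> exists x, f x + x ^ d <> 0.
Proof.
  revert f. induction d; intros f H.
  - exists 0. simpl in *. rewrite H. lra.
  - destruct H as (c & g & Hg & H). apply NNPP. intros N.
    assert (HN : forall x, f x + x ^ S d = 0).
    { intros x. apply NNPP. intros Hx. apply N. eauto. }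
    assert (c = 0). { specialize (HN 0). rewrite H in HN. simpl in HN. lra. }
    destruct (IHd g Hg) as [x Hx]. apply Hx.
    apply (polyfun_zero_off_zero (S d) (fun x => g x + x ^ d)).
    + apply polyfun_add; [now apply polyfun_S|apply polyfun_pow_id].
    + intros y Hy. specialize (HN y). rewrite H, H0 in HN. simpl in HN.
      apply (Rmult_eq_reg_l y); auto. lra.
Qed.

(** * Products of linear factors and elimination *)

Definition prodl (xs : list R) (x : R) : R := fold_right (fun r p => (x - r) * p) 1 xs.

Lemma prodl_polyfun xs : polyfun (S (length xs)) (prodl xs).
Proof.
  induction xs as [|r xs IH]; [exact (polyfun_const 1 1 (le_n _))|].
  exact (polyfun_mul 2 (S (length xs)) _ _ (polyfun_linear r) IH).
Qed.
#[export] Hint Resolve prodl_polyfun : cont.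

Lemma prodl_app l1 l2 x : prodl (l1 ++ l2) x = prodl l1 x * prodl l2 x.
Proof. induction l1; simpl; [|rewrite IHl1]; ring. Qed.

Lemma prodl_zero xs x : prodl xs x = 0 <-> In x xs.
Proof.
  induction xs as [|r xs IH]; simpl; [split; [lra|tauto]|]. split.
  - intros H. apply Rmult_integral in H. destruct H; [left; lra|right; tauto].
  - intros [-> |H]; [ring|]. rewrite (proj2 IH H). ring.
Qed.

Lemma prodl_sign xs hi : (forall x, In x xs -> hi < x) ->
  exists s, (s = 1 \/ s = -1) /\ forall u, u <= hi -> 0 < s * prodl xs u.
Proof.
  induction xs as [|r xs IH]; intros H.
  - exists 1. split; auto. intros; simpl; lra.
  - destruct IH as (s & Hs & Hp). { intros; apply H; right; auto. }
    exists (- s). split; [destruct Hs; [right|left]; lra|]. intros u Hu. simpl.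
    specialize (Hp u Hu). specialize (H r (or_introl eq_refl)).
    replace (- s * ((u - r) * prodl xs u)) with ((r - u) * (s * prodl xs u)) by ring.
    apply Rmult_lt_0_compat; lra.
Qed.

Lemma prodl_dup xs : ~ NoDup xs -> exists r ys, length xs = S (S (length ys)) /\
  forall x, prodl xs x = (x - r) ^ 2 * prodl ys x.
Proof.
  induction xs as [|a xs IH]; intros H; [exfalso; apply H; constructor|].
  destruct (classic (In a xs)) as [Hin|Hin].
  - destruct (in_split _ _ Hin) as (l1 & l2 & ->). exists a, (l1 ++ l2). split.
    + simpl. rewrite !length_app. simpl. lia.
    + intros x. simpl. rewrite !prodl_app. simpl. ring.
  - destruct IH as (r & ys & Hl & E).
    + intros Hnd. apply H. constructor; auto.
    + exists r, (a :: ys). split; [simpl; lia|]. intros x. simpl. rewrite E. ring.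
Qed.

(** Zeros are stripped off with multiplicity, so a repeated entry of [rs] signals a multiple zero in
    [P]. *)
Lemma polyfun_factor n f (P : R -> Prop) : polyfun n f -> (exists x, f x <> 0) ->
  exists rs g m, polyfun m g /\ (m + length rs = n)%nat /\ (forall r, In r rs -> P r) /\
    (forall x, P x -> g x <> 0) /\ forall x, f x = prodl rs x * g x.
Proof.
  revert f. induction n; intros f H [x0 Hx0]; [exfalso; apply Hx0, H|].
  destruct (classic (exists r, P r /\ f r = 0)) as [(r & HP & Hr)|Hn].
  - destruct (polyfun_root n f r H Hr) as (h & Hh & E).
    destruct (IHn h Hh) as (rs & g & m & Hg & Hlen & Hrs & Hnz & Hf).
    + exists x0. intros E0. apply Hx0. rewrite E, E0. ring.
    + exists (r :: rs), g, m. repeat split; auto.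
      * simpl; lia.
      * intros r' [<-|Hin]; auto.
      * intros x. rewrite E, Hf. simpl. ring.
  - exists [], f, (S n). split; [exact H|]. split; [simpl; lia|]. split; [intros r []|]. split.
    + intros x HPx E. apply Hn; eauto.
    + intros; simpl; ring.
Qed.

(* Gaussian elimination: [d] homogeneous equations in [d + 1] unknowns, here coefficients attached
   to the elements of [xs]. *)
Lemma kernel {X} d (E : X -> nat -> R) (xs : list X) : length xs = S d ->
  exists l : list (R * X), map snd l = xs /\ (exists p, In p l /\ fst p <> 0) /\
    forall i, (i < d)%nat -> lsum (fun p => fst p * E (snd p) i) l = 0.
Proof.
  revert E xs. induction d; intros E xs Hlen.
  - destruct xs as [|x [|]]; try discriminate. exists [(1, x)]. split; auto. split.
    + exists (1, x). split; [left; auto|simpl; lra].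
    + intros; lia.
  - destruct (classic (exists x, In x xs /\ E x d <> 0)) as [(x0 & Hin & Hx0)|Hn].
    + destruct (in_split _ _ Hin) as (l1 & l2 & ->).
      (* Equation [d] is solved for the coefficient of [x0] and substituted into the others. *)
      set (E' := fun x i => E x i - E x d / E x0 d * E x0 i).
      destruct (IHd E' (l1 ++ l2)) as (l & Hl & (p & Hp & Hp0) & Hk).
      { rewrite length_app in *. simpl in Hlen. lia. }
      apply map_eq_app in Hl. destruct Hl as (L1 & L2 & -> & <- & <-).
      set (c0 := - lsum (fun p => fst p * E (snd p) d) (L1 ++ L2) / E x0 d).
      exists (L1 ++ (c0, x0) :: L2). split; [|split].
      * rewrite map_app. reflexivity.
      * exists p. split; auto. apply in_app_or in Hp. apply in_or_app. simpl. tauto.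
      * intros i Hi.
        assert (Hc : lsum (fun p => fst p * E (snd p) i) (L1 ++ (c0, x0) :: L2)
           = lsum (fun p => fst p * E (snd p) i) (L1 ++ L2) + c0 * E x0 i).
        { rewrite !lsum_app. simpl. ring. }
        rewrite Hc. unfold c0.
        destruct (Nat.eq_dec i d) as [->|Hne]; [field; auto|].
        specialize (Hk i ltac:(lia)).
        assert (Hs : forall l, lsum (fun p => fst p * E' (snd p) i) l =
          lsum (fun p => fst p * E (snd p) i) l - lsum (fun p => fst p * E (snd p) d) l / E x0 d * E x0 i).
        { clear -Hx0. induction l as [|q l IH]; simpl; [field; auto|]. rewrite IH. unfold E'. field. auto. }
        rewrite Hs in Hk. rewrite <- Hk. field. auto.
    (* Equation [d] is trivial on all of [xs]; one unknown is set to zero to match the smaller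
       system. *)
    + destruct xs as [|x xs]; [discriminate|].
      destruct (IHd E xs) as (l & Hl & (p & Hp & Hp0) & Hk). { simpl in Hlen; lia. }
      exists ((0, x) :: l). split; [simpl; now rewrite Hl|]. split.
      * exists p. split; [right; auto|auto].
      * intros i Hi. simpl. rewrite Rmult_0_l, Rplus_0_l.
        destruct (Nat.eq_dec i d) as [->|Hne]; [|apply Hk; lia].
        assert (Hz : forall q, In q l -> E (snd q) d = 0).
        { intros q Hq. apply NNPP. intros Hne. apply Hn. exists (snd q). split; auto.
          right. rewrite <- Hl. now apply in_map. }
        clear -Hz. induction l as [|q l IH]; simpl; auto.
        rewrite Hz by (left; auto). rewrite IH; [ring|]. intros; apply Hz; right; auto.
Qed.

(** Translates coefficients found by [kernel] into a polynomial; the last clause turns a nonzero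
    kernel vector into a nonzero polynomial. *)
Lemma monomials_indep n s (l : list (R * nat)) : map snd l = seq s n ->
  exists f, polyfun n f /\ (forall x, lsum (fun p => fst p * x ^ snd p) l = x ^ s * f x) /\
    ((forall x, f x = 0) -> forall p, In p l -> fst p = 0).
Proof.
  revert s l. induction n; intros s l Hl.
  - apply map_eq_nil in Hl. subst. exists (fun _ => 0). split; [apply polyfun_zero|]. split.
    + intros; simpl; ring.
    + intros _ p [].
  - destruct l as [|[c k] l]; [discriminate|]. simpl in Hl. injection Hl as -> Hl.
    destruct (IHn (S s) l Hl) as (f & Hf & E & Hz).
    exists (fun x => c + x * f x). split; [|split].
    + exists c, f. auto.
    + intros x. simpl lsum. rewrite E. simpl. ring.
    + intros H0. assert (c = 0) by (specialize (H0 0); lra). subst c.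
      intros p [<-|Hp]; auto. apply Hz; auto.
      apply (polyfun_zero_off_zero n f Hf). intros x Hx. specialize (H0 x).
      apply (Rmult_eq_reg_l x); auto. lra.
Qed.

Lemma lsum_lin_fun {X} (L : (R -> R) -> R) lo hi (HL : posfun lo hi L) (F : X -> R -> R) (l : list (R * X)) :
  (forall x, cont lo hi (F x)) ->
  cont lo hi (fun t => lsum (fun p => fst p * F (snd p) t) l) /\
  L (fun t => lsum (fun p => fst p * F (snd p) t) l) = lsum (fun p => fst p * L (F (snd p))) l.
Proof.
  intros HF. induction l as [|p l [IH1 IH2]]; simpl.
  - split; [auto with cont|]. eapply pf_zero; eauto.
  - split; [auto with cont|].
    rewrite <- IH2, <- (pf_scal _ _ _ HL), (pf_add _ _ _ HL); auto with cont.
Qed.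

(** * Markov functions and orthogonality *)

(** A polynomial of the second kind. By Horner, [(t g(t) - u g(u)) / (t - u) = g(t) + u (g(t) -
    g(u)) / (t - u)], and the factor [u] joins [c]. *)
Lemma quot_integral lo hi L (HL : posfun lo hi L) n f c : cont lo hi c -> polyfun n f ->
  exists r, polyfun (pred n) r /\
    forall t, hi < t -> L (fun u => c u * ((f t - f u) / (t - u))) = r t.
Proof.
  revert f c. induction n; intros f c Hc Hf.
  - exists (fun _ => 0). split; [apply polyfun_zero|]. intros t Ht. simpl in Hf.
    rewrite <- (pf_zero _ _ _ HL). symmetry. apply (pf_ext _ _ _ HL); [auto with cont|].
    intros x Hx. rewrite !Hf. field. lra.
  - destruct Hf as (c0 & g & Hg & Hf).
    destruct (IHn g (fun u => c u * u)) as (r & Hr & E); auto with cont.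
    exists (fun t => L c * g t + r t). split.
    + simpl. apply polyfun_add; [now apply polyfun_scal|].
      eapply polyfun_le; [|exact Hr]. lia.
    + intros t Ht. rewrite <- E by auto.
      assert (forall x, lo <= x <= hi -> t - x <> 0) by (intros; lra). assert (Cg : cont lo hi g) by eauto with cont.
      rewrite (Rmult_comm (L c)), <- (pf_scal _ _ _ HL), <- (pf_add _ _ _ HL) by auto 10 with cont.
      symmetry. apply (pf_ext _ _ _ HL); [auto 10 with cont|].
      intros u Hu. rewrite !Hf. field. lra.
Qed.

Definition markov (L : (R -> R) -> R) (t : R) : R := L (fun u => / (t - u)).

Section Markov.
Variables (lo hi : R) (L : (R -> R) -> R).
Hypothesis HL : posfun lo hi L.

Definition lform (P1 P2 : R -> R) (t : R) : R := P1 t + P2 t * markov L t.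

(* The difference of the two sides is a polynomial of degree [< length xs] vanishing at the [xs]. *)
Lemma lform_identity A B P1 P2 xs : polyfun A P1 -> polyfun B P2 -> NoDup xs ->
  (forall x, In x xs -> hi < x) -> S (length xs) = (A + B)%nat -> (B <= A + 1)%nat ->
  (forall x, In x xs -> lform P1 P2 x = 0) ->
  forall t, hi < t -> lform P1 P2 t * P2 t = prodl xs t * L (fun u => P2 u ^ 2 / ((t - u) * prodl xs u)).
Proof.
  intros H1 H2 Hnd Hgt Hlen HBA Hz.
  assert (Hw0 : forall u, lo <= u <= hi -> prodl xs u <> 0).
  { intros u Hu E. apply prodl_zero in E. specialize (Hgt u E). lra. }
  assert (HG : polyfun (pred (B + B)) (fun u => P2 u * P2 u)) by now apply polyfun_mul.
  (* With [ω = prodl xs], [r1] integrates [(P2(t)^2 - P2(u)^2) / (t - u)], and [r2] integrates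
     [(ω(t) - ω(u)) / (t - u)] against [P2(u)^2 / ω(u)]. *)
  destruct (quot_integral lo hi L HL _ _ (fun _ => 1) (cont_const _ _ _) HG) as (r1 & Hr1 & E1).
  destruct (quot_integral lo hi L HL _ _ (fun u => P2 u ^ 2 / prodl xs u)
    ltac:(eauto 8 with cont) (prodl_polyfun xs)) as (r2 & Hr2 & E2).
  set (D := fun t => lform P1 P2 t * P2 t - prodl xs t * L (fun u => P2 u ^ 2 / ((t - u) * prodl xs u))).
  set (r := fun t => P1 t * P2 t + r1 t + (-1) * r2 t).
  assert (HD : forall t, hi < t -> D t = r t).
  { intros t Ht. unfold D, r, lform, markov.
    assert (Hn : forall x, lo <= x <= hi -> t - x <> 0) by (intros; lra).
    assert (Hn2 : forall x, lo <= x <= hi -> (t - x) * prodl xs x <> 0).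
    { intros; apply Rmult_integral_contrapositive; auto. }
    assert (C2 : cont lo hi P2) by eauto with cont.
    assert (C3 : cont lo hi (prodl xs)) by eauto with cont.
    rewrite <- E1, <- E2 by auto.
    assert (K : (P2 t * P2 t) * L (fun u => / (t - u)) + (- prodl xs t) * L (fun u => P2 u ^ 2 / ((t - u) * prodl xs u))
      = L (fun u => 1 * ((P2 t * P2 t - P2 u * P2 u) / (t - u)))
        + (-1) * L (fun u => P2 u ^ 2 / prodl xs u * ((prodl xs t - prodl xs u) / (t - u)))).
    { rewrite <- !(pf_scal _ _ _ HL), <- !(pf_add _ _ _ HL) by auto 12 with cont.
      apply (pf_ext _ _ _ HL); [auto 12 with cont|]. intros u Hu.
      specialize (Hw0 u Hu). specialize (Hn u Hu). field. auto. }
    lra. }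
  (* [P1 P2] and [r2] have at most [A + B - 1 = length xs] coefficients; [r1] has at most [2B - 2],
     and here [B <= A + 1] is used. *)
  assert (Hr : polyfun (length xs) r).
  { unfold r. apply polyfun_lin.
    - apply polyfun_add.
      + eapply polyfun_le; [|apply (polyfun_mul _ _ _ _ H1 H2)]. lia.
      + eapply polyfun_le; [|exact Hr1]. lia.
    - exact Hr2. }
  intros t Ht. apply Rminus_diag_uniq. change (D t = 0). rewrite HD by auto.
  apply (polyfun_roots _ _ xs Hr Hnd); auto.
  intros x Hx. rewrite <- HD by auto. unfold D. rewrite Hz by auto.
  rewrite (proj2 (prodl_zero xs x) Hx). ring.
Qed.

(** Left of the zeros the integrand has the sign [s], and it vanishes only at the finitely many
    zeros of [P2]. *)
Lemma lform_weight_sign B P2 xs s t : polyfun B P2 -> (exists x, P2 x <> 0) -> hi < t ->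
  (forall u, u <= hi -> 0 < s * prodl xs u) -> 0 < s * L (fun u => P2 u ^ 2 / ((t - u) * prodl xs u)).
Proof.
  intros H2 Hnz Ht Hs.
  assert (Hw0 : forall u, lo <= u <= hi -> (t - u) * prodl xs u <> 0).
  { intros u Hu. specialize (Hs u ltac:(lra)). apply Rmult_integral_contrapositive. split; [lra|].
    intros E. rewrite E in Hs. lra. }
  assert (Hp : forall u, u <= hi -> 0 < s / ((t - u) * prodl xs u)).
  { intros u Hu. specialize (Hs u Hu).
    assert (prodl xs u <> 0) by (intros E; rewrite E in Hs; lra).
    assert (s <> 0) by (intros E; rewrite E in Hs; lra).
    replace (s / ((t - u) * prodl xs u)) with (s ^ 2 / ((t - u) * (s * prodl xs u))).
    - apply Rdiv_lt_0_compat; [|apply Rmult_lt_0_compat; lra].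
      assert (0 < s * s) by nra. simpl; lra.
    - field. repeat split; auto. lra. }
  assert (C2 : cont lo hi P2) by eauto with cont.
  assert (C3 : cont lo hi (prodl xs)) by eauto with cont.
  rewrite <- (pf_scal _ _ _ HL) by auto 8 with cont.
  destruct (polyfun_zeros _ _ H2 Hnz) as [l Hl].
  assert (Eq : forall x, s * (P2 x ^ 2 / ((t - x) * prodl xs x)) = P2 x ^ 2 * (s / ((t - x) * prodl xs x))).
  { intros; unfold Rdiv; ring. }
  apply (pf_gt0 _ _ _ HL _ l); [auto 8 with cont| |]; intros x Hx; rewrite Eq.
  - apply Rmult_le_pos; [apply pow2_ge_0|]. apply Rlt_le, Hp; lra.
  - intros E. apply Hl. specialize (Hp x ltac:(lra)). apply Rmult_integral in E.
    destruct E as [E|E]; [|lra]. simpl in E. apply Rmult_integral in E. lra.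
Qed.

(** One zero more than [lform_identity] uses: at the extra point the left side vanishes, while the
    right side is a product of nonzero factors. *)
Lemma lform_indep A B P1 P2 xs : polyfun A P1 -> polyfun B P2 -> NoDup xs ->
  (forall x, In x xs -> hi < x) -> length xs = (A + B)%nat -> (B <= A + 1)%nat ->
  (forall x, In x xs -> lform P1 P2 x = 0) -> forall t, P2 t = 0.
Proof.
  intros H1 H2 Hnd Hgt Hlen HBA Hz t. apply NNPP. intros Hne.
  destruct xs as [|x xs].
  - simpl in Hlen. replace B with O in H2 by lia. apply Hne, H2.
  - inversion Hnd; subst.
    destruct (prodl_sign xs hi) as (s & _ & Hs). { intros; apply Hgt; right; auto. }
    pose proof (lform_weight_sign B P2 xs s x H2 (ex_intro _ t Hne) (Hgt x (or_introl eq_refl)) Hs) as Hp.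
    pose proof (lform_identity A B P1 P2 xs H1 H2 H4 (fun y Hy => Hgt y (or_intror Hy)) Hlen HBA
      (fun y Hy => Hz y (or_intror Hy)) x (Hgt x (or_introl eq_refl))) as HI.
    rewrite (Hz x (or_introl eq_refl)) in HI.
    rewrite Rmult_0_l in HI. symmetry in HI. apply Rmult_integral in HI. destruct HI as [HI|HI].
    + apply prodl_zero in HI. contradiction.
    + rewrite HI in Hp. lra.
Qed.

Lemma polyfun_const_sign n f a : polyfun n f -> (forall t, a < t -> f t <> 0) ->
  exists s, (s = 1 \/ s = -1) /\ forall t, a < t -> 0 < s * f t.
Proof.
  intros H Hnz. pose proof (Hnz (a + 1) ltac:(lra)) as H1.
  assert (Hc : forall x, continuity_pt f x).
  { intros x. apply (polyfun_cont n f x x H). lra. }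
  assert (Hg : forall g : R -> R, (forall x, continuity_pt g x) -> (forall t, a < t -> g t <> 0) ->
     0 < g (a + 1) -> forall t, a < t -> 0 < g t).
  { intros g Hgc Hgn Hg1 t Ht. apply Rnot_le_lt. intros Hle.
    specialize (Hgn t Ht) as Hgt.
    assert (g t < 0) by lra.
    destruct (Rtotal_order t (a + 1)) as [Hlt|[Heq|Hgt']].
    - destruct (Ranalysis5.IVT_interv g t (a + 1)) as (z & Hz & Ez); auto; try lra.
      apply (Hgn z); auto; lra.
    - subst t. lra.
    - destruct (Ranalysis5.IVT_interv (fun x => - g x) (a + 1) t) as (z & Hz & Ez); auto; try lra.
      + intros x Hx. apply (continuity_pt_opp g). apply Hgc.
      + apply (Hgn z); lra. }
  destruct (Rlt_dec 0 (f (a + 1))) as [Hp|Hp].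
  - exists 1. split; auto. intros t Ht. rewrite Rmult_1_l. apply Hg; auto.
  - exists (-1). split; auto. intros t Ht. replace (-1 * f t) with (- f t) by ring.
    apply (Hg (fun x => - f x)); auto; try lra.
    + intros x. apply (continuity_pt_opp f), Hc.
    + intros y Hy. specialize (Hnz y Hy). lra.
Qed.

(** There are [A + B] coefficients for [A + B - 1] prescribed zeros, hence a nonzero form. If [P2]
    is nonzero, it has constant sign right of [hi], and [lform_identity] makes the form times
    [prodl xs] a square times a function of constant sign. *)
Lemma lform_test A B xs : NoDup xs -> (forall x, In x xs -> hi < x) ->
  S (length xs) = (A + B)%nat -> (B <= A + 1)%nat ->
  exists P1 P2, polyfun A P1 /\ polyfun B P2 /\
    forall t, hi < t -> ~ In t xs -> 0 < lform P1 P2 t * prodl xs t.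
Proof.
  intros Hnd Hgt Hlen HBA.
  assert (Hsol : exists P1 P2, polyfun A P1 /\ polyfun B P2 /\ ((exists x, P1 x <> 0) \/ exists x, P2 x <> 0) /\
     forall x, In x xs -> lform P1 P2 x = 0).
  (* Unknowns are tagged: [true] for coefficients of [P1], [false] for those of [P2]. *)
  { destruct (kernel (length xs) (fun (p : bool * nat) i =>
       let t := nth i xs 0 in if fst p then t ^ snd p else t ^ snd p * markov L t)
       (map (pair true) (seq 0 A) ++ map (pair false) (seq 0 B))) as (l & Hl & (p & Hp & Hp0) & Hk).
    { rewrite length_app, !length_map, !length_seq. lia. }
    apply map_eq_app in Hl. destruct Hl as (l1 & l2 & -> & Hl1 & Hl2).
    set (pr := fun p : R * (bool * nat) => (fst p, snd (snd p))).
    destruct (monomials_indep A 0 (map pr l1)) as (P1 & HP1 & EP1 & NP1).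
    { rewrite map_map. unfold pr; simpl. rewrite <- (map_map snd snd), Hl1, map_map, map_id. auto. }
    destruct (monomials_indep B 0 (map pr l2)) as (P2 & HP2 & EP2 & NP2).
    { rewrite map_map. unfold pr; simpl. rewrite <- (map_map snd snd), Hl2, map_map, map_id. auto. }
    exists P1, P2. split; auto. split; auto. split.
    - apply NNPP. intros N. apply Hp0.
      assert (HpM : In (pr p) (map pr l1) \/ In (pr p) (map pr l2)).
      { apply in_app_or in Hp. destruct Hp; [left|right]; now apply in_map. }
      destruct HpM as [HpM|HpM].
      + apply (NP1) with (p := pr p); auto. intros x. apply NNPP. intros Hx. apply N; left; eauto.
      + apply (NP2) with (p := pr p); auto. intros x. apply NNPP. intros Hx. apply N; right; eauto.
    - intros x Hx. destruct (In_nth xs x 0 Hx) as (i & Hi & Ei).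
      specialize (Hk i Hi). simpl in Hk. rewrite Ei, lsum_app in Hk.
      unfold lform. rewrite <- (Rmult_1_l (P1 x)), <- (Rmult_1_l (P2 x)).
      change 1 with (x ^ 0). rewrite <- EP1, <- EP2, !lsum_map. unfold pr; simpl.
      rewrite <- Hk. f_equal.
      + assert (Hall : forall p, In p l1 -> fst (snd p) = true).
        { intros q Hq. apply (in_map snd) in Hq. rewrite Hl1 in Hq. apply in_map_iff in Hq.
          destruct Hq as (k & <- & _). auto. }
        clear -Hall. induction l1 as [|q l1 IH]; simpl; auto.
        rewrite (Hall q (or_introl eq_refl)), IH; auto. intros; apply Hall; right; auto.
      + assert (Hall : forall p, In p l2 -> fst (snd p) = false).
        { intros q Hq. apply (in_map snd) in Hq. rewrite Hl2 in Hq. apply in_map_iff in Hq.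
          destruct Hq as (k & <- & _). auto. }
        clear -Hall. induction l2 as [|q l2 IH]; simpl; [ring|].
        rewrite (Hall q (or_introl eq_refl)), <- IH; [ring|]. intros; apply Hall; right; auto. }
  destruct Hsol as (P1 & P2 & H1 & H2 & Hnz & Hz).
  assert (Hflip : exists s, (s = 1 \/ s = -1) /\ forall t, hi < t -> ~ In t xs -> 0 < s * (lform P1 P2 t * prodl xs t)).
  { destruct (classic (exists x, P2 x <> 0)) as [Hnz2|Hz2].
    (* By the identity, a zero of [P2] would belong to [xs] and hence be a zero of [P1] too.
       Cancelling the common factor lowers both counts by one and leaves [A + B - 2] zeros, which
       [lform_indep] forbids. *)
    - assert (HP2 : forall t, hi < t -> P2 t <> 0).
      { intros t Ht E2. destruct (prodl_sign xs hi Hgt) as (s & _ & Hs).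
        pose proof (lform_weight_sign B P2 xs s t H2 Hnz2 Ht Hs) as Hp.
        pose proof (lform_identity A B P1 P2 xs H1 H2 Hnd Hgt Hlen HBA Hz t Ht) as HI.
        rewrite E2, Rmult_0_r in HI. symmetry in HI. apply Rmult_integral in HI.
        destruct HI as [HI|HI]; [|rewrite HI in Hp; lra].
        apply prodl_zero in HI. pose proof HI as Hin.
        apply in_split in HI. destruct HI as (l1 & l2 & ->).
        assert (E1 : P1 t = 0). { specialize (Hz t Hin). unfold lform in Hz. rewrite E2 in Hz. lra. }
        rewrite length_app in Hlen. simpl in Hlen.
        destruct A as [|A]; [lia|]. destruct B as [|B]; [destruct Hnz2 as [x Hx]; apply Hx, H2|].
        destruct (polyfun_root _ _ _ H1 E1) as (Q1 & HQ1 & F1).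
        destruct (polyfun_root _ _ _ H2 E2) as (Q2 & HQ2 & F2).
        apply NoDup_remove in Hnd. destruct Hnd as [Hnd Hnin].
        assert (HQ0 : forall x, Q2 x = 0).
        { apply (lform_indep A B Q1 Q2 (l1 ++ l2)); auto.
          - intros x Hx. apply Hgt. apply in_app_or in Hx. apply in_or_app; simpl; tauto.
          - rewrite length_app. lia.
          - lia.
          - intros x Hx. assert (Hx' : In x (l1 ++ t :: l2)).
            { apply in_app_or in Hx. apply in_or_app; simpl; tauto. }
            specialize (Hz x Hx'). unfold lform in *. rewrite F1, F2 in Hz.
            assert (x - t <> 0). { intros E. apply Hnin. replace t with x by lra. auto. }
            apply (Rmult_eq_reg_l (x - t)); auto. rewrite Rmult_0_r, <- Hz. ring. }
        destruct Hnz2 as [x Hx]. apply Hx. rewrite F2, HQ0. ring. }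
      destruct (polyfun_const_sign B P2 hi H2 HP2) as (s2 & Hs2 & Hp2).
      destruct (prodl_sign xs hi Hgt) as (s & Hs' & Hs).
      exists (s * s2). split.
      { destruct Hs' as [-> | ->], Hs2 as [-> | ->]; [left|right|right|left]; ring. }
      intros t Ht Hnin.
      pose proof (lform_weight_sign B P2 xs s t H2 Hnz2 Ht Hs) as Hp.
      pose proof (lform_identity A B P1 P2 xs H1 H2 Hnd Hgt Hlen HBA Hz t Ht) as HI.
      specialize (Hp2 t Ht).
      assert (Hw : prodl xs t <> 0) by (intros E; apply prodl_zero in E; auto).
      (* Multiplication by [P2(t)^2] exposes the product of the form with [P2] without a
         division. *)
      apply (Rmult_lt_reg_l ((s2 * P2 t) ^ 2)); [nra|]. rewrite Rmult_0_r.
      replace ((s2 * P2 t) ^ 2 * (s * s2 * (lform P1 P2 t * prodl xs t))) with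
        ((s2 * s2) * (s2 * P2 t) * (s * ((lform P1 P2 t * P2 t) * prodl xs t))) by ring.
      rewrite HI.
      replace (s2 * s2) with 1 by (destruct Hs2 as [-> | ->]; ring).
      apply Rmult_lt_0_compat; [lra|].
      replace (s * (prodl xs t * L (fun u => P2 u ^ 2 / ((t - u) * prodl xs u)) * prodl xs t)) with
        ((prodl xs t * prodl xs t) * (s * L (fun u => P2 u ^ 2 / ((t - u) * prodl xs u)))) by ring.
      apply Rmult_lt_0_compat; auto. nra.
    - assert (Hz2' : forall x, P2 x = 0). { intros x. apply NNPP. intros Hx. apply Hz2; eauto. }
      assert (Hv : forall t, lform P1 P2 t = P1 t). { intros t. unfold lform. rewrite Hz2'. ring. }
      destruct Hnz as [[x0 Hx0]|Hnz]; [|exfalso; auto].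
      destruct (polyfun_factor A P1 (fun x => In x xs) H1 (ex_intro _ x0 Hx0)) as (rs & g & m & Hg & Hm & Hrs & Hgn & E).
      assert (incl xs rs).
      { intros x Hx. pose proof (Hz x Hx) as Hzx. rewrite Hv, E in Hzx. apply Rmult_integral in Hzx.
        destruct Hzx as [Hzx|Hzx]; [now apply prodl_zero|]. exfalso. apply (Hgn x Hx Hzx). }
      pose proof (NoDup_incl_length Hnd H) as Hle.
      destruct m as [|m]; [exfalso; apply Hx0; rewrite E; simpl in Hg; rewrite Hg; ring|].
      (* Here [P2 = 0], so [P1], with [A] coefficients, has [A + B - 1] zeros. This forces [B = 0]
         and makes [P1] a multiple of [prodl xs]. *)
      assert (m = 0%nat) by lia. subst m. destruct Hg as (c & g' & Hg' & Eg). simpl in Hg'.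
      assert (EP : forall x, P1 x = c * prodl xs x).
      { assert (Hperm : Permutation xs rs).
        { apply NoDup_Permutation_bis; auto. lia. }
        assert (Hpp : forall x, prodl xs x = prodl rs x).
        { intros x. clear -Hperm. induction Hperm; simpl; try rewrite IHHperm; try ring. congruence. }
        intros x. rewrite E, Eg, Hg', Hpp. ring. }
      assert (c <> 0). { intros ->. apply Hx0. rewrite EP. ring. }
      exists (if Rlt_dec 0 c then 1 else -1). split; [destruct (Rlt_dec 0 c); auto|].
      intros t Ht Hnin. assert (Hw : prodl xs t <> 0) by (intros Ew; apply prodl_zero in Ew; auto).
      rewrite Hv, EP. assert (0 < prodl xs t * prodl xs t) by nra.
      destruct (Rlt_dec 0 c); nra. }
  destruct Hflip as (s & Hs & Hp).
  exists (fun x => s * P1 x), (fun x => s * P2 x). split; [now apply polyfun_scal|]. split; [now apply polyfun_scal|].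
  intros t Ht Hnin. specialize (Hp t Ht Hnin). unfold lform in *.
  replace ((s * P1 t + s * P2 t * markov L t) * prodl xs t) with (s * ((P1 t + P2 t * markov L t) * prodl xs t)) by ring.
  exact Hp.
Qed.
End Markov.

Lemma markov_continuous lo hi L2 (HL2 : posfun lo hi L2) lo1 hi1 : hi < lo1 -> cont lo1 hi1 (markov L2).
Proof.
  intros Hlt x Hx. assert (Hc : cont lo1 hi1 (fun t => L2 (fun u => (fun _ => 1) u / (t - u)))).
  { apply (markov_cont lo hi); auto with cont. }
  specialize (Hc x Hx). eapply (continuity_pt_locally_ext _ (markov L2) (x - hi)); [| |exact Hc]; [lra|].
  intros y Hy. unfold markov. apply (pf_ext _ _ _ HL2).
  - apply Rabs_def2 in Hy. apply cont_mult; [auto with cont|]. apply cont_inv; [auto with cont|]. intros; lra.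
  - intros u Hu. unfold Rdiv. ring.
Qed.

(* Multiple zeros are absorbed, two at a time, into the measure. *)
Lemma orth_degree lo hi L2 (HL2 : posfun lo hi L2) A B lo1 hi1 : hi < lo1 -> (B <= A + 1)%nat ->
  forall n L1 p, posfun lo1 hi1 L1 -> polyfun n p -> (exists x, p x <> 0) ->
  (forall S, polyfun A S -> L1 (fun t => p t * S t) = 0) ->
  (forall S, polyfun B S -> L1 (fun t => p t * (S t * markov L2 t)) = 0) ->
  (A + B + 1 <= n)%nat.
Proof.
  intros Hlt HBA n. induction n as [n IH] using (well_founded_induction Wf_nat.lt_wf).
  intros L1 p HL1 Hp Hnz HA HB.
  destruct (polyfun_factor n p (fun x => lo1 < x < hi1) Hp Hnz) as (rs & g & m & Hg & Hm & Hrs & Hgn & E).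
  assert (Hgnz : exists x, g x <> 0).
  { destruct Hnz as [x Hx]. exists x. intros Ex. apply Hx. rewrite E, Ex. ring. }
  pose proof (markov_continuous _ _ _ HL2 lo1 hi1 Hlt) as Cm.
  destruct (classic (NoDup rs)) as [Hnd|Hnd].
  - destruct (Compare_dec.le_lt_dec (A + B) (length rs)) as [Hle|Hl].
    + destruct m as [|m]; [|lia]. exfalso. destruct Hgnz as [x Hx]. apply Hx, Hg.
    + exfalso.
      (* A test form with sign changes exactly at [rs] has [A' + B' = length rs + 1] coefficients.
         The cap on [B'] gives [B' <= A' + 1], and [A' <= A] follows from [length rs < A + B] and
         [B <= A + 1]. *)
      set (B' := Nat.min B ((length rs + 2) / 2)). set (A' := (S (length rs) - B')%nat).
      assert (HB' : (B' <= B)%nat /\ (2 * B' <= length rs + 2)%nat /\ (B' = B \/ length rs < 2 * B')%nat).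
      { unfold B'. pose proof (Nat.div_mod_eq (length rs + 2) 2). pose proof (Nat.mod_upper_bound (length rs + 2) 2 ltac:(lia)). lia. }
      assert (HA' : (A' <= A)%nat) by (unfold A'; lia).
      destruct (lform_test lo hi L2 HL2 A' B' rs Hnd) as (P1 & P2 & H1 & H2 & Hsign); try (unfold A'; lia).
      { intros x Hx. specialize (Hrs x Hx). lra. }
      apply (polyfun_le A' A) in H1; auto. apply (polyfun_le B' B) in H2; [|lia].
      assert (C1 : cont lo1 hi1 P1) by eauto with cont.
      assert (C2 : cont lo1 hi1 P2) by eauto with cont.
      assert (Cp : cont lo1 hi1 p) by eauto with cont.
      assert (Cg : cont lo1 hi1 g) by eauto with cont.
      assert (HI : L1 (fun t => p t * lform L2 P1 P2 t) = 0).
      { rewrite <- (Rplus_0_l 0). rewrite <- (HA P1 H1) at 1. rewrite <- (HB P2 H2).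
        rewrite <- (pf_add _ _ _ HL1) by auto with cont.
        apply (pf_ext _ _ _ HL1); [unfold lform; auto with cont|]. intros; unfold lform; ring. }
      (* All interior zeros of [p] sit in [rs], so the cofactor [g] has constant sign on the
         interval. *)
      assert (Hgs : exists s, (s = 1 \/ s = -1) /\ forall t, lo1 < t < hi1 -> 0 < s * g t).
      { pose proof (pf_lt _ _ _ HL1) as Hlh. set (mid := (lo1 + hi1) / 2).
        assert (Hmid : lo1 < mid < hi1) by (unfold mid; lra).
        assert (Hc : forall x, continuity_pt g x) by (intros x; apply (polyfun_cont m g x x Hg); lra).
        assert (Hgo : forall t, lo1 < t < hi1 -> 0 < g mid * g t).
        { intros t Ht. apply Rnot_le_lt. intros Hle.
          assert (Hg1 : g mid <> 0) by auto. assert (Hg2 : g t <> 0) by auto.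
          assert (Hle' : g mid * g t < 0).
          { destruct Hle as [|Hle]; auto. apply Rmult_integral in Hle. tauto. }
          assert (Hk : exists z, lo1 < z < hi1 /\ g mid * g z = 0).
          { assert (Hc1 : forall x, continuity_pt (fun z => g mid * g z) x).
            { intros x. apply (continuity_pt_scal g). apply Hc. }
            assert (Hsq : 0 < g mid * g mid) by nra.
            destruct (Rtotal_order t mid) as [Hc2|[->|Hc2]]; [|lra|].
            - destruct (Ranalysis5.IVT_interv (fun z => g mid * g z) t mid) as (z & Hz & Ez); auto.
              exists z. split; auto; lra.
            - destruct (Ranalysis5.IVT_interv (fun z => - (g mid * g z)) mid t) as (z & Hz & Ez); auto; try lra.
              + intros x Hx. apply (continuity_pt_opp (fun z => g mid * g z)). apply Hc1.
              + exists z. split; lra. }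
          destruct Hk as (z & Hz & Ez). apply Rmult_integral in Ez. destruct Ez; [auto|]. apply (Hgn z); auto. }
        exists (if Rlt_dec 0 (g mid) then 1 else -1). split; [destruct (Rlt_dec 0 (g mid)); auto|].
        intros t Ht. specialize (Hgo t Ht). specialize (Hgo). pose proof (Hgn mid Hmid).
        destruct (Rlt_dec 0 (g mid)); nra. }
      destruct Hgs as (s & Hs & Hgs).
      (* The product of [p] and the test form has constant sign and finitely many zeros, yet its
         integral is zero. *)
      apply (pf_pos _ _ _ HL1 (fun t => s * (p t * lform L2 P1 P2 t)) rs).
      * unfold lform; auto with cont.
      * intros t Ht. rewrite E.
        replace (s * (prodl rs t * g t * lform L2 P1 P2 t)) with ((s * g t) * (lform L2 P1 P2 t * prodl rs t)) by ring.
        specialize (Hgs t Ht). apply Rmult_le_pos; [lra|].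
        destruct (classic (In t rs)) as [Hin|Hin].
        -- rewrite (proj2 (prodl_zero rs t) Hin). lra.
        -- apply Rlt_le, Hsign; auto. lra.
      * rewrite (pf_scal _ _ _ HL1), HI; [ring|unfold lform; auto with cont].
      * intros t Ht E0. apply NNPP. intros Hin. specialize (Hsign t ltac:(lra) Hin).
        specialize (Hgs t Ht). rewrite E in E0.
        replace (s * (prodl rs t * g t * lform L2 P1 P2 t)) with ((s * g t) * (lform L2 P1 P2 t * prodl rs t)) in E0 by ring.
        apply Rmult_integral in E0. lra.
  - destruct (prodl_dup rs Hnd) as (r & ys & Hys & Er).
    assert (Hk : polyfun (n - 2) (fun x => prodl ys x * g x)).
    { eapply polyfun_le; [|apply (polyfun_mul _ _ _ _ (prodl_polyfun ys) Hg)]. simpl. lia. }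
    assert (n - 2 < n)%nat as Hn2 by lia.
    assert (HW : posfun lo1 hi1 (fun f => L1 (fun x => (x - r) ^ 2 * f x))).
    { apply (posfun_weight _ _ _ HL1 _ [r]); [auto with cont|intros; apply pow2_ge_0|].
      intros x Hx E0. left. destruct (Req_dec x r); auto. exfalso. apply (pow_nonzero (x - r) 2); auto. lra. }
    assert (Cg : cont lo1 hi1 (fun x => prodl ys x * g x)) by eauto with cont.
    pose proof (IH (n - 2)%nat Hn2 _ _ HW Hk) as IH'. cbv beta in IH'.
    assert (A + B + 1 <= n - 2)%nat; [|lia].
    apply IH'.
    + destruct Hnz as [x Hx]. exists x. intros E0. apply Hx. rewrite E, Er.
      rewrite Rmult_assoc, E0. ring.
    + intros S HS. rewrite <- (HA S HS). apply (pf_ext _ _ _ HL1); [eauto 7 with cont|].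
      intros x Hx. rewrite E, Er. ring.
    + intros S HS. rewrite <- (HB S HS). apply (pf_ext _ _ _ HL1); [eauto 7 with cont|].
      intros x Hx. rewrite E, Er. ring.
Qed.

(** * Double zeros and Wronskians *)

Lemma orth_powers lo hi L (HL : posfun lo hi L) A w : cont lo hi w ->
  (forall i, (i < A)%nat -> L (fun t => w t * t ^ i) = 0) ->
  forall S, polyfun A S -> L (fun t => w t * S t) = 0.
Proof.
  intros Hw. induction A; intros H S HS.
  - rewrite <- (pf_zero _ _ _ HL). symmetry. apply (pf_ext _ _ _ HL); auto with cont.
    intros x _. simpl in HS. rewrite HS. ring.
  - destruct (polyfun_top A S HS) as (c & g & Hg & E).
    assert (cont lo hi g) by eauto with cont.
    replace 0 with (0 + c * 0) by ring.
    rewrite <- (IHA (fun i Hi => H i ltac:(lia)) g Hg) at 1. rewrite <- (H A ltac:(lia)).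
    rewrite <- (pf_lin _ _ _ HL) by auto with cont.
    symmetry. apply (pf_ext _ _ _ HL); [auto with cont|]. intros x _. rewrite E. ring.
Qed.

Section Orth.
Variables (lo hi lo1 hi1 : R) (L2 : (R -> R) -> R).
Hypothesis HL2 : posfun lo hi L2.
Hypothesis Hhi : hi < 0.
Hypothesis Hlo1 : 0 <= lo1.

(** [c] is the lowest power in the relations without [h], and [c + e] the lowest in those with [h].
    The offset [e] stems from the factor [z^2] in [f]. *)
Definition orth (L1 : (R -> R) -> R) (c e A B : nat) (g : R -> R) : Prop :=
  (forall i, (c <= i < c + A)%nat -> L1 (fun t => t ^ i * g t) = 0) /\
  (forall i, (c + e <= i < c + e + B)%nat -> L1 (fun t => t ^ i * g t * markov L2 t) = 0).

Let Cm : cont lo1 hi1 (markov L2).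
Proof. apply (markov_continuous lo hi); auto. lra. Qed.

(* [t h(t) = ∫ dσ - ∫ (-u) dσ(u) / (t - u)], so a factor [t] amounts to the measure [-u dσ(u)]. *)
Lemma orth_shift c e A B : (e <= 1)%nat -> (B + e <= A + 1)%nat -> exists L2', posfun lo hi L2' /\
  forall L1 g, posfun lo1 hi1 L1 -> cont lo1 hi1 g -> orth L1 c e A B g ->
    (forall S, polyfun A S -> L1 (fun t => t ^ c * g t * S t) = 0) /\
    (forall S, polyfun B S -> L1 (fun t => t ^ c * g t * (S t * markov L2' t)) = 0).
Proof.
  intros He HBA.
  assert (H1 : forall L1 g, posfun lo1 hi1 L1 -> cont lo1 hi1 g -> orth L1 c e A B g ->
    (forall S, polyfun A S -> L1 (fun t => t ^ c * g t * S t) = 0) /\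
    (forall S, polyfun B S -> L1 (fun t => (t ^ c * g t * (t ^ e * markov L2 t)) * S t) = 0)).
  { intros L1 g HL1 Cg [HA HB]. split.
    - apply (orth_powers lo1 hi1 _ HL1); auto with cont. intros i Hi.
      rewrite <- (HA (c + i)%nat) by lia. apply (pf_ext _ _ _ HL1); [auto with cont|].
      intros x _. rewrite pow_add. ring.
    - apply (orth_powers lo1 hi1 _ HL1); auto with cont. intros i Hi.
      rewrite <- (HB (c + e + i)%nat) by lia. apply (pf_ext _ _ _ HL1); [auto 7 with cont|].
      intros x _. rewrite !pow_add. ring. }
  assert (e = 0 \/ e = 1)%nat as [-> | ->] by lia.
  - exists L2. split; auto. intros L1 g HL1 Cg Ho. destruct (H1 L1 g HL1 Cg Ho) as [HA HB].
    split; auto. intros S HS. assert (cont lo1 hi1 S) by eauto with cont.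
    rewrite <- (HB S HS). apply (pf_ext _ _ _ HL1); [auto with cont|]. intros; simpl; ring.
  - exists (fun f => L2 (fun u => (- u) * f u)). split.
    + apply (posfun_weight lo hi L2 HL2 _ []); auto with cont.
      * intros; lra.
      * intros x Hx E. lra.
    + intros L1 g HL1 Cg Ho. destruct (H1 L1 g HL1 Cg Ho) as [HA HB].
      split; auto. intros S HS. assert (CS : cont lo1 hi1 S) by eauto with cont.
      assert (E : forall t, lo1 <= t <= hi1 -> markov (fun f => L2 (fun u => - u * f u)) t =
         L2 (fun _ => 1) + (-1) * (t * markov L2 t)).
      { intros t Ht. unfold markov.
        assert (forall u, lo <= u <= hi -> t - u <> 0) by (intros; lra).
        rewrite <- !(pf_scal _ _ _ HL2), <- (pf_add _ _ _ HL2) by auto 8 with cont.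
        apply (pf_ext _ _ _ HL2); [auto with cont|]. intros u Hu. field. auto. }
      replace 0 with (L2 (fun _ => 1) * 0 + (-1) * 0) by ring.
      (* For [e = 1] the hypothesis reads [B <= A], so [S] is also a test polynomial of the first
         family and the constant part of the new Markov function drops out. *)
      rewrite <- (HA S) at 1 by (eapply polyfun_le; [|exact HS]; lia).
      rewrite <- (HB S HS).
      rewrite <- (pf_scal _ _ _ HL1), <- (pf_lin _ _ _ HL1) by auto 8 with cont.
      symmetry. apply (pf_ext _ _ _ HL1); [auto 8 with cont|].
      intros t Ht. cbv beta. rewrite E by auto. ring.
Qed.

Lemma posfun_power L1 c : posfun lo1 hi1 L1 -> posfun lo1 hi1 (fun f => L1 (fun t => t ^ c * f t)).
Proof.
  intros HL1. apply (posfun_weight _ _ _ HL1 _ []); auto with cont.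
  - intros x Hx. apply pow_le. lra.
  - intros x Hx E. apply (pow_nonzero x c); auto. lra.
Qed.

(** The factor [t^c] goes into the first measure and [t^e] into the second, which leaves the plain
    powers of [orth_degree]. *)
Lemma orth_bound L1 c e A B g n : posfun lo1 hi1 L1 -> (e <= 1)%nat -> (B + e <= A + 1)%nat ->
  orth L1 c e A B g -> polyfun n g -> (exists x, g x <> 0) -> (A + B + 1 <= n)%nat.
Proof.
  intros HL1 He HBA Ho Hg Hnz. assert (Cg : cont lo1 hi1 g) by eauto with cont.
  destruct (orth_shift c e A B He HBA) as (L2' & HL2' & Hs).
  destruct (Hs L1 g HL1 Cg Ho) as [HA HB].
  apply (orth_degree lo hi L2' HL2' A B lo1 hi1 ltac:(lra) ltac:(lia) n _ g (posfun_power L1 c HL1) Hg Hnz).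
  - intros S HS. rewrite <- (HA S HS). assert (cont lo1 hi1 S) by eauto with cont.
    apply (pf_ext _ _ _ HL1); [auto with cont|]. intros; ring.
  - intros S HS. rewrite <- (HB S HS). assert (cont lo1 hi1 S) by eauto with cont.
    assert (cont lo1 hi1 (markov L2')). { apply (markov_continuous lo hi); auto; lra. }
    apply (pf_ext _ _ _ HL1); [auto with cont|]. intros; ring.
Qed.

(** Removing [(t - x0)^2] leaves at most [A + B] coefficients, while all [A + B] relations persist
    for the measure with this weight; [orth_bound] asks for one coefficient more. *)
Lemma orth_no_double_zero L1 c e A B g g' n x0 : posfun lo1 hi1 L1 -> (e <= 1)%nat -> (B + e <= A + 1)%nat ->
  orth L1 c e A B g -> polyfun n g -> (exists x, g x <> 0) -> (n <= A + B + 2)%nat ->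
  derivable_pt_lim g x0 g' -> ~ (g x0 = 0 /\ g' = 0).
Proof.
  intros HL1 He HBA Ho Hg Hnz Hn Hd [H0 H0'].
  destruct n as [|n]; [destruct Hnz as [x Hx]; apply Hx, Hg|].
  destruct (polyfun_root n g x0 Hg H0) as (h & Hh & E).
  assert (Hh0 : h x0 = 0).
  { destruct (polyfun_deriv n h Hh) as [h' Hh'].
    assert (Hd' : derivable_pt_lim g x0 (1 * h x0 + (x0 - x0) * h' x0)).
    { replace g with (fun x => (x - x0) * h x) by (extensionality x; now rewrite E).
      apply (derivable_pt_lim_mult (fun x => x - x0)); auto.
      replace 1 with (1 - 0) by ring.
      apply (derivable_pt_lim_minus (fun x => x) (fun _ => x0)).
      - apply derivable_pt_lim_id.
      - apply derivable_pt_lim_const. }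
    pose proof (uniqueness_limite _ _ _ _ Hd Hd') as Hu. lra. }
  destruct n as [|n]; [destruct Hnz as [x Hx]; apply Hx; rewrite E; simpl in Hh; rewrite Hh; ring|].
  destruct (polyfun_root n h x0 Hh Hh0) as (k & Hk & Ek).
  assert (HW : posfun lo1 hi1 (fun f => L1 (fun x => (x - x0) ^ 2 * f x))).
  { apply (posfun_weight _ _ _ HL1 _ [x0]); [auto with cont|intros; apply pow2_ge_0|].
    intros x Hx E0. left. destruct (Req_dec x x0); auto. exfalso. apply (pow_nonzero (x - x0) 2); auto. lra. }
  assert (Ck : cont lo1 hi1 k) by eauto with cont.
  assert (A + B + 1 <= n)%nat; [|lia].
  apply (orth_bound _ c e A B k n HW He HBA); auto.
  - destruct Ho as [HA HB]. split; intros i Hi.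
    + rewrite <- (HA i Hi). apply (pf_ext _ _ _ HL1); [auto with cont|]. intros; rewrite E, Ek; ring.
    + rewrite <- (HB i Hi). apply (pf_ext _ _ _ HL1); [auto with cont|]. intros; rewrite E, Ek; ring.
  - destruct Hnz as [x Hx]. exists x. intros E0. apply Hx. rewrite E, Ek, E0. ring.
Qed.

(* A double zero [z] of the Cauchy transform moves into both measures, as [1/(t-z)^2] and [(u-z)^2],
   and yields two additional orthogonality relations. *)
Lemma orth_no_double_transform_zero L1 c e A B g n z : posfun lo1 hi1 L1 -> (e <= 1)%nat -> (B + e <= A + 1)%nat ->
  orth L1 c e A B g -> polyfun n g -> (exists x, g x <> 0) -> (n <= A + B + 2)%nat -> z < 0 ->
  ~ (L1 (fun t => t ^ c * g t / (t - z)) = 0 /\ L1 (fun t => t ^ c * g t / (t - z) ^ 2) = 0).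
Proof.
  intros HL1 He HBA Ho Hg Hnz Hn Hz [Z1 Z2]. assert (Cg : cont lo1 hi1 g) by eauto with cont.
  destruct (orth_shift c e A B He HBA) as (L2' & HL2' & Hs).
  destruct (Hs L1 g HL1 Cg Ho) as [HA HB].
  assert (N1 : forall x, lo1 <= x <= hi1 -> x - z <> 0) by (intros; lra).
  assert (N2 : forall x, lo1 <= x <= hi1 -> (x - z) ^ 2 <> 0) by (intros; apply pow_nonzero; auto).
  assert (HW1 : posfun lo1 hi1 (fun f => L1 (fun t => (t ^ c / (t - z) ^ 2) * f t))).
  { apply (posfun_weight _ _ _ HL1 _ []); auto with cont.
    - intros x Hx. apply Rmult_le_pos; [apply pow_le; lra|]. apply Rlt_le, Rinv_0_lt_compat, pow_lt. lra.
    - intros x Hx E. apply Rmult_integral in E. destruct E as [E|E].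
      + apply (pow_nonzero x c); auto. lra.
      + apply (Rinv_neq_0_compat ((x - z) ^ 2)); auto. apply N2; lra. }
  assert (HW2 : posfun lo hi (fun f => L2' (fun u => (u - z) ^ 2 * f u))).
  { apply (posfun_weight _ _ _ HL2' _ [z]); [auto with cont|intros; apply pow2_ge_0|].
    intros x Hx E0. left. destruct (Req_dec x z); auto. exfalso. apply (pow_nonzero (x - z) 2); auto. lra. }
  assert (Cm' : cont lo1 hi1 (markov L2')). { apply (markov_continuous lo hi); auto; lra. }
  (* Expansion of [S] at [z] to second order: the two zero conditions annihilate the constant and
     linear terms, the old relations the remainder. *)
  assert (HA' : forall S, polyfun (A + 2) S -> L1 (fun t => t ^ c / (t - z) ^ 2 * (g t * S t)) = 0).
  { intros S HS. replace (A + 2)%nat with (Datatypes.S (Datatypes.S A)) in HS by lia.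
    destruct (polyfun_quot _ S z HS) as (S1 & HS1 & E1).
    destruct (polyfun_quot _ S1 z HS1) as (S2 & HS2 & E2).
    assert (C2 : cont lo1 hi1 S2) by eauto with cont.
    replace 0 with (S z * 0 + (S1 z * 0 + 0)) by ring.
    rewrite <- Z2 at 1. rewrite <- Z1 at 1. rewrite <- (HA S2 HS2).
    rewrite <- !(pf_scal _ _ _ HL1), <- !(pf_add _ _ _ HL1) by auto 9 with cont.
    symmetry. apply (pf_ext _ _ _ HL1); [auto 9 with cont|]. intros x Hx.
    replace (S x) with (S z + (x - z) * (S1 z + (x - z) * S2 x)).
    - specialize (N1 x Hx). field. auto.
    - rewrite <- E2. replace (S1 z + (S1 x - S1 z)) with (S1 x) by ring. rewrite <- E1. ring. }
  assert (A + 2 + B + 1 <= n)%nat; [|lia].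
  apply (orth_degree lo hi _ HW2 (A + 2) B lo1 hi1 ltac:(lra) ltac:(lia) n _ g HW1 Hg Hnz); auto.
  intros S HS. assert (CS : cont lo1 hi1 S) by eauto with cont.
  (* From [(u - z)^2 / (t - u) = (t - z)^2 / (t - u) - (t - z) - (u - z)]: the new Markov function
     is [(t - z)^2] times the old one, minus [r]. *)
  set (r := fun t => L2' (fun _ => 1) * (t - z) + L2' (fun u => u - z)).
  assert (Hr : polyfun 2 r).
  { unfold r. apply polyfun_add; [apply polyfun_scal, polyfun_linear|apply polyfun_const; lia]. }
  (* [S r] has at most [B + 1 <= A + 2] coefficients, so the two relations just gained absorb it. *)
  assert (HSr : polyfun (A + 2) (fun t => S t * r t)).
  { eapply polyfun_le; [|apply (polyfun_mul _ _ _ _ HS Hr)]. lia. }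
  assert (E : forall t, lo1 <= t <= hi1 -> markov (fun f => L2' (fun u => (u - z) ^ 2 * f u)) t =
       (t - z) ^ 2 * markov L2' t + (-1) * r t).
  { intros t Ht. unfold markov, r.
    assert (forall u, lo <= u <= hi -> t - u <> 0) by (intros; lra).
    rewrite (Rmult_comm (L2' (fun _ => 1))).
    rewrite <- (pf_scal _ _ _ HL2' (fun _ => 1)), <- (pf_add _ _ _ HL2'), <- !(pf_scal _ _ _ HL2'), <- (pf_add _ _ _ HL2') by auto 9 with cont.
    apply (pf_ext _ _ _ HL2'); [auto with cont|]. intros u Hu. field. auto. }
  assert (Cr : cont lo1 hi1 r) by eauto with cont.
  replace 0 with (0 + (-1) * 0) by ring. rewrite <- (HB S HS) at 1. rewrite <- (HA' _ HSr).
  rewrite <- (pf_lin _ _ _ HL1) by auto 9 with cont.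
  symmetry. apply (pf_ext _ _ _ HL1); [auto 9 with cont|].
  intros t Ht. cbv beta. rewrite E by auto. specialize (N1 t Ht). field. auto.
Qed.
End Orth.

(** * Wronskians and interlacing *)

Lemma wronskian_neq_0 f f' g g' : (forall a b, a <> 0 \/ b <> 0 -> ~ (a * f + b * g = 0 /\ a * f' + b * g' = 0)) ->
  f * g' - f' * g <> 0.
Proof.
  (* In each case the coefficients form a kernel vector of the singular matrix with rows [(f, g)]
     and [(f', g')]. *)
  intros H E. destruct (Req_dec f 0) as [F|F].
  - destruct (Req_dec g 0) as [G|G].
    + destruct (Req_dec g' 0) as [G'|G'].
      * apply (H 0 1); [right; lra|]. split; lra.
      * apply (H g' (- f')); [left; auto|]. split; [rewrite F, G|]; ring.
    + apply (H g (- f)); [left; auto|]. split; [ring|lra].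
  - apply (H g (- f)); [right; lra|]. split; [ring|lra].
Qed.

(* The two functions enter only through their zero sets [Zf] and [Zg] on [P]. *)
Definition wpair (P Zf Zg : R -> Prop) : Prop := exists f f' g g' : R -> R,
  (forall x, P x -> derivable_pt_lim f x (f' x)) /\ (forall x, P x -> derivable_pt_lim g x (g' x)) /\
  (forall x, P x -> (Zf x <-> f x = 0)) /\ (forall x, P x -> (Zg x <-> g x = 0)) /\
  (forall x, P x -> f x * g' x - f' x * g x <> 0).

Lemma wpair_sym P Zf Zg : wpair P Zf Zg -> wpair P Zg Zf.
Proof.
  intros (f & f' & g & g' & H1 & H2 & H3 & H4 & H5). exists g, g', f, f'. repeat split; try apply H3; try apply H4; auto.
  intros x Hx E. apply (H5 x Hx). lra.
Qed.

Lemma wpair_ext (P Q Zf Zg Zf' Zg' : R -> Prop) : (forall x, Q x -> P x) -> (forall x, Q x -> (Zf x <-> Zf' x)) ->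
  (forall x, Q x -> (Zg x <-> Zg' x)) -> wpair P Zf Zg -> wpair Q Zf' Zg'.
Proof.
  intros HP Ef Eg (f & f' & g & g' & H1 & H2 & H3 & H4 & H5). exists f, f', g, g'.
  split; [auto|]. split; [auto|]. split; [|split]; auto; intros x Hx.
  - rewrite <- Ef by auto. auto.
  - rewrite <- Eg by auto. auto.
Qed.

Lemma wpair_no_common P Zf Zg x : wpair P Zf Zg -> P x -> ~ (Zf x /\ Zg x).
Proof.
  intros (f & f' & g & g' & H1 & H2 & H3 & H4 & H5) Hx [Hf Hg].
  apply (H5 x Hx). apply H3 in Hf; auto. apply H4 in Hg; auto. rewrite Hf, Hg. ring.
Qed.

(** By the chain rule the Wronskian only gains the factor [3 x^2]. *)
Lemma wpair_cube P Zf Zg : (forall x, P x -> x <> 0) -> wpair (fun t => exists x, P x /\ t = x ^ 3) Zf Zg ->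
  wpair P (fun x => Zf (x ^ 3)) (fun x => Zg (x ^ 3)).
Proof.
  intros HP (f & f' & g & g' & H1 & H2 & H3 & H4 & H5).
  assert (Hc : forall x, derivable_pt_lim (fun x => x ^ 3) x (3 * x ^ 2)).
  { intros x. replace (3 * x ^ 2) with (INR 3 * x ^ pred 3) by (simpl; ring). apply derivable_pt_lim_pow. }
  exists (fun x => f (x ^ 3)), (fun x => f' (x ^ 3) * (3 * x ^ 2)), (fun x => g (x ^ 3)), (fun x => g' (x ^ 3) * (3 * x ^ 2)).
  split; [|split; [|split; [|split]]].
  - intros x Hx. apply (derivable_pt_lim_comp (fun x => x ^ 3) f); eauto.
  - intros x Hx. apply (derivable_pt_lim_comp (fun x => x ^ 3) g); eauto.
  - intros x Hx. apply H3; eauto.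
  - intros x Hx. apply H4; eauto.
  - intros x Hx E. apply (H5 (x ^ 3)); eauto. specialize (HP x Hx).
    apply (Rmult_eq_reg_l (3 * x ^ 2)); [|apply Rmult_integral_contrapositive; split; [lra|apply pow_nonzero; auto]].
    rewrite Rmult_0_r, <- E. ring.
Qed.

Lemma rolle_quotient f f' g g' x y : x < y -> (forall z, x <= z <= y -> derivable_pt_lim f z (f' z)) ->
  (forall z, x <= z <= y -> derivable_pt_lim g z (g' z)) -> (forall z, x <= z <= y -> g z <> 0) ->
  f x = 0 -> f y = 0 -> exists z, x < z < y /\ f z * g' z - f' z * g z = 0.
Proof.
  intros Hxy Hf Hg Hn Fx Fy.
  destruct (MVT_cor2 (fun z => f z / g z) (fun z => (f' z * g z - g' z * f z) / Rsqr (g z)) x y Hxy) as (z & E & Hz).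
  - intros z Hz. apply (derivable_pt_lim_div f g); auto.
  - exists z. split; auto. rewrite Fx, Fy in E.
    specialize (Hn z ltac:(lra)).
    replace (0 / g y - 0 / g x) with 0 in E by (unfold Rdiv; ring).
    symmetry in E. apply Rmult_integral in E. destruct E as [E|E]; [|lra].
    apply Rmult_integral in E. destruct E as [E|E]; [lra|].
    exfalso. revert E. apply Rinv_neq_0_compat. unfold Rsqr. nra.
Qed.

(** With no zero of [g] in between, Rolle applied to [f / g] gives a zero of the Wronskian; at the
    endpoints [g] is nonzero since common zeros are excluded. Two zeros of [g] give the same
    contradiction with [g / f]. *)
Lemma wpair_interlace P Zf Zg x y : wpair P Zf Zg -> (forall z, x <= z <= y -> P z) -> x < y ->
  Zf x -> Zf y -> (forall w, x < w < y -> ~ Zf w) -> exists! w, x < w < y /\ Zg w.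
Proof.
  intros (f & f' & g & g' & H1 & H2 & H3 & H4 & H5) HP Hxy Zx Zy Hno.
  apply H3 in Zx; [|apply HP; lra]. apply H3 in Zy; [|apply HP; lra].
  assert (exists w, x < w < y /\ g w = 0) as (w & Hw & Hgw).
  { apply NNPP. intros N.
    destruct (rolle_quotient f f' g g' x y) as (z & Hz & E); auto.
    - intros z Hz Gz. assert (PZ : P z) by auto. apply (H5 z PZ).
      destruct (Req_dec z x) as [-> |]; [rewrite Zx, Gz; ring|].
      destruct (Req_dec z y) as [-> |]; [rewrite Zy, Gz; ring|].
      exfalso. apply N. exists z. split; auto; lra.
    - apply (H5 z); auto. apply HP; lra. }
  exists w. split; [split; auto; apply H4; auto; apply HP; lra|].
  assert (Hun : forall w1 w2, x < w1 -> w1 < w2 -> w2 < y -> g w1 = 0 -> g w2 = 0 -> False).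
  { intros w1 w2 A1 A2 A3 G1 G2.
    destruct (rolle_quotient g g' f f' w1 w2) as (z & Hz & E); auto.
    - intros; apply H2, HP; lra.
    - intros; apply H1, HP; lra.
    - intros z Hz Fz. apply (Hno z); [lra|]. apply H3; auto. apply HP; lra.
    - apply (H5 z); [apply HP; lra|]. lra. }
  intros w' [Hw' Zw']. apply H4 in Zw'; [|apply HP; lra].
  destruct (Rtotal_order w w') as [Hc|[Hc|Hc]]; auto; exfalso;
    [apply (Hun w w')|apply (Hun w' w)]; auto; lra.
Qed.

(** * Consecutive orthogonal polynomials *)

Section Levels.
Variables (lo hi hi1 : R) (L1 L2 : (R -> R) -> R).
Hypothesis HL1 : posfun 0 hi1 L1.
Hypothesis HL2 : posfun lo hi L2.
Hypothesis Hhi : hi < 0.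

(* Orthogonality of [z^r g(z^3)] to the powers [z^k] in the conditions defining [Q_m], read off in
   the variable [t = z^3]; only the [k] with [3 | r + k], resp. [3 | r + k + 2], contribute. *)
Definition resid_orth (m r : nat) (g : R -> R) : Prop :=
  (forall i k, (3 * i = r + k)%nat -> (2 * k + 1 <= m)%nat -> L1 (fun t => t ^ i * g t) = 0) /\
  (forall i k, (3 * i = r + 2 + k)%nat -> (2 * k + 2 <= m)%nat -> L1 (fun t => t ^ i * g t * markov L2 t) = 0).

(** What remains of [Q_m] in the variable [t]. The leading coefficient is forgotten; being nonzero
    suffices because only zeros matter. *)
Definition level (m d r : nat) (g : R -> R) : Prop :=
  (m = 3 * d + r)%nat /\ (r < 3)%nat /\ polyfun (d + 1) g /\ (exists x, g x <> 0) /\ resid_orth m r g.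

Let Cm : cont 0 hi1 (markov L2).
Proof. apply (markov_continuous lo hi); auto. Qed.

(** The period 6 combines the residue of exponents modulo 3 with the parity of [m], which decides
    the family that gained the last condition. *)
Lemma mod6_cases m : exists l, (m = 6 * l \/ m = 6 * l + 1 \/ m = 6 * l + 2 \/ m = 6 * l + 3 \/ m = 6 * l + 4 \/ m = 6 * l + 5)%nat.
Proof.
  exists (m / 6)%nat. pose proof (Nat.div_mod_eq m 6). pose proof (Nat.mod_upper_bound m 6 ltac:(lia)). lia.
Qed.

(** Read in the variable [z]: no nonzero [z^r g(z^3)] of degree below [m] satisfies the conditions
    for [m]. In each class the available exponents form two ranges to which [orth_bound] applies. *)
Lemma resid_bound m r n g : (r < 3)%nat -> resid_orth m r g -> polyfun n g -> (exists x, g x <> 0) ->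
  (m + 3 <= 3 * n + r)%nat.
Proof.
  intros Hr [H1 H2] Hg Hnz.
  assert (Hb : forall c e A B, (e <= 1)%nat -> (B + e <= A + 1)%nat ->
    (forall i, (c <= i < c + A)%nat -> (r <= 3 * i /\ 2 * (3 * i - r) + 1 <= m)%nat) ->
    (forall i, (c + e <= i < c + e + B)%nat -> (r + 2 <= 3 * i /\ 2 * (3 * i - r - 2) + 2 <= m)%nat) ->
    (A + B + 1 <= n)%nat).
  { intros c e A B He HBA HA HB. apply (orth_bound lo hi 0 hi1 L2 HL2 Hhi ltac:(lra) L1 c e A B g); auto.
    split; intros i Hi.
    - specialize (HA i Hi). apply (H1 i (3 * i - r)%nat); lia.
    - specialize (HB i Hi). apply (H2 i (3 * i - r - 2)%nat); lia. }
  destruct (mod6_cases m) as [l Hl].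
  (* The pairs [(c, e)] are [(0, 1)], [(1, 0)], [(1, 1)]: [c] and [c + e] are [r / 3] and
     [(r + 2) / 3] rounded up. The range lengths are each [l] or [l + 1]. *)
  assert (r = 0 \/ r = 1 \/ r = 2)%nat as [-> |[-> | ->]] by lia;
    [pose proof (Hb 0%nat 1%nat) as Hc|pose proof (Hb 1%nat 0%nat) as Hc|pose proof (Hb 1%nat 1%nat) as Hc]; clear Hb H1 H2;
    destruct Hl as [Hl|[Hl|[Hl|[Hl|[Hl|Hl]]]]];
    first [ specialize (Hc (l + 1) (l + 1) ltac:(lia) ltac:(lia) ltac:(intros; lia) ltac:(intros; lia))%nat; lia
          | specialize (Hc (l + 1) l ltac:(lia) ltac:(lia) ltac:(intros; lia) ltac:(intros; lia))%nat; lia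
          | specialize (Hc l (l + 1) ltac:(lia) ltac:(lia) ltac:(intros; lia) ltac:(intros; lia))%nat; lia
          | specialize (Hc l l ltac:(lia) ltac:(lia) ltac:(intros; lia) ltac:(intros; lia))%nat; lia ].
Qed.

(** When the residue passes from 2 to 0, the exponents of the two polynomials are off by one; the
    factor [t] realigns them. *)
Definition lift (r : nat) (g : R -> R) : R -> R := match r with 2%nat => fun t => t * g t | _ => g end.
(** The lowest exponent in the relations without [h] that [lift r g] and its successor share. *)
Definition wexp (r : nat) : nat := match r with 2%nat => 0 | _ => 1 end.

Lemma comb_zero a b w f g : cont 0 hi1 w -> cont 0 hi1 f -> cont 0 hi1 g ->
  L1 (fun t => w t * f t) = 0 -> L1 (fun t => w t * g t) = 0 -> L1 (fun t => w t * (a * f t + b * g t)) = 0.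
Proof.
  intros Cw Cf Cg H1 H2. replace 0 with (a * 0 + b * 0) by ring. rewrite <- H1 at 1. rewrite <- H2.
  rewrite <- (pf_scal _ _ _ HL1), <- (pf_lin _ _ _ HL1) by auto with cont.
  apply (pf_ext _ _ _ HL1); auto with cont. intros; ring.
Qed.

(** Were [lift r g] and [g'] proportional, [g] would inherit a further relation from [g']: [d + 1]
    relations for [d + 1] coefficients, against [orth_bound]. *)
Lemma level_indep m d r d' r' g g' : (2 <= m)%nat -> level m d r g -> level (S m) d' r' g' ->
  forall a b, a <> 0 \/ b <> 0 -> exists x, a * lift r g x + b * g' x <> 0.
Proof.
  intros Hm (Em & Hr & Hg & [x0 Hx0] & H1 & H2) (Em' & Hr' & Hg' & [x1 Hx1] & H1' & H2') a b Hab.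
  apply NNPP. intros N.
  assert (Hz : forall x, a * lift r g x + b * g' x = 0).
  { intros x. apply NNPP. intros Hx. apply N; eauto. }
  clear N.
  assert (Cg : cont 0 hi1 g) by eauto with cont. assert (Cg' : cont 0 hi1 g') by eauto with cont.
  assert (Cu : cont 0 hi1 (lift r g)).
  { destruct r as [|[|[|]]]; simpl; auto with cont. }
  assert (Ha : a <> 0).
  { intros ->. destruct Hab as [|Hb]; auto. specialize (Hz x1). rewrite Rmult_0_l, Rplus_0_l in Hz.
    apply Rmult_integral in Hz. tauto. }
  assert (Hu : forall x, lift r g x = - (b / a) * g' x).
  { intros x. specialize (Hz x). apply (Rmult_eq_reg_l a); auto.
    replace (a * (- (b / a) * g' x)) with (- (b * g' x)) by (field; auto). lra. }
  assert (HT : forall w, cont 0 hi1 w -> L1 (fun t => w t * g' t) = 0 -> L1 (fun t => w t * lift r g t) = 0).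
  { intros w Cw Hw. rewrite <- (Rmult_0_r (- (b / a))), <- Hw, <- (pf_scal _ _ _ HL1) by auto with cont.
    apply (pf_ext _ _ _ HL1); auto with cont. intros x _. rewrite Hu. ring. }
  assert (HU1 : forall i k, (3 * i = r' + k)%nat -> (2 * k + 1 <= S m)%nat -> L1 (fun t => t ^ i * lift r g t) = 0).
  { intros i k E1 E2. apply HT; eauto with cont. }
  assert (HU2 : forall i k, (3 * i = r' + 2 + k)%nat -> (2 * k + 2 <= S m)%nat -> L1 (fun t => t ^ i * lift r g t * markov L2 t) = 0).
  { intros i k E1 E2. specialize (H2' i k E1 E2).
    rewrite <- (HT (fun t => t ^ i * markov L2 t)).
    - apply (pf_ext _ _ _ HL1); auto with cont. intros; ring.
    - auto with cont.
    - rewrite <- H2'. apply (pf_ext _ _ _ HL1); auto with cont. intros; ring. }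
  assert (Hb : forall c e A B, (e <= 1)%nat -> (B + e <= A + 1)%nat ->
    orth L2 L1 c e A B g -> (A + B + 1 <= d + 1)%nat).
  { intros c e A B He HBA Ho. apply (orth_bound lo hi 0 hi1 L2 HL2 Hhi ltac:(lra) L1 c e A B g); eauto. }
  clear HT H1' H2'.
  assert (HV : r = 2%nat -> (forall i, L1 (fun t => t ^ i * lift r g t) = 0 -> L1 (fun t => t ^ (S i) * g t) = 0) /\
    (forall i, L1 (fun t => t ^ i * lift r g t * markov L2 t) = 0 -> L1 (fun t => t ^ (S i) * g t * markov L2 t) = 0)).
  { intros ->. split; intros i <-; apply (pf_ext _ _ _ HL1); simpl; auto with cont; intros; ring. }
  (* In each class the own and the inherited exponents together fill two ranges with
     [A + B = d + 1]. *)
  destruct (mod6_cases m) as [l Hl]. destruct Hl as [Hl|[Hl|[Hl|[Hl|[Hl|Hl]]]]].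
  - assert (r = 0 /\ d = 2 * l /\ r' = 1)%nat as (-> & Hd & ->) by lia. simpl in *.
    specialize (Hb 0 1 (l + 1) l ltac:(lia) ltac:(lia))%nat. assert (l + 1 + l + 1 <= d + 1)%nat; [|lia].
    apply Hb. split; intros i Hi.
    + destruct (Nat.eq_dec i 0) as [-> |]; [apply (H1 _ 0%nat); lia|apply (HU1 _ (3 * i - 1)%nat); lia].
    + apply (H2 _ (3 * i - 2)%nat); lia.
  - assert (r = 1 /\ d = 2 * l /\ r' = 2)%nat as (-> & Hd & ->) by lia. simpl in *.
    specialize (Hb 1 0 l (l + 1) ltac:(lia) ltac:(lia))%nat. assert (l + (l + 1) + 1 <= d + 1)%nat; [|lia].
    apply Hb. split; intros i Hi.
    + apply (H1 _ (3 * i - 1)%nat); lia.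
    + destruct (Nat.eq_dec i 1) as [-> |]; [apply (H2 _ 0%nat); lia|apply (HU2 _ (3 * i - 4)%nat); lia].
  - assert (r = 2 /\ d = 2 * l /\ r' = 0)%nat as (-> & Hd & ->) by lia.
    destruct (HV eq_refl) as [V1 V2].
    specialize (Hb 1 1 (l + 1) l ltac:(lia) ltac:(lia))%nat. assert (l + 1 + l + 1 <= d + 1)%nat; [|lia].
    apply Hb. split; intros i Hi; destruct i as [|i]; try lia.
    + apply V1. apply (HU1 _ (3 * i)%nat); lia.
    + apply V2. apply (HU2 _ (3 * i - 2)%nat); lia.
  - assert (r = 0 /\ d = 2 * l + 1 /\ r' = 1)%nat as (-> & Hd & ->) by lia. simpl in *.
    specialize (Hb 0 1 (l + 1) (l + 1) ltac:(lia) ltac:(lia))%nat. assert (l + 1 + (l + 1) + 1 <= d + 1)%nat; [|lia].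
    apply Hb. split; intros i Hi.
    + apply (H1 _ (3 * i)%nat); lia.
    + apply (HU2 _ (3 * i - 3)%nat); lia.
  - assert (r = 1 /\ d = 2 * l + 1 /\ r' = 2)%nat as (-> & Hd & ->) by lia. simpl in *.
    specialize (Hb 1 0 (l + 1) (l + 1) ltac:(lia) ltac:(lia))%nat. assert (l + 1 + (l + 1) + 1 <= d + 1)%nat; [|lia].
    apply Hb. split; intros i Hi.
    + apply (HU1 _ (3 * i - 2)%nat); lia.
    + apply (H2 _ (3 * i - 3)%nat); lia.
  - assert (r = 2 /\ d = 2 * l + 1 /\ r' = 0)%nat as (-> & Hd & ->) by lia.
    destruct (HV eq_refl) as [V1 V2].
    specialize (Hb 1 1 (l + 1) (l + 1) ltac:(lia) ltac:(lia))%nat. assert (l + 1 + (l + 1) + 1 <= d + 1)%nat; [|lia].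
    apply Hb. split; intros i Hi; destruct i as [|i]; try lia.
    + apply V1. apply (HU1 _ (3 * i)%nat); lia.
    + apply V2. apply (HU2 _ (3 * i - 2)%nat); lia.
Qed.

(* All combinations satisfy at least [deg - 1] orthogonality relations. *)
Lemma level_comb m d r d' r' g g' : (2 <= m)%nat -> level m d r g -> level (S m) d' r' g' ->
  exists e A B N, (e <= 1)%nat /\ (B + e <= A + 1)%nat /\ (N <= A + B + 2)%nat /\
    forall a b, polyfun N (fun x => a * lift r g x + b * g' x) /\
      orth L2 L1 (wexp r) e A B (fun x => a * lift r g x + b * g' x).
Proof.
  intros Hm (Em & Hr & Hg & _ & H1 & H2) (Em' & Hr' & Hg' & _ & H1' & H2').
  assert (Cg : cont 0 hi1 g) by eauto with cont. assert (Cg' : cont 0 hi1 g') by eauto with cont.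
  assert (Cu : cont 0 hi1 (lift r g)).
  { destruct r as [|[|[|]]]; simpl; auto with cont. }
  assert (Hb : forall e A B N, polyfun N (lift r g) -> polyfun N g' -> orth L2 L1 (wexp r) e A B (lift r g) ->
    orth L2 L1 (wexp r) e A B g' -> forall a b, polyfun N (fun x => a * lift r g x + b * g' x) /\
      orth L2 L1 (wexp r) e A B (fun x => a * lift r g x + b * g' x)).
  { intros e A B N P1 P2 [O1 O2] [O1' O2'] a b. split.
    - apply polyfun_lin; auto. apply polyfun_scal; auto.
    - split; intros i Hi.
      + apply comb_zero; auto with cont.
      + specialize (O2 i Hi). specialize (O2' i Hi).
        rewrite <- (comb_zero a b (fun t => t ^ i * markov L2 t) (lift r g) g'); auto with cont.
        * apply (pf_ext _ _ _ HL1); auto with cont. intros; ring.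
        * rewrite <- O2. apply (pf_ext _ _ _ HL1); auto with cont. intros; ring.
        * rewrite <- O2'. apply (pf_ext _ _ _ HL1); auto with cont. intros; ring. }
  assert (HV : r = 2%nat -> (forall i, L1 (fun t => t ^ (S i) * g t) = 0 -> L1 (fun t => t ^ i * lift r g t) = 0) /\
    (forall i, L1 (fun t => t ^ (S i) * g t * markov L2 t) = 0 -> L1 (fun t => t ^ i * lift r g t * markov L2 t) = 0)).
  { intros ->. split; intros i <-; apply (pf_ext _ _ _ HL1); simpl; auto with cont; intros; ring. }
  (* [A] and [B] count the relations common to both polynomials, and [N = A + B + 2] throughout.
     Where [l - 1] occurs, [2 <= m] gives [1 <= l]; for [r = 2] the factor [t] raises [N] to
     [d + 2]. *)
  destruct (mod6_cases m) as [l Hl]. destruct Hl as [Hl|[Hl|[Hl|[Hl|[Hl|Hl]]]]].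
  - assert (r = 0 /\ d = 2 * l /\ r' = 1)%nat as (-> & Hd & ->) by lia. simpl in *.
    exists 0%nat, (l - 1)%nat, l, (d + 1)%nat. split; [lia|]. split; [lia|]. split; [lia|].
    apply Hb; auto. { eapply polyfun_le; [|exact Hg']; lia. }
    + split; intros i Hi; [apply (H1 _ (3 * i)%nat)|apply (H2 _ (3 * i - 2)%nat)]; lia.
    + split; intros i Hi; [apply (H1' _ (3 * i - 1)%nat)|apply (H2' _ (3 * i - 3)%nat)]; lia.
  - assert (r = 1 /\ d = 2 * l /\ r' = 2)%nat as (-> & Hd & ->) by lia. simpl in *.
    exists 1%nat, l, (l - 1)%nat, (d + 1)%nat. split; [lia|]. split; [lia|]. split; [lia|].
    apply Hb; auto. { eapply polyfun_le; [|exact Hg']; lia. }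
    + split; intros i Hi; [apply (H1 _ (3 * i - 1)%nat)|apply (H2 _ (3 * i - 3)%nat)]; lia.
    + split; intros i Hi; [apply (H1' _ (3 * i - 2)%nat)|apply (H2' _ (3 * i - 4)%nat)]; lia.
  - assert (r = 2 /\ d = 2 * l /\ r' = 0)%nat as (-> & Hd & ->) by lia.
    destruct (HV eq_refl) as [V1 V2].
    exists 1%nat, l, l, (d + 2)%nat. split; [lia|]. split; [lia|]. split; [lia|].
    apply Hb.
    { simpl. replace (d + 2)%nat with (S (d + 1)) by lia. now apply polyfun_mulX. }
    { eapply polyfun_le; [|exact Hg']; lia. }
    + split; intros i Hi; simpl in Hi; [apply V1, (H1 _ (3 * i + 1)%nat)|apply V2, (H2 _ (3 * i - 1)%nat)]; lia.
    + split; intros i Hi; simpl in Hi; [apply (H1' _ (3 * i)%nat)|apply (H2' _ (3 * i - 2)%nat)]; lia.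
  - assert (r = 0 /\ d = 2 * l + 1 /\ r' = 1)%nat as (-> & Hd & ->) by lia. simpl in *.
    exists 0%nat, l, l, (d + 1)%nat. split; [lia|]. split; [lia|]. split; [lia|].
    apply Hb; auto. { eapply polyfun_le; [|exact Hg']; lia. }
    + split; intros i Hi; [apply (H1 _ (3 * i)%nat)|apply (H2 _ (3 * i - 2)%nat)]; lia.
    + split; intros i Hi; [apply (H1' _ (3 * i - 1)%nat)|apply (H2' _ (3 * i - 3)%nat)]; lia.
  - assert (r = 1 /\ d = 2 * l + 1 /\ r' = 2)%nat as (-> & Hd & ->) by lia. simpl in *.
    exists 1%nat, l, l, (d + 1)%nat. split; [lia|]. split; [lia|]. split; [lia|].
    apply Hb; auto. { eapply polyfun_le; [|exact Hg']; lia. }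
    + split; intros i Hi; [apply (H1 _ (3 * i - 1)%nat)|apply (H2 _ (3 * i - 3)%nat)]; lia.
    + split; intros i Hi; [apply (H1' _ (3 * i - 2)%nat)|apply (H2' _ (3 * i - 4)%nat)]; lia.
  - assert (r = 2 /\ d = 2 * l + 1 /\ r' = 0)%nat as (-> & Hd & ->) by lia.
    destruct (HV eq_refl) as [V1 V2].
    exists 1%nat, (l + 1)%nat, l, (d + 2)%nat. split; [lia|]. split; [lia|]. split; [lia|].
    apply Hb.
    { simpl. replace (d + 2)%nat with (S (d + 1)) by lia. now apply polyfun_mulX. }
    { eapply polyfun_le; [|exact Hg']; lia. }
    + split; intros i Hi; simpl in Hi; [apply V1, (H1 _ (3 * i + 1)%nat)|apply V2, (H2 _ (3 * i - 1)%nat)]; lia.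
    + split; intros i Hi; simpl in Hi; [apply (H1' _ (3 * i)%nat)|apply (H2' _ (3 * i - 2)%nat)]; lia.
Qed.

Lemma level_const m d r g : (m <= 2)%nat -> level m d r g -> exists c, c <> 0 /\ forall x, g x = c.
Proof.
  intros Hm (Em & Hr & Hg & [x Hx] & _). replace (d + 1)%nat with 1%nat in Hg by lia.
  destruct Hg as (c & g0 & H0 & E). simpl in H0. exists c. split.
  - intros ->. apply Hx. rewrite E, H0. ring.
  - intros y. rewrite E, H0. ring.
Qed.

(** For the lowest levels both polynomials are constants, with vanishing Wronskian. As only zero
    sets count, they are replaced by [1] and [x], whose Wronskian is 1. *)
Lemma wpair_trivial (P Zf Zg : R -> Prop) : (forall x, P x -> ~ Zf x) -> (forall x, P x -> ~ Zg x) ->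
  (forall x, P x -> x <> 0) -> wpair P Zf Zg.
Proof.
  intros Hf Hg HP. exists (fun _ => 1), (fun _ => 0), (fun x => x), (fun _ => 1).
  split; [intros; apply derivable_pt_lim_const|]. split; [intros; apply derivable_pt_lim_id|].
  split; [|split]; intros x Hx.
  - split; [intros Hz; now destruct (Hf x)|lra].
  - split; [intros Hz; now destruct (Hg x)|]. intros E. now destruct (HP x).
  - lra.
Qed.

Lemma level_wpair m d r d' r' g g' : level m d r g -> level (S m) d' r' g' ->
  wpair (fun t => 0 < t) (fun t => g t = 0) (fun t => g' t = 0).
Proof.
  intros Hl Hl'. destruct (Compare_dec.le_lt_dec m 1) as [Hm|Hm].
  - destruct (level_const m d r g ltac:(lia) Hl) as (c & Hc & E).
    destruct (level_const (S m) d' r' g' ltac:(lia) Hl') as (c' & Hc' & E').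
    apply wpair_trivial; intros x Hx; [rewrite E|rewrite E'|]; lra.
  - pose proof (level_indep _ _ _ _ _ _ _ Hm Hl Hl') as Hnz.
    destruct (level_comb _ _ _ _ _ _ _ Hm Hl Hl') as (e & A & B & N & He & HBA & HN & Hcomb).
    destruct Hl as (Em & Hr & Hg & _). destruct Hl' as (_ & _ & Hg' & _).
    assert (Hu : exists u', forall x, derivable_pt_lim (lift r g) x (u' x)).
    { apply (polyfun_deriv (S (d + 1))). destruct r as [|[|[|]]]; simpl lift;
        try (apply polyfun_S; exact Hg). now apply polyfun_mulX. }
    destruct Hu as [u' Hu'].
    destruct (polyfun_deriv _ _ Hg') as [w' Hw'].
    exists (lift r g), u', g', w'. split; [auto|]. split; [auto|]. split; [|split]; [|tauto|].
    + intros x Hx. destruct r as [|[|[|]]]; simpl; try tauto.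
      split; [intros ->; ring|]. intros E. apply Rmult_integral in E. destruct E; auto; lra.
    + intros x Hx. apply wronskian_neq_0. intros a b Hab.
      destruct (Hcomb a b) as [HP HO].
      apply (orth_no_double_zero lo hi 0 hi1 L2 HL2 Hhi ltac:(lra) L1 (wexp r) e A B _ _ N x HL1 He HBA HO HP (Hnz a b Hab) HN).
      apply (derivable_pt_lim_plus (fun x => a * lift r g x) (fun x => b * g' x));
        [apply (derivable_pt_lim_scal (lift r g))|apply (derivable_pt_lim_scal g')]; auto.
Qed.

(** The argument stands for the cube of the original variable. From [1 / (w - z) = (w^2 + w z + z^2)
    / (w^3 - z^3)], multiplied by [w^r], the term with a power of [w] divisible by 3 carries [w^0]
    if [r = 0] and [w^3 = t] otherwise. *)
Definition psi (r : nat) (g : R -> R) (z : R) : R :=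
  L1 (fun t => t ^ (match r with O => 0 | _ => 1 end) * g t / (t - z)).

Lemma psi_const_neq r g c z : c <> 0 -> (forall x, g x = c) -> z < 0 -> psi r g z <> 0.
Proof.
  intros Hc E Hz E0. unfold psi in E0. set (k := match r with O => 0%nat | _ => 1%nat end) in *.
  assert (HN : forall x, 0 <= x <= hi1 -> x - z <> 0) by (intros; lra).
  assert (Cg : cont 0 hi1 g). { replace g with (fun _ : R => c) by (extensionality x; auto). auto with cont. }
  apply (pf_pos _ _ _ HL1 (fun t => / c * (t ^ k * g t / (t - z))) []).
  - auto with cont.
  - intros x Hx. rewrite E. replace (/ c * (x ^ k * c / (x - z))) with (x ^ k / (x - z)) by (field; lra).
    apply Rlt_le, Rdiv_lt_0_compat; [apply pow_lt|]; lra.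
  - rewrite (pf_scal _ _ _ HL1), E0; [ring|auto with cont].
  - intros x Hx. rewrite E. replace (/ c * (x ^ k * c / (x - z))) with (x ^ k / (x - z)) by (field; lra).
    intros H. assert (0 < x ^ k / (x - z)); [|lra]. apply Rdiv_lt_0_compat; [apply pow_lt|]; lra.
Qed.

Lemma level_psi_wpair m d r d' r' g g' : level m d r g -> level (S m) d' r' g' ->
  wpair (fun z => z < 0) (fun z => psi r g z = 0) (fun z => psi r' g' z = 0).
Proof.
  intros Hl Hl'. destruct (Compare_dec.le_lt_dec m 1) as [Hm|Hm].
  - destruct (level_const m d r g ltac:(lia) Hl) as (c & Hc & E).
    destruct (level_const (S m) d' r' g' ltac:(lia) Hl') as (c' & Hc' & E').
    apply wpair_trivial; intros x Hx; [apply (psi_const_neq _ _ c)|apply (psi_const_neq _ _ c')|lra]; auto.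
  - pose proof (level_indep _ _ _ _ _ _ _ Hm Hl Hl') as Hnz.
    destruct (level_comb _ _ _ _ _ _ _ Hm Hl Hl') as (e & A & B & N & He & HBA & HN & Hcomb).
    destruct Hl as (Em & Hr & Hg & _ & H1 & _). destruct Hl' as (Em' & Hr' & Hg' & _).
    assert (Cg : cont 0 hi1 g) by eauto with cont. assert (Cg' : cont 0 hi1 g') by eauto with cont.
    assert (Cu : cont 0 hi1 (lift r g)).
    { destruct r as [|[|[|]]]; simpl; auto with cont. }
    set (c := wexp r).
    assert (HN0 : forall z, z < 0 -> forall x, 0 <= x <= hi1 -> x - z <> 0) by (intros; lra).
    exists (fun z => L1 (fun t => t ^ c * lift r g t / (t - z))), (fun z => L1 (fun t => t ^ c * lift r g t / (t - z) ^ 2)),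
           (fun z => L1 (fun t => t ^ c * g' t / (t - z))), (fun z => L1 (fun t => t ^ c * g' t / (t - z) ^ 2)).
    split; [|split; [|split; [|split]]]; intros z Hz.
    + apply (cauchy_transform_deriv 0 hi1 L1 HL1 (fun t => t ^ c * lift r g t)); auto with cont.
    + apply (cauchy_transform_deriv 0 hi1 L1 HL1 (fun t => t ^ c * g' t)); auto with cont.
    + specialize (HN0 z Hz). unfold psi, c. destruct r as [|[|[|]]]; simpl wexp; simpl lift; try lia.
      (* By [t / (t - z) = 1 + z / (t - z)] and since [g] has integral zero, the transforms with
         weights [t] and 1 differ by the nonzero factor [z]. *)
      * assert (E : L1 (fun t => t ^ 1 * g t / (t - z)) = L1 (fun t => t ^ 0 * g t) + z * L1 (fun t => t ^ 0 * g t / (t - z))).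
        { rewrite <- (pf_lin _ _ _ HL1) by auto with cont. apply (pf_ext _ _ _ HL1); auto with cont.
          intros x Hx. field. auto. }
        rewrite (H1 0%nat 0%nat) in E by lia. rewrite E. split; [intros ->; ring|].
        intros E0. rewrite Rplus_0_l in E0. apply Rmult_integral in E0. destruct E0; auto; lra.
      * tauto.
      * assert (E : L1 (fun t => t ^ 1 * g t / (t - z)) = L1 (fun t => t ^ 0 * (t * g t) / (t - z))).
        { apply (pf_ext _ _ _ HL1); auto with cont. intros x Hx. simpl. field. auto. }
        rewrite E. tauto.
    + unfold psi, c. destruct r as [|[|[|]]]; simpl wexp; try lia.
      * replace r' with 1%nat by lia. tauto.
      * replace r' with 2%nat by lia. tauto.
      * replace r' with 0%nat by lia. tauto.
    + specialize (HN0 z Hz). apply wronskian_neq_0. intros a b Hab.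
      assert (HN2 : forall x, 0 <= x <= hi1 -> (x - z) ^ 2 <> 0) by (intros; apply pow_nonzero; auto).
      destruct (Hcomb a b) as [HP HO].
      pose proof (orth_no_double_transform_zero lo hi 0 hi1 L2 HL2 Hhi ltac:(lra) L1 (wexp r) e A B _ N z HL1 He HBA HO HP (Hnz a b Hab) HN Hz) as Hd.
      intros [Z1 Z2]. apply Hd. fold c.
      assert (HE : forall q, cont 0 hi1 q -> (forall x, 0 <= x <= hi1 -> q x <> 0) ->
        L1 (fun t => t ^ c * (a * lift r g t + b * g' t) / q t) =
        a * L1 (fun t => t ^ c * lift r g t / q t) + b * L1 (fun t => t ^ c * g' t / q t)).
      { intros q Cq Hq. rewrite <- (pf_scal _ _ _ HL1 _ a), <- (pf_lin _ _ _ HL1) by auto with cont.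
        apply (pf_ext _ _ _ HL1); auto with cont. intros x Hx. field. auto. }
      split.
      * rewrite (HE (fun t => t - z)); auto with cont.
      * rewrite (HE (fun t => (t - z) ^ 2)); auto with cont.
Qed.

(** * Existence of solutions of exact degree *)

Lemma resid_orth_scal m r k g : cont 0 hi1 g -> resid_orth m r g -> resid_orth m r (fun t => k * g t).
Proof.
  intros Cg [H1 H2]. split; intros i j E1 E2.
  - rewrite <- (Rmult_0_r k), <- (H1 i j E1 E2), <- (pf_scal _ _ _ HL1) by auto with cont.
    apply (pf_ext _ _ _ HL1); auto with cont. intros; ring.
  - rewrite <- (Rmult_0_r k), <- (H2 i j E1 E2), <- (pf_scal _ _ _ HL1) by auto with cont.
    apply (pf_ext _ _ _ HL1); auto with cont. intros; ring.
Qed.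

(** The exponents of class [r] fit into ranges of total length [d], one less than the number of
    coefficients in degree [d]. *)
Lemma resid_count m d r : (m = 3 * d + r)%nat -> (r < 3)%nat -> exists c c' A B, (A + B = d)%nat /\
  (forall i k, 3 * i = r + k -> 2 * k + 1 <= m -> c <= i < c + A)%nat /\
  (forall i k, 3 * i = r + 2 + k -> 2 * k + 2 <= m -> c' <= i < c' + B)%nat.
Proof.
  intros Hm Hr. destruct (mod6_cases m) as [l Hl]. destruct Hl as [Hl|[Hl|[Hl|[Hl|[Hl|Hl]]]]].
  - exists 0%nat, 1%nat, l, l. split; [lia|split; intros; lia].
  - exists 1%nat, 1%nat, l, l. split; [lia|split; intros; lia].
  - exists 1%nat, 2%nat, l, l. split; [lia|split; intros; lia].
  - exists 0%nat, 1%nat, (l + 1)%nat, l. split; [lia|split; intros; lia].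
  - exists 1%nat, 1%nat, l, (l + 1)%nat. split; [lia|split; intros; lia].
  - exists 1%nat, 2%nat, (l + 1)%nat, l. split; [lia|split; intros; lia].
Qed.

(** [kernel] yields a nonzero solution of degree at most [d]; [resid_bound] shows that its top
    coefficient can be normalised to 1. *)
Lemma resid_exists d r : (r < 3)%nat -> exists g, polyfun d g /\ resid_orth (3 * d + r) r (fun t => g t + t ^ d).
Proof.
  intros Hr. set (m := (3 * d + r)%nat).
  destruct (resid_count m d r eq_refl Hr) as (c & c' & A & B & HAB & HA & HB).
  set (w := fun i t => if Compare_dec.lt_dec i A then t ^ (c + i) else t ^ (c' + (i - A)) * markov L2 t).
  assert (Cw : forall i, cont 0 hi1 (w i)).
  { intros i. unfold w. destruct (Compare_dec.lt_dec i A); auto with cont. }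
  destruct (kernel d (fun j i => L1 (fun t => w i t * t ^ j)) (seq 0 (S d))) as (l & Hl & (p & Hp & Hp0) & Hk).
  { apply length_seq. }
  destruct (monomials_indep (S d) 0 l Hl) as (f & Hf & Ef & Hz).
  assert (Cf : cont 0 hi1 f) by eauto with cont.
  assert (Hw : forall i, (i < d)%nat -> L1 (fun t => w i t * f t) = 0).
  { intros i Hi. rewrite <- (Hk i Hi).
    destruct (lsum_lin_fun L1 0 hi1 HL1 (fun j t => w i t * t ^ j) l) as [_ HL]; [auto with cont|].
    rewrite <- HL. apply (pf_ext _ _ _ HL1); auto with cont. intros x _.
    rewrite <- (Rmult_1_l (f x)). change 1 with (x ^ 0). rewrite <- Ef. clear.
    induction l as [|q l IH]; simpl; [ring|]. rewrite <- IH. ring. }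
  assert (Ho : resid_orth m r f).
  { split; intros i k E1 E2.
    - specialize (HA i k E1 E2). rewrite <- (Hw (i - c)%nat) by lia.
      apply (pf_ext _ _ _ HL1); auto with cont. intros x _. unfold w.
      destruct (Compare_dec.lt_dec (i - c) A); [|lia]. now replace (c + (i - c))%nat with i by lia.
    - specialize (HB i k E1 E2). rewrite <- (Hw (A + (i - c'))%nat) by lia.
      apply (pf_ext _ _ _ HL1); auto with cont. intros x _. unfold w.
      destruct (Compare_dec.lt_dec (A + (i - c')) A); [lia|].
      replace (c' + (A + (i - c') - A))%nat with i by lia. ring. }
  assert (Hnz : exists x, f x <> 0).
  { apply NNPP. intros N. apply Hp0, Hz; auto. intros x. apply NNPP. intros Hx. apply N; eauto. }
  destruct (polyfun_top d f Hf) as (k & g & Hg & E).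
  (* Otherwise [d] coefficients remain, one fewer than [resid_bound] demands. *)
  assert (Hk0 : k <> 0).
  { intros ->. assert (Hfd : polyfun d f) by (eapply polyfun_ext; [|exact Hg]; intros x; rewrite E; ring).
    pose proof (resid_bound m r d f Hr Ho Hfd Hnz). lia. }
  exists (fun t => / k * g t). split; [now apply polyfun_scal|].
  replace (fun t => / k * g t + t ^ d) with (fun t => / k * f t).
  - apply resid_orth_scal; auto.
  - extensionality x. rewrite E. field. auto.
Qed.
End Levels.

(** * Integrals over the star *)

Lemma Cx_ring : ring_theory C0 C1 Cadd Cmul Csub Copp (@eq Cx).
Proof.
  constructor; intros; repeat match goal with z : Cx |- _ => destruct z end;
    unfold Csub, Cadd, Cmul, Copp, C0, C1; simpl; f_equal; ring.
Qed.
Add Ring Cx_ring : Cx_ring.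

Lemma Cx_eq (z w : Cx) : fst z = fst w -> snd z = snd w -> z = w.
Proof. destruct z, w; simpl; congruence. Qed.

Lemma RtoC_add x y : RtoC (x + y) = Cadd (RtoC x) (RtoC y).
Proof. apply Cx_eq; simpl; ring. Qed.
Lemma RtoC_mul x y : RtoC (x * y) = Cmul (RtoC x) (RtoC y).
Proof. apply Cx_eq; simpl; ring. Qed.
Lemma RtoC_pow x n : Cpow (RtoC x) n = RtoC (x ^ n).
Proof. induction n; [reflexivity|]. simpl. now rewrite IHn, <- RtoC_mul. Qed.

Lemma Cpow_add z n m : Cpow z (n + m) = Cmul (Cpow z n) (Cpow z m).
Proof. induction n; simpl; [|rewrite IHn]; ring. Qed.

Lemma Cpow_mult z n m : Cpow z (n * m) = Cpow (Cpow z n) m.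
Proof.
  induction m; simpl; [now rewrite Nat.mul_0_r|].
  rewrite Nat.mul_succ_r, Nat.add_comm, Cpow_add, IHm. reflexivity.
Qed.

Lemma Cmul_integral z w : Cmul z w = C0 -> z = C0 \/ w = C0.
Proof.
  destruct z as [a b], w as [c d]. intros H. injection H. simpl. intros H1 H2.
  assert (E : (a * a + b * b) * (c * c + d * d) = 0).
  { replace ((a * a + b * b) * (c * c + d * d)) with ((a * c - b * d) * (a * c - b * d) + (a * d + b * c) * (a * d + b * c)) by ring.
    rewrite H1, H2. ring. }
  apply Rmult_integral in E. destruct E; [left|right]; apply Cx_eq; simpl; nra.
Qed.

Lemma Cpow_eq0 z n : Cpow z n = C0 -> z = C0.
Proof.
  induction n; simpl; intros H.
  - injection H. intros; lra.
  - apply Cmul_integral in H. tauto.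
Qed.

Lemma Cinv_unique z w : Cmul z w = C1 -> Cinv z = w.
Proof.
  destruct z as [a b], w as [c d]. intros H. injection H as H1 H2. simpl in H1, H2.
  assert (N : a * a + b * b <> 0).
  { intros E. assert (a = 0 /\ b = 0) as [-> ->] by nra. lra. }
  assert (N' : a ^ 2 + b ^ 2 <> 0) by (intros E; apply N; rewrite <- E; ring).
  unfold Cinv; cbn [fst snd]. apply Cx_eq; cbn [fst snd].
  - apply (Rmult_eq_reg_l (a ^ 2 + b ^ 2)); auto. replace ((a ^ 2 + b ^ 2) * (a / (a ^ 2 + b ^ 2))) with a by (field; auto).
    transitivity (a * (a * c - b * d) + b * (a * d + b * c)); [rewrite H1, H2|]; ring.
  - apply (Rmult_eq_reg_l (a ^ 2 + b ^ 2)); auto. replace ((a ^ 2 + b ^ 2) * (- b / (a ^ 2 + b ^ 2))) with (- b) by (field; auto).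
    transitivity (a * (a * d + b * c) - b * (a * c - b * d)); [rewrite H1, H2|]; ring.
Qed.

Lemma omega_sum : Cadd C1 (Cadd omega (Cmul omega omega)) = C0.
Proof.
  pose proof (sqrt_sqrt 3 ltac:(lra)). apply Cx_eq; unfold omega; simpl; lra.
Qed.

Lemma omega_cube : Cpow omega 3 = C1.
Proof.
  pose proof omega_sum as H. simpl.
  transitivity (Cadd C1 (Cmul (Csub omega C1) (Cadd C1 (Cadd omega (Cmul omega omega))))); [ring|].
  rewrite H. ring.
Qed.

Definition ray (k : nat) (x : R) : Cx := Cmul (Cpow omega k) (RtoC x).

Lemma ray_cube k x : Cpow (ray k x) 3 = RtoC (x ^ 3).
Proof.
  unfold ray. rewrite <- RtoC_pow.
  assert (E : Cpow (Cpow omega k) 3 = C1).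
  { rewrite <- Cpow_mult, Nat.mul_comm, Cpow_mult, omega_cube.
    induction k; simpl; [|rewrite IHk]; ring. }
  transitivity (Cmul (Cpow (Cpow omega k) 3) (Cpow (RtoC x) 3)); [simpl; ring|]. rewrite E. ring.
Qed.

Definition cpolyfun (n : nat) (G : R -> Cx) : Prop := polyfun n (fun t => fst (G t)) /\ polyfun n (fun t => snd (G t)).

(** A Horner step rotates the three parts, and part 2 re-enters part 0 with a factor [t]. The
    inequality says that part [r] has at most [(length Q - r) / 3] coefficients, rounded up. *)
Lemma peval_split (Q : cpoly) : exists (G : nat -> R -> Cx) (n : nat -> nat),
  (forall r, (r < 3)%nat -> cpolyfun (n r) (G r) /\ (3 * n r + r <= length Q + 2)%nat) /\
  forall z t, Cpow z 3 = RtoC t -> peval Q z = Cadd (G 0%nat t) (Cadd (Cmul z (G 1%nat t)) (Cmul (Cmul z z) (G 2%nat t))).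
Proof.
  induction Q as [|c Q (G & n & HG & HE)].
  - exists (fun _ _ => C0), (fun _ => 0%nat). split.
    + intros r Hr. split; [split; apply polyfun_zero|simpl; lia].
    + intros z t _. simpl. ring.
  - exists (fun r => match r with O => fun t => Cadd c (Cmul (RtoC t) (G 2%nat t)) | S r => G r end),
           (fun r => match r with O => S (n 2%nat) | S r => n r end).
    split.
    + intros [|r] Hr; simpl length.
      * destruct (HG 2%nat ltac:(lia)) as [[H1 H2] Hn]. split; [|lia]. split.
        -- exists (fst c), (fun t => fst (G 2%nat t)). split; auto. intros; simpl; ring.
        -- exists (snd c), (fun t => snd (G 2%nat t)). split; auto. intros; simpl; ring.
      * destruct (HG r ltac:(lia)) as [H1 Hn]. split; auto. lia.
    + intros z t Hz. simpl. rewrite (HE z t Hz), <- Hz. simpl. ring.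
Qed.

Lemma peval_monic (q : cpoly) z : peval (q ++ [C1]) z = Cadd (peval q z) (Cpow z (length q)).
Proof. induction q; simpl; [|rewrite IHq]; ring. Qed.

Lemma peval_spread d g : polyfun d g -> exists Q : cpoly, length Q = (3 * d)%nat /\
  forall z t, Cpow z 3 = RtoC t -> peval Q z = RtoC (g t).
Proof.
  revert g. induction d; intros g H.
  - exists []. split; auto. intros z t _. simpl in *. rewrite H. reflexivity.
  - destruct H as (c & f & Hf & H). destruct (IHd f Hf) as (Q & HQ & E).
    exists (RtoC c :: C0 :: C0 :: Q). split; [simpl; lia|]. intros z t Hz. simpl.
    rewrite (E z t Hz), H, RtoC_add, RtoC_mul, <- Hz. simpl. ring.
Qed.

Lemma peval_shift r Q z : peval (repeat C0 r ++ Q) z = Cmul (Cpow z r) (peval Q z).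
Proof. induction r; simpl; [|rewrite IHr]; ring. Qed.

Definition ccont (hi1 : R) (G : R -> Cx) : Prop := cont 0 hi1 (fun t => fst (G t)) /\ cont 0 hi1 (fun t => snd (G t)).

Lemma ccont_add h G H : ccont h G -> ccont h H -> ccont h (fun t => Cadd (G t) (H t)).
Proof. intros [] []; split; simpl; auto with cont. Qed.
Lemma ccont_mul h G H : ccont h G -> ccont h H -> ccont h (fun t => Cmul (G t) (H t)).
Proof. intros [] []; split; simpl; auto with cont. Qed.
Lemma ccont_const h c : ccont h (fun _ => c).
Proof. split; simpl; auto with cont. Qed.
Lemma ccont_RtoC h f : cont 0 h f -> ccont h (fun t => RtoC (f t)).
Proof. split; simpl; auto with cont. Qed.
#[export] Hint Resolve ccont_add ccont_mul ccont_const ccont_RtoC : cont.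

Section Star.
Variables (alpha : R) (s1 : R -> R).
Hypothesis Halpha : 0 < alpha.
Hypothesis Hs1 : exists I, has_int 0 alpha s1 I.

Definition starint (f : R -> R) : R := Int 0 alpha (fun x => f (x ^ 3) * s1 x).

(** Decomposition on the star into the three eigenspaces of the rotation by [omega]. *)
Definition on_rays (G : Cx -> Cx) (Gs : nat -> R -> Cx) : Prop :=
  (forall r, (r < 3)%nat -> ccont (alpha ^ 3) (Gs r)) /\
  forall k x, (k < 3)%nat -> 0 <= x <= alpha ->
    G (ray k x) = Cadd (Gs 0%nat (x ^ 3)) (Cadd (Cmul (ray k x) (Gs 1%nat (x ^ 3))) (Cmul (Cmul (ray k x) (ray k x)) (Gs 2%nat (x ^ 3)))).

Lemma cont_cube0 f : cont 0 (alpha ^ 3) f -> cont 0 alpha (fun x => f (x ^ 3)).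
Proof. intros H. apply cont_cube. replace (0 ^ 3) with 0 by ring. exact H. Qed.

Lemma cint_exists (T : R -> Cx) : cont 0 alpha (fun x => fst (T x)) -> cont 0 alpha (fun x => snd (T x)) ->
  exists I, has_cint 0 alpha (fun x => Cmul (T x) (RtoC (s1 x))) I.
Proof.
  intros H1 H2. destruct Hs1 as [I0 HI0].
  destruct (has_int_mult 0 alpha _ s1 I0 ltac:(lra) H1 HI0) as [I1 HI1].
  destruct (has_int_mult 0 alpha _ s1 I0 ltac:(lra) H2 HI0) as [I2 HI2].
  exists (I1, I2). split; simpl.
  - eapply has_int_ext; [|exact HI1]. intros; simpl; ring.
  - eapply has_int_ext; [|exact HI2]. intros; simpl; ring.
Qed.

Lemma cint_ext (T T' : R -> Cx) I : (forall x, 0 <= x <= alpha -> T x = T' x) ->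
  has_cint 0 alpha T I -> has_cint 0 alpha T' I.
Proof.
  intros E [H1 H2]. split; eapply has_int_ext; try eassumption; intros x Hx; simpl; now rewrite E.
Qed.

Lemma cint_uniq (T : R -> Cx) I I' : has_cint 0 alpha T I -> has_cint 0 alpha T I' -> I = I'.
Proof. intros [] []. apply Cx_eq; eapply has_int_uniq; try eassumption; lra. Qed.

(** Summed over the rays, components 1 and 2 carry the factor [1 + omega + omega^2 = 0], and
    component 0 is counted three times. Existence and uniqueness of the ray integrals give the
    equivalence. *)
Lemma S0int_rays G Gs : on_rays G Gs -> forall I, has_S0int alpha s1 G I <->
  I = (3 * starint (fun t => fst (Gs 0%nat t)), 3 * starint (fun t => snd (Gs 0%nat t))).
Proof.
  intros [HC HE].
  set (T := fun k x => Cadd (Gs 0%nat (x ^ 3)) (Cadd (Cmul (ray k x) (Gs 1%nat (x ^ 3))) (Cmul (Cmul (ray k x) (ray k x)) (Gs 2%nat (x ^ 3))))).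
  assert (HT : forall k, exists I, has_cint 0 alpha (fun x => Cmul (T k x) (RtoC (s1 x))) I).
  { intros k. destruct (HC 0%nat ltac:(lia)) as [C00 C01], (HC 1%nat ltac:(lia)) as [C10 C11], (HC 2%nat ltac:(lia)) as [C20 C21].
    apply cont_cube0 in C00, C01, C10, C11, C20, C21.
    unfold T, ray. destruct (Cpow omega k) as [p q]. apply cint_exists; simpl in *; auto 10 with cont. }
  destruct (HT 0%nat) as [I0 HI0], (HT 1%nat) as [I1 HI1], (HT 2%nat) as [I2 HI2].
  assert (HTG : forall k I, (k < 3)%nat -> has_cint 0 alpha (fun x => Cmul (T k x) (RtoC (s1 x))) I <->
     has_cint 0 alpha (fun x => Cmul (G (Cmul (Cpow omega k) (RtoC x))) (RtoC (s1 x))) I).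
  { intros k I Hk. split; apply cint_ext; intros x Hx; f_equal; [symmetry|]; apply (HE k x Hk Hx). }
  assert (HS : Cadd I0 (Cadd I1 I2) = (3 * starint (fun t => fst (Gs 0%nat t)), 3 * starint (fun t => snd (Gs 0%nat t)))).
  { assert (Hsum : forall x, Cadd (T 0%nat x) (Cadd (T 1%nat x) (T 2%nat x)) = Cmul (RtoC 3) (Gs 0%nat (x ^ 3))).
    { intros x. unfold T, ray. simpl Cpow.
      transitivity (Cadd (Cmul (Cadd C1 (Cadd C1 C1)) (Gs 0%nat (x ^ 3)))
        (Cadd (Cmul (Cmul (Cadd C1 (Cadd omega (Cmul omega omega))) (RtoC x)) (Gs 1%nat (x ^ 3)))
         (Cmul (Cmul (Cmul (Cadd C1 (Cadd (Cpow omega 2) (Cmul omega (Cpow omega 3)))) (RtoC x)) (RtoC x)) (Gs 2%nat (x ^ 3))))).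
      - simpl Cpow. ring.
      - rewrite omega_cube.
        replace (Cadd C1 (Cadd (Cpow omega 2) (Cmul omega C1))) with (Cadd C1 (Cadd omega (Cmul omega omega))) by (simpl; ring).
        rewrite omega_sum. replace (RtoC 3) with (Cadd C1 (Cadd C1 C1)) by (apply Cx_eq; simpl; ring). ring. }
    assert (H0 : has_int 0 alpha (fun _ => 0) 0).
    { destruct Hs1 as [I HI].
      pose proof (has_int_lin 0 alpha s1 s1 I I (-1) ltac:(lra) HI HI) as HJ.
      replace (I + -1 * I) with 0 in HJ by ring.
      eapply has_int_ext; [|exact HJ]. intros; simpl; ring. }
    (* [pr] is the real or the imaginary part. *)
    assert (Hc : forall (pr : Cx -> R), (forall z w, pr (Cadd z w) = pr z + pr w) -> (forall z x, pr (Cmul z (RtoC x)) = pr z * x) ->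
       has_int 0 alpha (fun x => pr (Cmul (T 0%nat x) (RtoC (s1 x)))) (pr I0) ->
       has_int 0 alpha (fun x => pr (Cmul (T 1%nat x) (RtoC (s1 x)))) (pr I1) ->
       has_int 0 alpha (fun x => pr (Cmul (T 2%nat x) (RtoC (s1 x)))) (pr I2) ->
       cont 0 (alpha ^ 3) (fun t => pr (Gs 0%nat t)) ->
       pr (Cadd I0 (Cadd I1 I2)) = 3 * starint (fun t => pr (Gs 0%nat t))).
    { intros pr Ha Hm J0 J1 J2 Hcg. rewrite !Ha.
      assert (HH : has_int 0 alpha (fun x => pr (Gs 0%nat (x ^ 3)) * s1 x) (starint (fun t => pr (Gs 0%nat t)))).
      { unfold starint. apply (has_int_cube 0 alpha s1 (fun t => pr (Gs 0%nat t))); auto; [lra|].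
        replace (0 ^ 3) with 0 by ring. exact Hcg. }
      apply (has_int_uniq 0 alpha (fun x => 3 * (pr (Gs 0%nat (x ^ 3)) * s1 x))); [lra| |].
      - replace (pr I0 + (pr I1 + pr I2)) with (pr I0 + 1 * (pr I1 + 1 * pr I2)) by ring.
        eapply has_int_ext; [|apply has_int_lin; [lra|exact J0|apply has_int_lin; [lra|exact J1|exact J2]]].
        intros x Hx. cbv beta. rewrite !Hm. specialize (Hsum x). apply (f_equal pr) in Hsum.
        rewrite !Ha in Hsum. replace (Cmul (RtoC 3) (Gs 0%nat (x ^ 3))) with (Cmul (Gs 0%nat (x ^ 3)) (RtoC 3)) in Hsum by ring.
        rewrite Hm in Hsum.
        transitivity ((pr (T 0%nat x) + (pr (T 1%nat x) + pr (T 2%nat x))) * s1 x); [ring|]. rewrite Hsum. ring.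
      - replace (3 * starint (fun t => pr (Gs 0%nat t))) with (0 + 3 * starint (fun t => pr (Gs 0%nat t))) by ring.
        eapply has_int_ext; [|apply has_int_lin; [lra|exact H0|exact HH]]. intros; simpl; ring. }
    destruct (HC 0%nat ltac:(lia)) as [C00 C01].
    apply Cx_eq; simpl fst; simpl snd; [apply (Hc fst)|apply (Hc snd)];
      try apply HI0; try apply HI1; try apply HI2; auto; intros; simpl; ring. }
  intros I. split.
  - intros (J0 & J1 & J2 & K0 & K1 & K2 & ->). rewrite <- HS.
    apply HTG in K0; [|lia]. apply HTG in K1; [|lia]. apply HTG in K2; [|lia].
    rewrite (cint_uniq _ _ _ K0 HI0), (cint_uniq _ _ _ K1 HI1), (cint_uniq _ _ _ K2 HI2). reflexivity.
  - intros ->. rewrite <- HS. exists I0, I1, I2.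
    repeat split; try (apply HTG; [lia|assumption]).
Qed.

(** Multiplication by [z^k] moves class [r] to exponents divisible by 3, so [Gs r] becomes component
    0, the only one seen by the star integral. *)
Lemma on_rays_pow G Gs k r i : on_rays G Gs -> (r < 3)%nat -> (3 * i = r + k)%nat ->
  exists Hs, on_rays (fun z => Cmul (G z) (Cpow z k)) Hs /\ Hs 0%nat = fun t => Cmul (RtoC (t ^ i)) (Gs r t).
Proof.
  intros [HC HE] Hr E.
  assert (HP : forall j k x, Cpow (ray k x) (3 * j) = RtoC ((x ^ 3) ^ j)).
  { intros j k0 x. rewrite Cpow_mult, ray_cube, RtoC_pow. reflexivity. }
  assert (r = 0 \/ r = 1 \/ r = 2)%nat as [-> |[-> | ->]] by lia.
  - exists (fun r t => Cmul (RtoC (t ^ i)) (Gs r t)). split; [|reflexivity]. split; [auto with cont|].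
    intros k0 x Hk Hx. rewrite HE by auto. replace k with (3 * i)%nat by lia. rewrite HP. ring.
  - destruct i as [|i]; [lia|].
    exists (fun r t => match r with O => Cmul (RtoC (t ^ S i)) (Gs 1%nat t) | 1%nat => Cmul (RtoC (t ^ S i)) (Gs 2%nat t)
      | _ => Cmul (RtoC (t ^ i)) (Gs 0%nat t) end).
    split; [|reflexivity]. split; [intros [|[|r]] _; apply ccont_mul; auto with cont|].
    intros k0 x Hk Hx. rewrite HE by auto. replace k with (3 * i + 2)%nat by lia. rewrite Cpow_add, HP.
    simpl pow. rewrite RtoC_mul. pose proof (ray_cube k0 x) as Hc. simpl pow in Hc. rewrite <- Hc. simpl. ring.
  - destruct i as [|i]; [lia|].
    exists (fun r t => match r with O => Cmul (RtoC (t ^ S i)) (Gs 2%nat t) | 1%nat => Cmul (RtoC (t ^ i)) (Gs 0%nat t)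
      | _ => Cmul (RtoC (t ^ i)) (Gs 1%nat t) end).
    split; [|reflexivity]. split; [intros [|[|r]] _; apply ccont_mul; auto with cont|].
    intros k0 x Hk Hx. rewrite HE by auto. replace k with (3 * i + 1)%nat by lia. rewrite Cpow_add, HP.
    simpl pow. rewrite RtoC_mul. pose proof (ray_cube k0 x) as Hc. simpl pow in Hc. rewrite <- Hc. simpl. ring.
Qed.

Lemma on_rays_mulreal G G' Gs phi : on_rays G Gs -> cont 0 (alpha ^ 3) phi ->
  (forall k x, (k < 3)%nat -> 0 <= x <= alpha -> G' (ray k x) = Cmul (G (ray k x)) (RtoC (phi (x ^ 3)))) ->
  on_rays G' (fun r t => Cmul (RtoC (phi t)) (Gs r t)).
Proof.
  intros [HC HE] Hphi E. split; [auto with cont|].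
  intros k x Hk Hx. rewrite E, HE by auto. ring.
Qed.
End Star.

(** Treats both parities at once: the [k]-th condition without [F] enters at [m = 2k + 1], the one
    with [F] at [m = 2k + 2]. *)
Lemma Qcond_iff alpha s1 F m Q : Qcond alpha s1 F m Q <->
  (forall k, (2 * k + 1 <= m)%nat -> has_S0int alpha s1 (fun t => Cmul (peval Q t) (Cpow t k)) C0) /\
  (forall k, (2 * k + 2 <= m)%nat -> has_S0int alpha s1 (fun t => Cmul (Cmul (peval Q t) (Cpow t k)) (F t)) C0).
Proof.
  split.
  - intros H. destruct (Nat.Even_or_Odd m) as [[n Hn]|[n Hn]].
    + destruct (proj1 (H n) Hn) as [H1 H2]. split; intros k Hk; [apply H1|apply H2]; lia.
    + destruct (proj2 (H n) Hn) as [H1 H2]. split; intros k Hk; [apply H1|apply H2]; lia.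
  - intros [H1 H2] n. split; intros Hn; split; intros k Hk; [apply H1|apply H2|apply H1|apply H2]; lia.
Qed.

Lemma residue k : exists r i, (r < 3)%nat /\ (3 * i = r + k)%nat.
Proof.
  pose proof (Nat.div_mod_eq k 3). pose proof (Nat.mod_upper_bound k 3 ltac:(lia)).
  assert (k mod 3 = 0 \/ k mod 3 = 1 \/ k mod 3 = 2)%nat as [E|[E|E]] by lia.
  - exists 0%nat, (k / 3)%nat. lia.
  - exists 2%nat, (k / 3 + 1)%nat. lia.
  - exists 1%nat, (k / 3 + 1)%nat. lia.
Qed.

(** * Reduction of [Q_m] and [Psi_m] to real functions of the cube *)

Section Structure.
Variables (alpha : R) (s1 : R -> R) (lo hi : R) (L2 : (R -> R) -> R) (F : Cx -> Cx).
Hypothesis Halpha : 0 < alpha.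
Hypothesis Hs1 : exists I, has_int 0 alpha s1 I.
Let L1 := starint alpha s1.
Hypothesis HL1 : posfun 0 (alpha ^ 3) L1.
Hypothesis HL2 : posfun lo hi L2.
Hypothesis Hhi : hi < 0.
Hypothesis HF : forall k x, (k < 3)%nat -> 0 <= x <= alpha ->
  F (ray k x) = Cmul (Cpow (ray k x) 2) (RtoC (markov L2 (x ^ 3))).

Lemma S0int_zero G Gs : on_rays alpha G Gs -> has_S0int alpha s1 G C0 <->
  L1 (fun t => fst (Gs 0%nat t)) = 0 /\ L1 (fun t => snd (Gs 0%nat t)) = 0.
Proof.
  intros H. rewrite (S0int_rays alpha s1 Halpha Hs1 G Gs H). fold L1. split.
  - intros E. injection E as E1 E2. lra.
  - intros [-> ->]. apply Cx_eq; simpl; ring.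
Qed.

(** Each condition tests a single residue class and, as the functional and [markov L2] are real,
    real and imaginary parts separately. The factor [z^2] of [F] causes the shift by 2. *)
Lemma Qcond_resid m Q Gs : on_rays alpha (peval Q) Gs -> Qcond alpha s1 F m Q <->
  forall r, (r < 3)%nat -> resid_orth L1 L2 m r (fun t => fst (Gs r t)) /\ resid_orth L1 L2 m r (fun t => snd (Gs r t)).
Proof.
  intros HG.
  assert (E1 : forall k r i, (r < 3)%nat -> (3 * i = r + k)%nat ->
    has_S0int alpha s1 (fun t => Cmul (peval Q t) (Cpow t k)) C0 <->
    L1 (fun t => t ^ i * fst (Gs r t)) = 0 /\ L1 (fun t => t ^ i * snd (Gs r t)) = 0).
  { intros k r i Hr E. destruct (on_rays_pow alpha _ _ k r i HG Hr E) as (Hs & HHs & E0).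
    rewrite (S0int_zero _ _ HHs), E0.
    replace (fun t => fst (Cmul (RtoC (t ^ i)) (Gs r t))) with (fun t => t ^ i * fst (Gs r t)) by (extensionality t; simpl; ring).
    replace (fun t => snd (Cmul (RtoC (t ^ i)) (Gs r t))) with (fun t => t ^ i * snd (Gs r t)) by (extensionality t; simpl; ring).
    tauto. }
  assert (E2 : forall k r i, (r < 3)%nat -> (3 * i = r + 2 + k)%nat ->
    has_S0int alpha s1 (fun t => Cmul (Cmul (peval Q t) (Cpow t k)) (F t)) C0 <->
    L1 (fun t => t ^ i * fst (Gs r t) * markov L2 t) = 0 /\ L1 (fun t => t ^ i * snd (Gs r t) * markov L2 t) = 0).
  { intros k r i Hr E. destruct (on_rays_pow alpha _ _ (k + 2) r i HG Hr ltac:(lia)) as (Hs & HHs & E0).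
    pose proof (on_rays_mulreal alpha _ (fun t => Cmul (Cmul (peval Q t) (Cpow t k)) (F t)) Hs (markov L2) HHs
      (markov_continuous lo hi L2 HL2 0 (alpha ^ 3) Hhi)) as HHs'.
    rewrite (S0int_zero _ _ (HHs' ltac:(intros k0 x Hk0 Hx; cbv beta; rewrite HF, Cpow_add by auto; ring))), E0.
    replace (fun t => fst (Cmul (RtoC (markov L2 t)) (Cmul (RtoC (t ^ i)) (Gs r t)))) with (fun t => t ^ i * fst (Gs r t) * markov L2 t) by (extensionality t; simpl; ring).
    replace (fun t => snd (Cmul (RtoC (markov L2 t)) (Cmul (RtoC (t ^ i)) (Gs r t)))) with (fun t => t ^ i * snd (Gs r t) * markov L2 t) by (extensionality t; simpl; ring).
    tauto. }
  rewrite Qcond_iff. split.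
  - intros [H1 H2] r Hr. split; split; intros i k Ei Hk.
    + apply (E1 k r i Hr Ei); auto.
    + apply (E2 k r i Hr Ei); auto.
    + apply (E1 k r i Hr Ei); auto.
    + apply (E2 k r i Hr Ei); auto.
  - intros H. split; intros k Hk.
    + destruct (residue k) as (r & i & Hr & Ei). destruct (H r Hr) as [[A _] [B _]].
      apply (E1 k r i Hr Ei). split; [apply (A i k)|apply (B i k)]; auto.
    + destruct (residue (k + 2)) as (r & i & Hr & Ei). destruct (H r Hr) as [[_ A] [_ B]].
      apply (E2 k r i Hr ltac:(lia)). split; [apply (A i k)|apply (B i k)]; auto; lia.
Qed.

Lemma ccont_polyfun n G : cpolyfun n G -> ccont (alpha ^ 3) G.
Proof. intros [H1 H2]. split; eauto with cont. Qed.

(** Supplies the competitor of degree [m] for the minimality in [IsQ]. *)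
Lemma Qcond_exists m : exists P, monic P /\ length P = S m /\ Qcond alpha s1 F m P.
Proof.
  set (d := (m / 3)%nat). set (r := (m mod 3)%nat).
  assert (Em : (m = 3 * d + r)%nat) by apply Nat.div_mod_eq.
  assert (Hr : (r < 3)%nat) by (apply Nat.mod_upper_bound; lia).
  destruct (resid_exists lo hi (alpha ^ 3) L1 L2 HL1 HL2 Hhi d r Hr) as (g & Hg & Ho). rewrite <- Em in Ho.
  destruct (peval_spread d g Hg) as (Q & HQ & EQ).
  assert (Cg : cont 0 (alpha ^ 3) g) by eauto with cont.
  exists (repeat C0 r ++ (Q ++ [C1])). split; [|split].
  - exists (repeat C0 r ++ Q). now rewrite app_assoc.
  - rewrite !length_app, repeat_length, HQ. simpl. lia.
  - apply (Qcond_resid m _ (fun r' t => if Nat.eq_dec r' r then RtoC (g t + t ^ d) else C0)).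
    + split.
      * intros r' _. destruct (Nat.eq_dec r' r); auto with cont.
      * intros k x Hk Hx. rewrite peval_shift, peval_monic, HQ, (EQ _ _ (ray_cube k x)), Cpow_mult, ray_cube, RtoC_pow, RtoC_add.
        clearbody r. destruct r as [|[|[|]]]; [| | |lia]; simpl; ring.
    + assert (HZ : forall r', resid_orth L1 L2 m r' (fun _ => 0)).
      { intros r'. split; intros i k _ _.
        - replace (fun t => t ^ i * 0) with (fun _ : R => 0) by (extensionality t; ring). apply (pf_zero _ _ _ HL1).
        - replace (fun t => t ^ i * 0 * markov L2 t) with (fun _ : R => 0) by (extensionality t; ring). apply (pf_zero _ _ _ HL1). }
      intros r' Hr'. destruct (Nat.eq_dec r' r) as [-> |Hne]; simpl; split; auto; apply HZ.
Qed.

(** Minimality gives degree at most [m], and [resid_bound] for the class of the leading monomial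
    gives at least [m]. *)
Lemma IsQ_level m Q : IsQ alpha s1 F m Q -> exists d r g, level L1 L2 m d r g /\
  forall k x, (k < 3)%nat -> peval Q (ray k x) = Cmul (Cpow (ray k x) r) (RtoC (g (x ^ 3))).
Proof.
  intros ([q ->] & HQ & Hmin).
  destruct (Qcond_exists m) as (P & HP & HlP & HcP).
  specialize (Hmin P HP HcP). rewrite HlP, length_app in Hmin. simpl in Hmin.
  destruct (peval_split q) as (G & n & HG & EG).
  set (l := length q) in *. set (d := (l / 3)%nat). set (r := (l mod 3)%nat).
  assert (El : (l = 3 * d + r)%nat) by apply Nat.div_mod_eq.
  assert (Hr : (r < 3)%nat) by (apply Nat.mod_upper_bound; lia).
  (* The leading monomial [z^l] belongs to class [r] and contributes [t^d] there. *)
  set (Gs := fun r' t => if Nat.eq_dec r' r then Cadd (G r' t) (RtoC (t ^ d)) else G r' t).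
  assert (EGs : forall k x, peval (q ++ [C1]) (ray k x) =
     Cadd (Gs 0%nat (x ^ 3)) (Cadd (Cmul (ray k x) (Gs 1%nat (x ^ 3))) (Cmul (Cmul (ray k x) (ray k x)) (Gs 2%nat (x ^ 3))))).
  { intros k x. rewrite peval_monic, (EG _ _ (ray_cube k x)). fold l. rewrite El, Cpow_add, Cpow_mult, ray_cube, RtoC_pow.
    unfold Gs. clearbody r. destruct r as [|[|[|]]]; [| | |lia]; simpl; ring. }
  assert (HGs : on_rays alpha (peval (q ++ [C1])) Gs).
  { split; auto. intros r' Hr'. pose proof (ccont_polyfun _ _ (proj1 (HG r' Hr'))). unfold Gs.
    destruct (Nat.eq_dec r' r); auto with cont. }
  pose proof (proj1 (Qcond_resid m _ Gs HGs) HQ) as HQ0. clear HQ. rename HQ0 into HQ.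
  assert (Hbound : forall r' n' g, (r' < 3)%nat -> resid_orth L1 L2 m r' g -> polyfun n' g -> (exists x, g x <> 0) ->
    (m + 3 <= 3 * n' + r')%nat).
  { intros r' n' g. apply (resid_bound lo hi (alpha ^ 3) L1 L2 HL1 HL2 Hhi). }
  set (g := fun t => fst (Gs r t)).
  assert (Hg : polyfun (d + 1) g).
  { unfold g, Gs. destruct (Nat.eq_dec r r) as [_|]; [|tauto]. simpl.
    destruct (HG r Hr) as [[H1 _] Hn]. apply polyfun_add.
    - eapply polyfun_le; [|exact H1]. lia.
    - rewrite Nat.add_1_r. apply polyfun_pow_id. }
  assert (Hgnz : exists x, g x <> 0).
  { unfold g, Gs. destruct (Nat.eq_dec r r) as [_|]; [|tauto]. simpl.
    apply (polyfun_neq_pow d). destruct (HG r Hr) as [[H1 _] Hn]. eapply polyfun_le; [|exact H1]. lia. }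
  pose proof (Hbound r (d + 1)%nat g Hr (proj1 (HQ r Hr)) Hg Hgnz) as Hml.
  assert (Eml : l = m) by lia.
  (* A component whose degree in [z] is below [m] must vanish; this removes the other two classes
     and the imaginary part of the leading one. *)
  assert (Hz : forall r' n' h, (r' < 3)%nat -> resid_orth L1 L2 m r' h -> polyfun n' h -> (3 * n' + r' <= m + 2)%nat -> forall x, h x = 0).
  { intros r' n' h Hr' Ho Hp Hn x. apply NNPP. intros Hx.
    pose proof (Hbound r' n' h Hr' Ho Hp (ex_intro _ x Hx)). lia. }
  exists d, r, g. split.
  - split; [lia|]. split; auto. split; auto. split; auto. apply HQ; auto.
  - assert (Hother : forall r' t, (r' < 3)%nat -> r' <> r -> Gs r' t = C0).
    { intros r' t Hr' Hne. destruct (HG r' Hr') as [[P1 P2] Hn]. destruct (HQ r' Hr') as [O1 O2].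
      unfold Gs in *. destruct (Nat.eq_dec r' r); [tauto|].
      apply Cx_eq.
      - apply (Hz r' _ _ Hr' O1 P1). lia.
      - apply (Hz r' _ _ Hr' O2 P2). lia. }
    assert (Hmain : forall t, Gs r t = RtoC (g t)).
    { intros t. apply Cx_eq; [reflexivity|]. simpl.
      destruct (HG r Hr) as [[P1 P2] Hn]. destruct (HQ r Hr) as [O1 O2].
      apply (Hz r (n r) (fun t => snd (Gs r t)) Hr O2); [|lia].
      eapply polyfun_ext; [|exact P2]. intros x. unfold Gs. destruct (Nat.eq_dec r r); [|tauto]. simpl. ring. }
    intros k x Hk. rewrite EGs. rewrite <- Hmain. clear -Hother Hr. clearbody r.
    assert (r = 0 \/ r = 1 \/ r = 2)%nat as [-> |[-> | ->]] by lia; simpl Cpow.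
    + rewrite (Hother 1%nat), (Hother 2%nat) by lia. ring.
    + rewrite (Hother 0%nat), (Hother 2%nat) by lia. ring.
    + rewrite (Hother 0%nat), (Hother 1%nat) by lia. ring.
Qed.

(** The expansion of [1 / (w - z)] with denominator [w^3 - z^3] shows that [Psi] is [psi] at [z^3]
    times a power of [z] and a constant, and [z] is nonzero. *)
Lemma Psi_zero_psi Q r g z zeta : (r < 3)%nat -> cont 0 (alpha ^ 3) g ->
  (forall k x, (k < 3)%nat -> peval Q (ray k x) = Cmul (Cpow (ray k x) r) (RtoC (g (x ^ 3)))) ->
  Cpow z 3 = RtoC zeta -> zeta < 0 -> Psi_zero alpha s1 Q z <-> psi L1 r g zeta = 0.
Proof.
  intros Hr Cg HQ Hz Hzeta.
  assert (HN : forall t, 0 <= t <= alpha ^ 3 -> t - zeta <> 0) by (intros; lra).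
  set (k := match r with O => 0%nat | _ => 1%nat end).
  set (chi := fun t => t ^ k * g t / (t - zeta)).
  assert (Cchi : cont 0 (alpha ^ 3) chi) by (unfold chi; auto with cont).
  set (phi := fun t => g t / (t - zeta)).
  assert (Cphi : cont 0 (alpha ^ 3) phi) by (unfold phi; auto with cont).
  (* The power of [z] accompanying the term of the kernel selected by [r]. *)
  set (c := match r with O => Cmul z z | 1%nat => C1 | _ => z end).
  assert (Hc : c <> C0).
  { assert (Hz0 : z <> C0).
    { intros ->. simpl in Hz. injection Hz as E _. lra. }
    unfold c. destruct r as [|[|r]]; auto.
    - intros E. apply Cmul_integral in E. tauto.
    - intros E. injection E as E. lra. }
  set (Gs := fun j t => match j with O => Cmul c (RtoC (chi t)) | 1%nat => Cmul (match r with O => z | 1%nat => Cmul z z | _ => RtoC t end) (RtoC (phi t))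
     | _ => Cmul (match r with O => C1 | 1%nat => z | _ => Cmul z z end) (RtoC (phi t)) end).
  assert (HG : on_rays alpha (fun t => Cdiv (peval Q t) (Csub t z)) Gs).
  { split.
    - intros [|[|j]] _; unfold Gs; destruct r as [|[|r]]; auto with cont.
    - intros j x Hj Hx. set (w := ray j x). set (t := x ^ 3).
      assert (Ht : 0 <= t <= alpha ^ 3).
      { unfold t. split; [apply pow_le; lra|apply cube_le; lra]. }
      assert (Hw : Cpow w 3 = RtoC t) by apply ray_cube.
      unfold Cdiv. rewrite (Cinv_unique _ (Cmul (Cadd (Cmul w w) (Cadd (Cmul w z) (Cmul z z))) (RtoC (/ (t - zeta))))).
      + unfold w at 1. rewrite HQ by auto. fold w. fold t.
        assert (Ephi : RtoC (phi t) = Cmul (RtoC (g t)) (RtoC (/ (t - zeta)))) by apply RtoC_mul.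
        unfold Gs, c, chi, k. fold t.
        assert (r = 0 \/ r = 1 \/ r = 2)%nat as [-> |[-> | ->]] by lia; rewrite Ephi.
        * replace (t ^ 0 * g t / (t - zeta)) with (phi t) by (unfold phi, Rdiv; ring). rewrite Ephi. simpl. ring.
        * replace (t ^ 1 * g t / (t - zeta)) with (t * phi t) by (unfold phi, Rdiv; ring). rewrite RtoC_mul, Ephi, <- Hw. simpl. ring.
        * replace (t ^ 1 * g t / (t - zeta)) with (t * phi t) by (unfold phi, Rdiv; ring). rewrite RtoC_mul, Ephi, <- Hw. simpl. ring.
      + transitivity (Cmul (Csub (Cpow w 3) (Cpow z 3)) (RtoC (/ (t - zeta)))); [simpl; ring|].
        rewrite Hw, Hz. replace (Csub (RtoC t) (RtoC zeta)) with (RtoC (t - zeta)) by (apply Cx_eq; simpl; ring).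
        rewrite <- RtoC_mul, Rinv_r by auto. reflexivity. }
  unfold Psi_zero. rewrite (S0int_zero _ _ HG). unfold psi. fold k.
  change (fun t => t ^ k * g t / (t - zeta)) with chi.
  assert (E1 : L1 (fun t => fst (Gs 0%nat t)) = fst c * L1 chi).
  { rewrite <- (pf_scal _ _ _ HL1) by auto. f_equal. extensionality t. simpl. ring. }
  assert (E2 : L1 (fun t => snd (Gs 0%nat t)) = snd c * L1 chi).
  { rewrite <- (pf_scal _ _ _ HL1) by auto. f_equal. extensionality t. simpl. ring. }
  rewrite E1, E2. split.
  - intros [Z1 Z2]. apply NNPP. intros Hne. apply Hc.
    apply Rmult_integral in Z1, Z2. apply Cx_eq; simpl; tauto.
  - intros ->. split; ring.
Qed.
End Structure.

(** On the star [z^3] is real, so the integrand is real and the complex integral reduces to the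
    Markov function at [x^3]. *)
Lemma markov_on_rays alpha a b s2 F : 0 < a < b -> (exists I, has_int (- b) (- a) s2 I) ->
  (forall z, inS0 alpha z ->
     exists I, has_cint (- b) (- a)
                 (fun t => Cdiv (RtoC (s2 t)) (Csub (Cpow z 3) (RtoC (t ^ 3)))) I /\
               F z = Cmul (Cpow z 2) I) ->
  forall k x, (k < 3)%nat -> 0 <= x <= alpha ->
    F (ray k x) = Cmul (Cpow (ray k x) 2)
      (RtoC (markov (fun f => Int (- b) (- a) (fun t => f (t ^ 3) * s2 t)) (x ^ 3))).
Proof.
  intros Hab Hs2 HF k x Hk Hx. destruct (HF (ray k x)) as (I & [H1 H2] & ->).
  { exists k, x. auto. }
  f_equal. rewrite ray_cube in H1, H2.
  assert (Hx3 : 0 <= x ^ 3) by (apply pow_le; lra).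
  assert (Ha3 : (- a) ^ 3 < 0).
  { replace 0 with (0 ^ 3) by ring. apply cube_lt; lra. }
  assert (HN : forall u, (- b) ^ 3 <= u <= (- a) ^ 3 -> x ^ 3 - u <> 0) by (intros; lra).
  assert (Hcu : forall t, - b <= t <= - a -> x ^ 3 - t ^ 3 <> 0).
  { intros t Ht. apply HN. split; apply cube_le; lra. }
  assert (HM : has_int (- b) (- a) (fun t => / (x ^ 3 - t ^ 3) * s2 t)
    (markov (fun f => Int (- b) (- a) (fun t => f (t ^ 3) * s2 t)) (x ^ 3))).
  { apply (has_int_cube (- b) (- a) s2 (fun u => / (x ^ 3 - u))); auto with cont. lra. }
  assert (H0 : has_int (- b) (- a) (fun t => 0) 0).
  { destruct Hs2 as [J HJ].
    pose proof (has_int_lin (- b) (- a) s2 s2 J J (-1) ltac:(lra) HJ HJ) as HJ'.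
    replace (J + -1 * J) with 0 in HJ' by ring.
    eapply has_int_ext; [|exact HJ']. intros; simpl; ring. }
  apply Cx_eq; cbn [fst snd RtoC].
  - apply (has_int_uniq (- b) (- a) (fun t => / (x ^ 3 - t ^ 3) * s2 t)); [lra| |exact HM].
    eapply has_int_ext; [|exact H1]. intros t Ht. specialize (Hcu t Ht).
    unfold Cdiv, Cmul, Cinv, Csub, Cadd, Copp, RtoC; cbn [fst snd]. field.
    exact Hcu.
  - apply (has_int_uniq (- b) (- a) (fun t => 0)); [lra| |exact H0].
    eapply has_int_ext; [|exact H2]. intros t Ht.
    unfold Cdiv, Cmul, Cinv, Csub, Cadd, Copp, RtoC; cbn [fst snd]. unfold Rdiv. ring.
Qed.

Theorem theorem1p4
  (alpha a b : R) (s1 s2 : R -> R) (F : Cx -> Cx)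
  (Halpha : 0 < alpha) (Hab : 0 < a < b)
  (Hs1pos : forall x, 0 < x < alpha -> 0 <= s1 x)
  (Hs1L1 : exists I, has_int 0 alpha s1 I)
  (Hs1nz : ~ ae_on 0 alpha (fun x => s1 x = 0))
  (Hs2pos : forall x, - b <= x <= - a -> 0 <= s2 x)
  (Hs2L1 : exists I, has_int (- b) (- a) s2 I)
  (Hs2nz : ~ ae_on (- b) (- a) (fun x => s2 x = 0))
  (HF : forall z, inS0 alpha z ->
     exists I, has_cint (- b) (- a)
                 (fun t => Cdiv (RtoC (s2 t)) (Csub (Cpow z 3) (RtoC (t ^ 3)))) I /\
               F z = Cmul (Cpow z 2) I) :
  forall (n : nat) (Qn Qn1 : cpoly),
    IsQ alpha s1 F n Qn -> IsQ alpha s1 F (S n) Qn1 ->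
    (* no common zeros of Q_n, Q_{n+1} in S0 \ {0} *)
    (forall z, inS0 alpha z -> z <> C0 ->
       ~ (peval Qn z = C0 /\ peval Qn1 z = C0)) /\
    (* interlacing of zeros on (0, alpha) *)
    (forall x y, 0 < x -> x < y -> y < alpha ->
       Q_zero Qn x -> Q_zero Qn y -> (forall w, x < w < y -> ~ Q_zero Qn w) ->
       exists! w, x < w < y /\ Q_zero Qn1 w) /\
    (forall x y, 0 < x -> x < y -> y < alpha ->
       Q_zero Qn1 x -> Q_zero Qn1 y -> (forall w, x < w < y -> ~ Q_zero Qn1 w) ->
       exists! w, x < w < y /\ Q_zero Qn w) /\
    (* no common zeros of Psi_n, Psi_{n+1} in S1 *)
    (forall z, inS1 a b z ->
       ~ (Psi_zero alpha s1 Qn z /\ Psi_zero alpha s1 Qn1 z)) /\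
    (* interlacing of zeros on (-b, -a) *)
    (forall x y, - b < x -> x < y -> y < - a ->
       Psi_zero alpha s1 Qn (RtoC x) -> Psi_zero alpha s1 Qn (RtoC y) ->
       (forall w, x < w < y -> ~ Psi_zero alpha s1 Qn (RtoC w)) ->
       exists! w, x < w < y /\ Psi_zero alpha s1 Qn1 (RtoC w)) /\
    (forall x y, - b < x -> x < y -> y < - a ->
       Psi_zero alpha s1 Qn1 (RtoC x) -> Psi_zero alpha s1 Qn1 (RtoC y) ->
       (forall w, x < w < y -> ~ Psi_zero alpha s1 Qn1 (RtoC w)) ->
       exists! w, x < w < y /\ Psi_zero alpha s1 Qn (RtoC w)).
Proof.
  intros n Qn Qn1 HQn HQn1.
  set (L2 := fun f => Int (- b) (- a) (fun t => f (t ^ 3) * s2 t)).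
  assert (HL1 : posfun 0 (alpha ^ 3) (starint alpha s1)).
  { replace 0 with (0 ^ 3) by ring. apply posfun_int; auto. }
  assert (HL2 : posfun ((- b) ^ 3) ((- a) ^ 3) L2).
  { apply posfun_int; auto; [lra|]. intros; apply Hs2pos; lra. }
  assert (Hhi : (- a) ^ 3 < 0).
  { replace 0 with (0 ^ 3) by ring. apply cube_lt; lra. }
  pose proof (markov_on_rays alpha a b s2 F Hab Hs2L1 HF) as HF'. fold L2 in HF'.
  destruct (IsQ_level alpha s1 _ _ L2 F Halpha Hs1L1 HL1 HL2 Hhi HF' n Qn HQn) as (d & r & g & Hl & E).
  destruct (IsQ_level alpha s1 _ _ L2 F Halpha Hs1L1 HL1 HL2 Hhi HF' (S n) Qn1 HQn1) as (d' & r' & g' & Hl' & E').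
  pose proof (level_wpair _ _ _ _ _ HL1 HL2 Hhi _ _ _ _ _ _ _ Hl Hl') as W.
  pose proof (level_psi_wpair _ _ _ _ _ HL1 HL2 Hhi _ _ _ _ _ _ _ Hl Hl') as WP.
  assert (Hr : (r < 3)%nat) by apply Hl. assert (Hr' : (r' < 3)%nat) by apply Hl'.
  assert (Cg : cont 0 (alpha ^ 3) g) by (eapply polyfun_cont; apply Hl).
  assert (Cg' : cont 0 (alpha ^ 3) g') by (eapply polyfun_cont; apply Hl').
  assert (Hzero : forall Q r g, (forall k x, (k < 3)%nat -> peval Q (ray k x) = Cmul (Cpow (ray k x) r) (RtoC (g (x ^ 3)))) ->
    forall k x, (k < 3)%nat -> ray k x <> C0 -> (peval Q (ray k x) = C0 <-> g (x ^ 3) = 0)).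
  { clear. intros Q r g E k x Hk Hnz. rewrite E by auto. split.
    - intros H. apply Cmul_integral in H. destruct H as [H|H]; [apply Cpow_eq0 in H; contradiction|].
      now injection H.
    - intros ->. change (RtoC 0) with C0. ring. }
  assert (Hreal : forall x, RtoC x = ray 0 x) by (intros; unfold ray; simpl; ring).
  assert (HQz : forall Q r g, (forall k x, (k < 3)%nat -> peval Q (ray k x) = Cmul (Cpow (ray k x) r) (RtoC (g (x ^ 3)))) ->
    forall x, 0 < x -> (g (x ^ 3) = 0 <-> Q_zero Q x)).
  { intros Q r0 g0 E0 x Hx. unfold Q_zero. rewrite Hreal. symmetry. apply (Hzero Q r0 g0 E0); [lia|].
    rewrite <- Hreal. intros H. injection H as H. lra. }
  assert (Hneg : forall x, x < 0 -> x ^ 3 < 0).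
  { intros x Hx. replace 0 with (0 ^ 3) by ring. now apply cube_lt. }
  assert (HP : forall Q r g, (r < 3)%nat -> cont 0 (alpha ^ 3) g ->
    (forall k x, (k < 3)%nat -> peval Q (ray k x) = Cmul (Cpow (ray k x) r) (RtoC (g (x ^ 3)))) ->
    forall k x, x < 0 -> (psi (starint alpha s1) r g (x ^ 3) = 0 <-> Psi_zero alpha s1 Q (ray k x))).
  { intros Q r0 g0 Hr0 Cg0 E0 k x Hx. symmetry.
    apply (Psi_zero_psi alpha s1 Halpha Hs1L1 HL1 Q r0 g0); auto using ray_cube. }
  (* Off the origin the factor [x^r] has no zeros and cubing has nonzero derivative, so the
     Wronskian property returns to the variable [x]. *)
  assert (WQ : wpair (fun x => 0 < x) (Q_zero Qn) (Q_zero Qn1)).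
  { apply (wpair_ext (fun x => 0 < x) _ (fun x => g (x ^ 3) = 0) (fun x => g' (x ^ 3) = 0)); auto.
    - intros x Hx. apply (HQz Qn r g E x Hx).
    - intros x Hx. apply (HQz Qn1 r' g' E' x Hx).
    - apply (wpair_cube _ (fun t => g t = 0) (fun t => g' t = 0)); [intros; lra|].
      apply (wpair_ext (fun t => 0 < t) _ (fun t => g t = 0) (fun t => g' t = 0)); [|tauto|tauto|exact W].
      intros t (x0 & Hx0 & ->). apply pow_lt; auto. }
  assert (WPsi : wpair (fun x => x < 0) (fun x => Psi_zero alpha s1 Qn (RtoC x)) (fun x => Psi_zero alpha s1 Qn1 (RtoC x))).
  { apply (wpair_ext (fun x => x < 0) _ (fun x => psi (starint alpha s1) r g (x ^ 3) = 0)
      (fun x => psi (starint alpha s1) r' g' (x ^ 3) = 0)); auto.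
    - intros x Hx. rewrite Hreal. apply (HP Qn r g Hr Cg E 0%nat x Hx).
    - intros x Hx. rewrite Hreal. apply (HP Qn1 r' g' Hr' Cg' E' 0%nat x Hx).
    - apply (wpair_cube _ (fun t => psi (starint alpha s1) r g t = 0) (fun t => psi (starint alpha s1) r' g' t = 0)); [intros; lra|].
      apply (wpair_ext (fun t => t < 0) _ (fun t => psi (starint alpha s1) r g t = 0)
        (fun t => psi (starint alpha s1) r' g' t = 0)); [|tauto|tauto|exact WP].
      intros t (x0 & Hx0 & ->). auto. }
  split; [|split; [|split; [|split; [|split]]]].
  (* Cubing sends all three rays to the same real interval, so common zeros on any ray reduce to the
     real case. *)
  - intros z (k & x & Hk & Hx & ->) Hz [Z1 Z2]. fold (ray k x) in *.
    apply (Hzero Qn r g E) in Z1; auto. apply (Hzero Qn1 r' g' E') in Z2; auto.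
    apply (wpair_no_common _ _ _ (x ^ 3) W); [|auto].
    apply pow_lt. destruct (Req_dec x 0) as [-> |]; [|lra]. exfalso. apply Hz.
    unfold ray. change (RtoC 0) with C0. ring.
  - intros x y H0 Hxy Hy. apply (wpair_interlace _ _ _ x y WQ); auto. intros; lra.
  - intros x y H0 Hxy Hy. apply (wpair_interlace _ _ _ x y (wpair_sym _ _ _ WQ)); auto. intros; lra.
  - intros z (k & x & Hk & Hx & ->) [Z1 Z2]. fold (ray k x) in *.
    apply (HP Qn r g Hr Cg E) in Z1; [|lra]. apply (HP Qn1 r' g' Hr' Cg' E') in Z2; [|lra].
    apply (wpair_no_common _ _ _ (x ^ 3) WP); [apply Hneg; lra|auto].
  - intros x y H0 Hxy Hy. apply (wpair_interlace _ _ _ x y WPsi); auto. intros; lra.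
  - intros x y H0 Hxy Hy. apply (wpair_interlace _ _ _ x y (wpair_sym _ _ _ WPsi)); auto. intros; lra.
Qed.
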